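(* Let $\Delta$ be a purely $n$-dimensional fan in $V$, $\dim V=n$, and let $\mathcal E^\bullet$ be a minimal extension sheaf on $\Delta$. The following statements are equivalent: (i) For each cone $\sigma\in\Delta$, $\tilde H^\bullet(\Delta_\sigma,\partial\Delta_\sigma;\mathbb R)=0$. (ii) $\tilde H^\bullet(\Delta,\partial\Delta;\mathcal E^\bullet)=0$. (iii) The fan $\Delta$ is quasi-convex, i.e., the $A^\bullet$-module $E^\bullet_\Delta=\mathcal E^\bullet(\Delta)$ is free.
   Context: $V$ is a real vector space of finite dimension $n$. A cone in $V$ is a strictly convex polyhedral cone: a finite intersection $\sigma=\bigcap_i H_{\alpha_i}$ of half-spaces $H_\alpha=\{v:\alpha(v)\ge0\}$ ($\alpha$ a nonzero linear form) with $\bigcap_i\ker\alpha_i=\{0\}$. $V_\sigma:=\sigma+(-\sigma)$, $\dim\sigma:=\dim V_\sigma$, $o=\{0\}$. A face $\tau\preceq\sigma$ is $\sigma\cap\ker\beta$ with $\beta\in V^*$, $\sigma\subset H_\beta$; $\tau\prec_1\sigma$ means $\tau$ is a facet (face with $\dim\tau=\dim\sigma-1$). A fan is a nonempty finite set of cones containing all faces of its members such that the intersection of any two members is a face of both. A subfan is a subset which is a fan (the empty subfan is admitted). $\Delta^k$ is the set of $k$-dimensional cones of $\Delta$. $\langle\sigma\rangle$ is the fan of all faces of $\sigma$, $\partial\sigma=\langle\sigma\rangle\setminus\{\sigma\}$. $\Delta$ is purely $n$-dimensional if all its maximal cones have dimension $n$; then $\partial\Delta$ is the subfan generated by the $(n-1)$-cones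 that are facets of exactly one $n$-cone of $\Delta$ (empty if there are none). Fan space: the open sets of $\Delta$ are the subfans (including $\emptyset$). A sheaf $\mathcal F$ on $\Delta$ is the same as a collection $\mathcal F(\sigma):=\mathcal F(\langle\sigma\rangle)$, $\sigma\in\Delta$, with functorial restriction maps for $\tau\preceq\sigma$. Write $F_\Lambda=\mathcal F(\Lambda)$, $F_\sigma=\mathcal F(\sigma)$. The constant sheaf is denoted $\mathbb R$. $A^\bullet=S^\bullet(V^* )$ with $A^{2q}=S^q(V^* )$, $\mathfrak m=A^{>0}$, $\mathbb R^\bullet=A^\bullet/\mathfrak m$ (concentrated in degree $0$); $\overline F{}^\bullet:=F^\bullet/\mathfrak mF^\bullet$. $A_\sigma^\bullet:=S^\bullet(V_\sigma^* )$ graded likewise; $\mathcal A^\bullet$ is the sheaf with $\mathcal A^\bullet(\sigma)=A^\bullet_\sigma$ and natural restrictions. A minimal extension sheaf on $\Delta$ is a sheaf $\mathcal E^\bullet$ of graded $\mathcal A^\bullet$-modules such that: (N) $E^\bullet_o\cong\mathbb R^\bullet$; (PF) $E^\bullet_\sigma$ is a free $A^\bullet_\sigma$-module for each $\sigma\in\Delta$; (LME) for each $\sigma\in\Delta\setminus\{o\}$ the restriction $E^\bullet_\sigma\to E^\bullet_{\partial\sigma}$ induces an isomorphism $\overline E{}^\bullet_\sigma\cong\overline E{}^\bullet_{\partial\sigma}$. It exists and is unique up to isomorphism. Transversal fan: for $\sigma\in\Delta$, $\Delta_\sigma:=\{p(\gamma):\sigma\preceq\gamma\in\Delta\}$, a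 fan in $V/V_\sigma$, where $p:V\to V/V_\sigma$ is the quotient map. Cellular cochain complex: for a sheaf $\mathcal F$ of real vector spaces, $C^k(\Delta;\mathcal F)=\bigoplus_{\dim\sigma=n-k}\mathcal F(\sigma)$, $0\le k\le n$. Fix an orientation of each $V_\sigma$, the same for all $\sigma\in\Delta^n$; for $\tau\prec_1\sigma$ let $\mathrm{or}^\sigma_\tau=1$ if the orientation of $V_\tau$ followed by the inward normal is the orientation of $V_\sigma$, and $-1$ otherwise. The coboundary is $\delta(f)_\tau=\sum_{\sigma\succ_1\tau}\mathrm{or}^\sigma_\tau f_\sigma|_\tau$. Put $C^\bullet(\Delta,\partial\Delta;\mathcal F)=C^\bullet(\Delta;\mathcal F)/C^\bullet(\partial\Delta;\mathcal F)$, where $C^k(\partial\Delta;\mathcal F)=\bigoplus_{\sigma\in\partial\Delta,\dim\sigma=n-k}\mathcal F(\sigma)$. The augmented complex is $0\to F_\Delta\to C^0(\Delta,\partial\Delta;\mathcal F)\to\cdots\to C^n(\Delta,\partial\Delta;\mathcal F)\to0$ with $F_\Delta$ in degree $-1$ and first map given by restriction; $\tilde H^q(\Delta,\partial\Delta;\mathcal F)$ is its cohomology. For $\Delta_\sigma$ the same definitions are used with $V$ replaced by $V/V_\sigma$ and $n$ by $n-\dim\sigma$. *)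

(* Defs.v *)
From HB Require Import structures.
From mathcomp Require Import all_boot all_order all_algebra finmap mpoly.
From mathcomp Require Import boolp classical_sets reals.

Set Implicit Arguments.
Unset Strict Implicit.
Unset Printing Implicit Defensive.

Import Order.TTheory GRing.Theory Num.Theory.

Local Open Scope classical_set_scope.
Local Open Scope ring_scope.

Section Cones.
Variables (R : realType) (V : vectType R).
Implicit Types (s t : set V) (U W : {vspace V}).

(* The linear forms are listed in a sequence; the empty sequence is allowed and
   gives a strictly convex cone only when V = 0. *)
Definition is_cone s : Prop :=
  exists l : seq 'Hom(V, R^o),
    [/\ forall a, a \in l -> a != 0,
        s = [set v | forall a, a \in l -> 0 <= a v]
      & forall v, (forall a, a \in l -> a v = 0) -> v = 0].

(* V_s := s + (-s); the default value 0 is only used when this set is not a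
   subspace, which does not happen for cones (see [mem_lspan]). *)
Definition lspan s : {vspace V} :=
  xget 0%VS [set U : {vspace V} |
    forall v, v \in U <-> exists a b, [/\ s a, s b & v = a - b]].

Definition cone_dim s : nat := \dim (lspan s).

Definition face t s : Prop :=
  exists b : 'Hom(V, R^o),
    (forall v, s v -> 0 <= b v) /\ t = [set v | s v /\ b v = 0].

Definition facet t s : Prop := face t s /\ (cone_dim t).+1 = cone_dim s.

Definition is_fan (D : {fset set V}) : Prop :=
  [/\ D != fset0,
      forall s, s \in D -> is_cone s,
      forall s t, s \in D -> face t s -> t \in D
    & forall s t, s \in D -> t \in D -> face (s `&` t) s /\ face (s `&` t) t].

Record fan := Fan { fan_cones :> {fset set V}; fanP : is_fan fan_cones }.

Definition purely_dim (n : nat) (D : {fset set V}) : Prop :=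
  forall s, s \in D -> (forall t, t \in D -> s `<=` t -> t = s) ->
  cone_dim s = n.

Lemma lspan_subspace (P : set V) : P 0 ->
  (forall (c : R) u v, P u -> P v -> P (c *: u + v)) ->
  exists U : {vspace V}, forall v, v \in U <-> P v.
Proof.
move=> P0 PD.
pose Q k := `[< exists U : {vspace V}, \dim U = k /\ forall v, v \in U -> P v >].
have exQ : exists k, Q k.
  by exists 0%N; apply/asboolP; exists 0%VS; rewrite dimv0; split=> // v;
    rewrite memv0 => /eqP ->.
have leQ k : Q k -> (k <= \dim {:V})%N.
  by move=> /asboolP[U [<- _]]; apply/dimvS/subvf.
case: (ex_maxnP exQ leQ) => k /asboolP[U [dU PU]] maxk.
exists U => v; split; first exact: PU.
move=> Pv; apply: contrapT => /negP vU.
have : Q (\dim (U + <[v]>)).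
  apply/asboolP; exists (U + <[v]>)%VS; split=> // w /memv_addP[u uU [x]].
  by move=> /vlineP[c ->] ->; rewrite addrC; apply: PD => //; apply: PU.
move/maxk; rewrite -dU leqNgt => /negP; apply.
have sUv : (U <= U + <[v]>)%VS by exact: addvSl.
rewrite ltn_neqAle (dimvS sUv) andbT; apply/negP => /eqP dE.
have /eqP EU : U == (U + <[v]>)%VS by rewrite eqEdim sUv dE leqnn.
by move: vU; rewrite EU (subvP (addvSr U <[v]>)) ?memv_line.
Qed.

Lemma mem_lspan s : is_cone s ->
  forall v, v \in lspan s <-> exists a b, [/\ s a, s b & v = a - b].
Proof.
case=> l [_ -> _]; rewrite /lspan.
set S := [set U : {vspace V} | _].
suff : exists U, S U by move/(xgetPex 0%VS).
apply: lspan_subspace.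
  by exists 0, 0; rewrite subr0; split=> // a _; rewrite linear0.
move=> c u v [a [b [sa sb ->]]] [a' [b' [sa' sb' ->]]].
have [c0|c0] := lerP 0 c.
  exists (c *: a + a'), (c *: b + b'); split.
  - by move=> x xl; rewrite linearD linearZ addr_ge0 ?mulr_ge0 ?sa ?sa'.
  - by move=> x xl; rewrite linearD linearZ addr_ge0 ?mulr_ge0 ?sb ?sb'.
  - by rewrite scalerBr opprD !addrA; congr (_ - _); rewrite -!addrA;
      congr (_ + _); rewrite addrC.
have c1 : 0 <= - c by rewrite oppr_ge0 ltW.
exists (- c *: b + a'), (- c *: a + b'); split.
- by move=> x xl; rewrite linearD linearZ addr_ge0 ?mulr_ge0 ?sb ?sa'.
- by move=> x xl; rewrite linearD linearZ addr_ge0 ?mulr_ge0 ?sa ?sb'.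
- rewrite scalerBr !scaleNr opprD opprK !addrA; congr (_ - _).
  by rewrite [c *: a - _]addrC -!addrA; congr (_ + _); rewrite addrC.
Qed.

Lemma lspan_face s t : is_cone s -> is_cone t -> face t s ->
  (lspan t <= lspan s)%VS.
Proof.
move=> cs ct [b [_ tE]]; apply/subvP => v.
move/(mem_lspan ct) => [x [y [tx ty ->]]]; apply/(mem_lspan cs).
by exists x, y; move: tx ty; rewrite tE => -[? _] [? _].
Qed.

(* The quotient space V/U is realized on the complement U^C, the quotient map
   being the projection along U. *)
Definition quot U : vectType R := subvs_of (U^C)%VS.

Definition quot_proj U : 'Hom(V, quot U) :=
  (linfun (vsproj (U^C)%VS) \o daddv_pi (U^C) U)%VF.

Lemma quot_projE U v : vsval (quot_proj U v) = daddv_pi (U^C) U v.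
Proof. by rewrite comp_lfunE lfunE /= vsprojK ?memv_pi. Qed.

Lemma quot_proj_split U v :
  v = vsval (quot_proj U v) + daddv_pi U (U^C) v.
Proof.
by rewrite quot_projE daddv_pi_add // ?[(U^C + U)%VS]addvC ?addv_complf ?memvf //
  capvC capv_compl.
Qed.

Lemma lker_quot_proj U : lker (quot_proj U) = U.
Proof.
apply/vspaceP => v; rewrite memv_ker; apply/eqP/idP => [v0|vU].
  by rewrite (quot_proj_split U v) v0 linear0 add0r memv_pi.
apply/val_inj; rewrite -[LHS]/(vsval _) linear0.
move: (quot_proj_split U v); rewrite daddv_pi_id ?capv_compl // => E.
by apply: (addIr v); rewrite -E add0r.
Qed.

Lemma limg_quot_proj U : limg (quot_proj U) = fullv.
Proof.
apply/vspaceP => w; rewrite memvf; apply/memv_imgP.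
exists (vsval w); rewrite ?memvf //; apply: val_inj => /=.
by rewrite -[RHS]/(vsval _) quot_projE daddv_pi_id ?subvsP // capvC capv_compl.
Qed.

Definition transversal_fan (D : {fset set V}) s : {fset set (quot (lspan s))} :=
  [fset (quot_proj (lspan s) @` g)%classic | g in D & `[< face s g >]]%fset.

(* The symmetric algebra of the dual of U is {mpoly R[\dim U]}, the variables
   being the basis dual to vbasis U. Its component of degree 2q consists of the
   homogeneous polynomials of degree q. For W <= U, symres U W is the morphism
   induced by the restriction of linear forms. *)
Definition symres U W : {mpoly R[\dim U]} -> {mpoly R[\dim W]} :=
  comp_mpoly [tuple \sum_(j < \dim W)
    coord (vbasis U) i (vbasis W)`_j *: 'X_j | i < \dim U].
Arguments symres U W p : clear implicits.

Lemma comp_mpolyA (m n k : nat) (p : {mpoly R[m]}) (u : m.-tuple {mpoly R[n]})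
    (v : n.-tuple {mpoly R[k]}) :
  (p \mPo u) \mPo v = p \mPo [tuple tnth u i \mPo v | i < m].
Proof.
rewrite [p \mPo u]comp_mpolyE [RHS]comp_mpolyE raddf_sum /=.
apply: eq_bigr => x _; rewrite linearZ /= rmorph_prod; congr (_ *: _).
by apply: eq_bigr => i _; rewrite rmorphXn tnth_mktuple.
Qed.

Lemma symres_comp U1 U2 U3 p : (U3 <= U2)%VS ->
  symres U2 U3 (symres U1 U2 p) = symres U1 U3 p.
Proof.
move=> s32; rewrite /symres comp_mpolyA; congr (_ \mPo _).
have XE m k (t : m.-tuple {mpoly R[k]}) (j : 'I_m) : 'X_j \mPo t = tnth t j.
  by rewrite comp_mpolyXU (tnth_nth 0).
apply: eq_from_tnth => i; rewrite !tnth_mktuple raddf_sum /=.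
under eq_bigr => j _ do rewrite linearZ /= XE tnth_mktuple scaler_sumr.
rewrite exchange_big; apply: eq_bigr => k _ /=.
under eq_bigr => j _ do rewrite scalerA.
rewrite -scaler_suml; congr (_ *: _).
have bk : (vbasis U3)`_k \in U2.
  by apply: (subvP s32); apply/vbasis_mem/mem_nth; rewrite size_tuple.
rewrite [in RHS](coord_vbasis bk) linear_sum /=.
by apply: eq_bigr => j _; rewrite linearZ /= mulrC.
Qed.

(* Evaluating polynomials at the coordinates of a vector turns symres into the restriction of functions. *)
Lemma symres_eval U W (p : {mpoly R[\dim U]}) v : v \in W ->
  (symres U W p).@[fun j => coord (vbasis W) j v]
  = p.@[fun i => coord (vbasis U) i v].
Proof.
move=> vW; rewrite /symres comp_mpoly_meval; apply: meval_eq => i.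
rewrite tnth_mktuple raddf_sum /= [in RHS](coord_vbasis vW) linear_sum /=.
by apply: eq_bigr => j _; rewrite mevalZ mevalXU linearZ /= mulrC.
Qed.

(* An orientation is one of the two classes of ordered bases of U, given by its
   indicator function on ordered bases; the values on other sequences are
   irrelevant. For U = 0 the only basis is [::], but there still are two
   orientations. *)
Definition is_orientation U (o : seq V -> bool) : Prop :=
  forall b b' : (\dim U).-tuple V, basis_of U b -> basis_of U b' ->
    (o b == o b') = (0 < \det (\matrix_(i, j) coord b j b'`_i)).

Record orientation (D : {fset set V}) := Orientation {
  ori :> D -> seq V -> bool;
  oriP : forall s : D, is_orientation (lspan (val s)) (ori s);
  ori_top : forall s t : D, cone_dim (val s) = \dim {:V} ->
    cone_dim (val t) = \dim {:V} ->
    forall b, basis_of {:V} b -> ori s b = ori t b }.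

(* An inward normal of s along its facet t is any vector of s outside V_t. *)
Definition incidence (D : {fset set V}) (o : orientation D) (s t : D) : int :=
  if `[< exists b v, [/\ basis_of (lspan (val t)) b, val s v,
           v \notin lspan (val t) & o t b = o s (rcons b v)] >]
  then 1 else -1.

Definition closed_star (D : {fset set V}) (s : D) : {set D} :=
  [set t : D | `[< face (val t) (val s) >]]%SET.

Definition bd_cone (D : {fset set V}) (s : D) : {set D} :=
  (closed_star s :\ s)%SET.

Definition bd_fan (D : {fset set V}) : {set D} :=
  [set t : D | `[< exists r : D,
     [/\ (cone_dim (val r)).+1 = \dim {:V},
         #|[set s : D | (cone_dim (val s) == \dim {:V})
                         && `[< facet (val r) (val s) >]]%SET| = 1%N
       & face (val t) (val r)] >]]%SET.

End Cones.

Arguments symres {R V} U W p.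
Arguments bd_fan {R V} D.

(* A sheaf of abelian groups on the fan space, given by its values on the open
   sets of faces of single cones. The restriction from s to t is meaningful only
   if t is a face of s; the other values are irrelevant. *)
Record fan_sheaf (R : realType) (V : vectType R) (D : {fset set V}) :=
  FanSheaf {
    stalk :> D -> zmodType;
    res : forall s t : D, {additive stalk s -> stalk t};
    res_id : forall s x, res s s x = x;
    res_comp : forall s t r x, face (val t) (val s) -> face (val r) (val t) ->
      res t r (res s t x) = res s r x }.

Definition constant_sheaf (R : realType) (V : vectType R) (D : {fset set V}) :
    fan_sheaf D :=
  @FanSheaf R V D (fun _ => R : zmodType) (fun _ _ => idfun)
    (fun _ _ => erefl) (fun _ _ _ _ _ _ => erefl).

Section Sections.
Variables (R : realType) (V : vectType R) (D : {fset set V}).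
Variables (F : fan_sheaf D).

Definition compatible (L : {set D}) (x : forall s : D, s \in L -> F s) : Prop :=
  forall (s t : D) (hs : s \in L) (ht : t \in L), face (val t) (val s) ->
    res F s t (x s hs) = x t ht.

Definition sections (L : {set D}) := {x : forall s : D, s \in L -> F s | compatible x}.

Definition sec_val L (x : sections L) : forall s : D, s \in L -> F s := sval x.
Arguments sec_val {L} x s hs.

Lemma sections_ext L (x y : sections L) :
  (forall s hs, sec_val x s hs = sec_val y s hs) -> x = y.
Proof.
case: x y => [x cx] [y cy] /= E.
have {}E : x = y by apply: functional_extensionality_dep => s; apply: funext => h; exact: E.
by subst y; congr exist; exact: Prop_irrelevance.
Qed.

Variable L : {set D}.

Lemma sec0_subproof : @compatible L (fun s _ => 0).
Proof. by move=> s t hs ht _; rewrite raddf0. Qed.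

Lemma secN_subproof (x : sections L) : @compatible L (fun s hs => - sec_val x s hs).
Proof. by move=> s t hs ht st; rewrite raddfN (svalP x _ _ hs ht st). Qed.

Lemma secD_subproof (x y : sections L) :
  @compatible L (fun s hs => sec_val x s hs + sec_val y s hs).
Proof.
by move=> s t hs ht st;
  rewrite raddfD (svalP x _ _ hs ht st) (svalP y _ _ hs ht st).
Qed.

Definition sec0 : sections L := exist _ _ sec0_subproof.
Definition secN x : sections L := exist _ _ (secN_subproof x).
Definition secD x y : sections L := exist _ _ (secD_subproof x y).

Lemma secDA : associative secD.
Proof. by move=> x y z; apply: sections_ext => s hs; exact: addrA. Qed.
Lemma secDC : commutative secD.
Proof. by move=> x y; apply: sections_ext => s hs; exact: addrC. Qed.
Lemma sec0D : left_id sec0 secD.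
Proof. by move=> x; apply: sections_ext => s hs; exact: add0r. Qed.
Lemma secND : left_inverse sec0 secN secD.
Proof. by move=> x; apply: sections_ext => s hs; exact: addNr. Qed.

HB.instance Definition _ := gen_eqMixin (sections L).
HB.instance Definition _ := gen_choiceMixin (sections L).
HB.instance Definition _ := GRing.isZmodule.Build (sections L)
  secDA secDC sec0D secND.

End Sections.

Arguments sec_val {R V D F L} x s hs.

(* In the definitions below a cochain on D is a family x of elements x s of F s
   indexed by all cones, C^k being the families supported in codimension k. *)
Section Cellular.
Variables (R : realType) (V : vectType R) (D : {fset set V}).
Variables (o : orientation D) (F : fan_sheaf D).
Local Notation n := (\dim {:V}).
Local Notation family := (forall s : D, F s).

Definition cochain (k : nat) (x : family) : Prop :=
  forall s : D, (cone_dim (val s) + k)%N <> n -> x s = 0.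

Definition bd_cochain (k : nat) (x : family) : Prop :=
  cochain k x /\ forall s : D, s \notin bd_fan D -> x s = 0.

Definition coboundary (x : family) : family := fun t =>
  \sum_(s : D | `[< facet (val t) (val s) >]) res F s t (x s) *~ incidence o s t.

Definition augmentation (x : sections F [set: D]%SET) : family := fun s =>
  if cone_dim (val s) == n then sec_val x s (finset.in_setT s) else 0.

(* Relative cochains are classes modulo bd_cochain. Vanishing of the reduced
   relative cohomology in the degrees -1, 0 and k + 1. *)
Definition reduced_acyclic : Prop :=
  [/\ forall x, bd_cochain 0 (augmentation x) -> x = 0,
      forall x, cochain 0 x -> bd_cochain 1 (coboundary x) ->
        exists y, bd_cochain 0 (fun s => x s - augmentation y s)
    & forall k x, cochain k.+1 x -> bd_cochain k.+2 (coboundary x) ->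
        exists2 y, cochain k y &
          bd_cochain k.+1 (fun s => x s - coboundary y s)].

End Cellular.

(* The basis B need not be finite. *)
Definition free_module (A : pzRingType) (M : lmodType A) : Prop :=
  exists B : set M,
    (forall (l : seq M) (c : M -> A), uniq l -> (forall b, b \in l -> B b) ->
       \sum_(b <- l) c b *: b = 0 -> forall b, b \in l -> c b = 0)
    /\ (forall x, exists (l : seq M) (c : M -> A),
          (forall b, b \in l -> B b) /\ x = \sum_(b <- l) c b *: b).

(* M is the direct sum of its additive subgroups g d. *)
Definition is_grading (M : zmodType) (g : int -> set M) : Prop :=
  [/\ forall d, g d 0 /\ (forall x y, g d x -> g d y -> g d (x - y)),
      forall x, exists (l : seq int) (c : int -> M),
        (forall d, g d (c d)) /\ x = \sum_(d <- l) c d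
    & forall (l : seq int) (c : int -> M), uniq l -> (forall d, g d (c d)) ->
        \sum_(d <- l) c d = 0 -> forall d, d \in l -> c d = 0].

Section MaximalIdeal.
Variables (R : realType) (n : nat).

(* A^{>0} M, where A^{>0} consists of the polynomials without constant term. *)
Definition mideal_mul (M : lmodType {mpoly R[n]}) : set M :=
  [set x | exists l : seq ({mpoly R[n]} * M),
     (forall p, p \in l -> p.1@_0%MM = 0) /\ x = \sum_(p <- l) p.1 *: p.2].

(* The map M/mM -> N/mN induced by f is bijective. *)
Definition reduction_iso (M N : lmodType {mpoly R[n]}) (f : {linear M -> N}) :
    Prop :=
  (forall x, mideal_mul (f x) -> mideal_mul x) /\
  (forall y, exists x, mideal_mul (y - f x)).

End MaximalIdeal.

(* Sheaves of graded modules over the sheaf s |-> {mpoly R[\dim (lspan s)]}.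
   The grading of a module sheaf is by all integers. *)
Record gmod_sheaf (R : realType) (V : vectType R) (D : fan V) := GmodSheaf {
  mstalk :> forall s : D, lmodType {mpoly R[\dim (lspan (val s))]};
  mres : forall s t : D, {additive mstalk s -> mstalk t};
  mres_id : forall s x, mres s s x = x;
  mres_comp : forall s t r x, face (val t) (val s) -> face (val r) (val t) ->
    mres t r (mres s t x) = mres s r x;
  mres_scale : forall s t a x, face (val t) (val s) ->
    mres s t (a *: x) = symres (lspan (val s)) (lspan (val t)) a *: mres s t x;
  mdegree : forall s : D, int -> set (mstalk s);
  mdegree_grading : forall s, is_grading (@mdegree s);
  mdegree_scale : forall (s : D) (q : nat) (d : int)
      (a : {mpoly R[\dim (lspan (val s))]}) (x : mstalk s),
    a \is q.-homog -> mdegree d x -> mdegree (d + (2 * q)%N%:Z) (a *: x);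
  mdegree_res : forall (s t : D) (d : int) (x : mstalk s),
    face (val t) (val s) -> mdegree d x -> mdegree d (mres s t x) }.

Section ModuleSections.
Variables (R : realType) (V : vectType R) (D : fan V) (E : gmod_sheaf D).

Definition sheaf_of_gmod : fan_sheaf D :=
  @FanSheaf R V D (fun s => E s : zmodType) (mres E) (@mres_id _ _ _ E)
    (@mres_comp _ _ _ E).

Definition msections (L : {set D}) : Type := sections sheaf_of_gmod L.

HB.instance Definition _ (L : {set D}) :=
  GRing.Zmodule.copy (msections L) (sections sheaf_of_gmod L).

Variable L : {set D}.

Definition secZ_val (a : {mpoly R[\dim {:V}]}) (x : msections L) (s : D)
    (hs : s \in L) : E s :=
  symres {:V} (lspan (val s)) a *: (sec_val x s hs : E s).

Lemma fan_lspan_face (s t : D) : face (val t) (val s) ->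
  (lspan (val t) <= lspan (val s))%VS.
Proof. by case: (fanP D) => _ cD _ _ /lspan_face; apply; apply: cD; apply: valP. Qed.

Lemma secZ_subproof a x : @compatible _ _ _ sheaf_of_gmod L (secZ_val a x).
Proof.
move=> s t hs ht st; rewrite /secZ_val /= mres_scale // symres_comp ?fan_lspan_face //.
by congr (_ *: _); exact: (svalP x _ _ hs ht st).
Qed.

Definition secZ a x : msections L := exist _ _ (secZ_subproof a x).

Lemma secZA a b x : secZ a (secZ b x) = secZ (a * b) x.
Proof.
by apply: sections_ext => s hs /=; rewrite /secZ_val /= scalerA /symres rmorphM.
Qed.
Lemma sec1Z : left_id 1 secZ.
Proof. by move=> x; apply: sections_ext => s hs /=; rewrite /secZ_val /symres rmorph1 scale1r. Qed.
Lemma secZDr : right_distributive secZ +%R.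
Proof. by move=> a x y; apply: sections_ext => s hs; exact: scalerDr. Qed.
Lemma secZDl x : {morph secZ^~ x : a b / a + b}.
Proof.
by move=> a b; apply: sections_ext => s hs /=; rewrite /secZ_val /symres rmorphD; exact: scalerDl.
Qed.

HB.instance Definition _ :=
  GRing.Zmodule_isLmodule.Build {mpoly R[\dim {:V}]} (msections L)
    secZA sec1Z secZDr secZDl.

End ModuleSections.

Section Restriction.
Variables (R : realType) (V : vectType R) (D : fan V) (E : gmod_sheaf D).
Variables (L L' : {set D}) (sL : L' \subset L).

Lemma restrict_subproof (x : msections E L) : @compatible _ _ _ (sheaf_of_gmod E) L'
  (fun s hs => sec_val x s (fintype.subsetP sL s hs)).
Proof. by move=> s t hs ht st; exact: (svalP x). Qed.

Definition restrict (x : msections E L) : msections E L' :=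
  exist _ _ (restrict_subproof x).

Lemma restrict_linear : linear restrict.
Proof. by move=> a x y; apply: sections_ext. Qed.

HB.instance Definition _ :=
  GRing.isLinear.Build {mpoly R[\dim {:V}]} (msections E L) (msections E L') _
    restrict restrict_linear.

End Restriction.

Lemma bd_cone_sub (R : realType) (V : vectType R) (D : {fset set V}) (s : D) :
  bd_cone s \subset closed_star s.
Proof. exact: subD1set. Qed.

Record minimal_extension_sheaf (R : realType) (V : vectType R) (D : fan V)
    (E : gmod_sheaf D) : Prop := {
  (* a@_0 is the image of a in A / A^{>0} = R *)
  mes_N : forall s : D, val s = [set 0] ->
    exists f : E s -> R,
      [/\ bijective f, forall x y, f (x + y) = f x + f y,
          forall a x, f (a *: x) = a@_0%MM * f x
        & forall d x, mdegree d x <-> (d = 0 \/ f x = 0)];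
  mes_PF : forall s : D, free_module (E s);
  mes_LME : forall s : D, val s <> [set 0] ->
    reduction_iso (restrict (E := E) (bd_cone_sub s)) }.

Definition quasi_convex (R : realType) (V : vectType R) (D : fan V)
    (E : gmod_sheaf D) : Prop :=
  free_module (msections E [set: D]%SET).

(* Main.v *)
(* On the cones containing sigma, the cellular complex of Delta with constant
   coefficients is the complex of the transversal fan of sigma up to signs; call
   it the star complex of sigma.
   (i) => (ii): E is flabby. Filtering its sections by the smallest dimension of
   the cones on which they do not vanish, the complex of E is built from star
   complexes with coefficients in the kernels of E_sigma -> E_(bd sigma).
   (ii) => (i): a nonzero element of this kernel extends by zero to a section
   supported on the star of sigma; multiplication with it embeds the star complex
   of sigma in the complex of E, and a functional on E_sigma retracts it.
   (ii) => (iii): generic linear forms are regular on the modules of the complex,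
   hence on the sections of E if the complex is exact, and then the quotient
   complex is again exact one degree shorter. So E_Delta has a regular sequence of
   n linear forms and is free, by Nakayama.
   (iii) => (i): by induction on the degree and by descending induction on the
   dimension of sigma. The lift of a class of the star complex of sigma to the
   complex of E is killed by the forms vanishing on sigma, because the complexes
   of larger cones are exact; a sufficiently long generic sequence of such forms
   is regular on the complex, which forces the class to vanish. In the extreme
   degrees, where the sequence is too short, the star complexes of any purely
   n-dimensional fan are exact, because the cones around sigma are connected
   through the walls which are not in the boundary. *)
From HB Require Import structures.
Require Import Defs.
From mathcomp Require Import all_boot all_order all_algebra finmap mpoly.
From mathcomp Require Import boolp classical_sets reals.
From mathcomp Require Import ring lra zify.

Set Implicit Arguments.
Unset Strict Implicit.
Unset Printing Implicit Defensive.

Import Order.TTheory GRing.Theory Num.Theory.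

Local Open Scope classical_set_scope.
Local Open Scope ring_scope.

(** * Cones and fans *)

(** The reach of the algebra in (iii) => (i) is decided by a count. Let sigma have codimension c.
    The forms vanishing on V_sigma make up a space of dimension c, and on a cone of codimension k
    they restrict to a space of dimension at least c - k. So up to c - k generic ones are regular on
    its stalk, and up to c of them on E_Delta; this is where freeness of E_Delta enters. A class of
    degree m is pushed down one degree per form until it reaches the sections, which takes m + 2
    forms. Hence the argument covers m + 1 < c, and m = c - 1 and m = c are the extreme degrees left
    to the geometry of the fan. The modules are graded by all integers and may have infinite rank.
    Nakayama's lemma needs degrees bounded below, and this bound is deduced from freeness and (LME)
    by induction on the dimension of the cone. Cochains are families indexed by all cones, with
    conditions only on the interior cones of the right codimension, so that no relative quotient has
    to be formed. *)

Section ConeBasics.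
Variables (R : realType) (V : vectType R).
Implicit Types (s t : set V) (a b : 'Hom(V, R^o)).

Lemma homD a u v : a (u + v) = a u + a v :> R. Proof. exact: (raddfD a). Qed.
Lemma homB a u v : a (u - v) = a u - a v :> R. Proof. exact: (raddfB a). Qed.
Lemma homN a u : a (- u) = - a u :> R. Proof. exact: (raddfN a). Qed.
Lemma homZ a c u : a (c *: u) = c * a u :> R. Proof. exact: (linearZ_LR a c u). Qed.
Lemma hom0 a : a 0 = 0 :> R. Proof. exact: (raddf0 a). Qed.

(** The ratio test of the simplex method: [c] is the least quotient [a u / a z] over the forms in
    [P] that are positive at [z], so [u - c *: z] is where the half-line from [u] along [- z] leaves
    the region they cut out. *)
Lemma hom_pos_min (l : seq 'Hom(V, R^o)) (u z : V) (P : pred 'Hom(V, R^o)) :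
  (forall a, a \in l -> P a -> 0 <= a u) ->
  (exists2 a, (a \in l) && P a & 0 < a z) ->
  exists c, [/\ 0 <= c,
    forall a, a \in l -> P a -> 0 <= a (u - c *: z) &
    exists2 a, (a \in l) && P a & 0 < a z /\ a (u - c *: z) = 0].
Proof.
move=> Hu [x /andP[/(nthP 0)[i0 il xE] Px] xz].
pose Q (i : 'I_(size l)) := P l`_i && (0 < l`_i z).
have Q0 : Q (Ordinal il) by rewrite /Q /= xE Px.
case: (arg_minP (fun i : 'I_(size l) => l`_i u / l`_i z) Q0) => i /andP[Pi zi] mini.
have il' : l`_i \in l by exact: mem_nth.
have c0 : 0 <= l`_i u / l`_i z by rewrite divr_ge0 ?Hu // ltW.
exists (l`_i u / l`_i z); split=> //; last first.
  by exists l`_i; rewrite ?il' // homB homZ divfK ?subrr ?gt_eqF.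
move=> d dl Pd; rewrite homB homZ subr_ge0; have [dz|dz] := ltrP 0 (d z); last first.
  by apply: le_trans (Hu d dl Pd); rewrite mulr_ge0_le0.
rewrite -ler_pdivlMr //; have /(nthP 0)[j jl dE] := dl.
by have := mini (Ordinal jl); rewrite /Q /= dE Pd dz; apply.
Qed.

Lemma cone0 s : is_cone s -> s 0.
Proof. by case=> l [_ -> _] a _; rewrite hom0. Qed.

Lemma coneD s u v : is_cone s -> s u -> s v -> s (u + v).
Proof. by case=> l [_ -> _] su sv a al; rewrite homD addr_ge0 ?su ?sv. Qed.

Lemma coneZ s c u : is_cone s -> 0 <= c -> s u -> s (c *: u).
Proof. by case=> l [_ -> _] c0 su a al; rewrite homZ mulr_ge0 ?su. Qed.

Lemma face_sub t s v : face t s -> t v -> s v.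
Proof. by case=> b [_ ->] []. Qed.

(** Faces are extreme subsets: two nonnegative values of the supporting form with sum zero both
    vanish. *)
Lemma face_addl t s u v : face t s -> s u -> s v -> t (u + v) -> t u.
Proof.
case=> b [b0 ->] su sv [_]; rewrite homD => /eqP.
by rewrite paddr_eq0 ?b0 // => /andP[/eqP].
Qed.

Lemma lspan_mem s v : is_cone s -> s v -> v \in lspan s.
Proof.
by move=> cs sv; apply/(mem_lspan cs); exists v, 0; rewrite subr0; split=> //; exact: cone0.
Qed.

Lemma lspan_eq0 s (b : 'Hom(V, R^o)) : is_cone s ->
  (forall v, s v -> b v = 0) -> forall v, v \in lspan s -> b v = 0.
Proof.
move=> cs b0 v /(mem_lspan cs)[x [y [sx sy ->]]].
by rewrite homB (b0 _ sx) (b0 _ sy) subrr.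
Qed.

Lemma lspan_subv s (U : {vspace V}) : is_cone s ->
  (forall v, s v -> v \in U) -> (lspan s <= U)%VS.
Proof.
move=> cs sU; apply/subvP => v /(mem_lspan cs)[x [y [sx sy ->]]].
by rewrite rpredB ?sU.
Qed.

Lemma pos_off_face s t b v : is_cone t -> (forall u, s u -> 0 <= b u) ->
  (forall u, t u <-> s u /\ b u = 0) -> s v -> v \notin lspan t -> 0 < b v.
Proof.
move=> ct bp bE sv vt; rewrite lt_neqAle bp // andbT eq_sym; apply/eqP => E.
by case/negP: vt; apply: lspan_mem => //; apply/bE.
Qed.

Lemma line_disjoint (U : {vspace V}) v : v \notin U -> (U :&: <[v]> = 0)%VS.
Proof.
move=> vU; apply/eqP; rewrite -subv0; apply/subvP => w.
rewrite memv_cap => /andP[wU /vlineP[k E]]; move: wU; rewrite E rpredZeq (negbTE vU) orbF.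
by move=> /eqP ->; rewrite scale0r mem0v.
Qed.

Lemma dimv_add_line (U : {vspace V}) v : v \notin U -> \dim (U + <[v]>) = (\dim U).+1.
Proof.
move=> vU; rewrite dimv_disjoint_sum ?line_disjoint //.
by rewrite dim_vline (_ : v != 0) ?addn1 //; apply: contraNneq vU => ->; exact: mem0v.
Qed.

Lemma lspan_top s : cone_dim s = \dim {:V} -> lspan s = {:V}%VS.
Proof. by move=> sd; apply/eqP; rewrite eqEdim subvf -/(cone_dim s) sd /=. Qed.

(* A relative interior point of [t], as far as the forms of [l] can tell. *)
Lemma relint_exists (l : seq 'Hom(V, R^o)) t : is_cone t ->
  (forall a v, a \in l -> t v -> 0 <= a v) ->
  exists2 w, t w & forall a, a \in l -> a w = 0 -> forall v, t v -> a v = 0.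
Proof.
move=> ct; elim: l => [|a l IH] Hl; first by exists 0; [exact: cone0|].
have [|w tw Hw] := IH; first by move=> b v bl; apply: Hl; rewrite inE bl orbT.
have [az|] := pselect (forall v, t v -> a v = 0).
  exists w => // b; rewrite inE => /orP[/eqP-> _|]; [exact: az|exact: Hw].
move=> /existsNP[v /not_implyP[tv /eqP av]].
exists (w + v); first exact: coneD.
move=> b; rewrite inE homD => /orP[/eqP->|bl] /eqP.
  rewrite paddr_eq0 ?Hl ?mem_head // => /andP[_].
  by rewrite (negbTE av).
rewrite paddr_eq0 ?Hl ?inE ?bl ?orbT // => /andP[/eqP/(Hw _ bl) //].
Qed.

(** The tangent cone [s - t] of [s] along [t]; it equals [s + V_t] when [t] is contained in [s]. *)
Definition loc s t v : Prop := exists2 w, t w & s (v + w).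

(** Only the forms vanishing at [w] constrain [v]; the others are made nonnegative by a large
    multiple of [w]. *)
Lemma forms_push (l : seq 'Hom(V, R^o)) v w :
  (forall a, a \in l -> 0 <= a w) -> (forall a, a \in l -> a w = 0 -> 0 <= a v) ->
  exists2 N : R, 0 <= N & forall a, a \in l -> 0 <= a (v + N *: w).
Proof.
elim: l => [|a l IH] lw Hw; first by exists 0.
have [||N N0 HN] := IH.
- by move=> b bl; apply: lw; rewrite inE bl orbT.
- by move=> b bl; apply: Hw; rewrite inE bl orbT.
have aw := lw a (mem_head _ _).
(* The increment is [0] when [a w = 0], since division by zero gives [0]. *)
exists (N + `|a v| / a w); first by rewrite addr_ge0 // divr_ge0.
move=> b; rewrite inE => /orP[/eqP->|bl]; rewrite scalerDl addrA homD homZ.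
  rewrite homD homZ.
  have [aw0|aw0] := eqVneq (a w) 0.
    by rewrite aw0 !mulr0 !addr0 Hw ?mem_head.
  rewrite -mulrA mulVf // mulr1.
  have := mulr_ge0 N0 aw; have := ler_norm (- a v); rewrite normrN; lra.
by rewrite addr_ge0 ?HN // mulr_ge0 ?divr_ge0 // lw // inE bl orbT.
Qed.

(** The forms that matter are those vanishing on [t]: a relative interior point of [t] makes all the
    others positive, so [forms_push] applies. *)
Lemma loc_forms s t (l : seq 'Hom(V, R^o)) : is_cone t -> t `<=` s ->
  s = [set v | forall a, a \in l -> 0 <= a v] ->
  forall v, loc s t v <->
    (forall a, a \in l -> (forall u, t u -> a u = 0) -> 0 <= a v).
Proof.
move=> ct ts sE v; split.
  case=> w tw; rewrite sE => /= H a al at0; move: (H a al).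
  by rewrite homD (at0 w tw) addr0.
move=> H.
have [|w tw Hw] := @relint_exists l t ct.
  by move=> a u al /ts; rewrite sE => /(_ a al).
have [||N N0 HN] := @forms_push l v w.
- by move=> a al; move: (ts _ tw); rewrite {1}sE => /(_ a al).
- by move=> a al aw; apply: H => // u; exact: Hw.
by exists (N *: w); [exact: coneZ|rewrite sE].
Qed.

Lemma loc_sub s t v : is_cone t -> s v -> loc s t v.
Proof. by move=> ct sv; exists 0; [exact: cone0|rewrite addr0]. Qed.

(** The lineality space of the tangent cone is V_t: the two witnesses in [s] add up to an element of
    [t], and [t] is extreme. *)
Lemma loc_both s t v : is_cone t -> face t s ->
  loc s t v -> loc s t (- v) -> v \in lspan t.
Proof.
move=> ct ts [w tw sw] [w' tw' sw'].
have : t ((v + w) + (- v + w')).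
  by rewrite addrACA subrr add0r; exact: coneD.
move/(face_addl ts sw sw') => tvw.
by rewrite -[v](addrK w) rpredB // lspan_mem.
Qed.

End ConeBasics.

(** * Faces inside a fan, ray shooting, rays of a star *)

Section FanBasics.
Variables (R : realType) (V : vectType R) (D : fan V).
Implicit Types (s t r g : set V) (a b : 'Hom(V, R^o)).

Lemma fan_cone s : s \in fan_cones D -> is_cone s.
Proof. by case: (fanP D) => _ + _ _; apply. Qed.

Lemma face_fan s t : s \in fan_cones D -> face t s -> t \in fan_cones D.
Proof. by case: (fanP D) => _ _ + _; apply. Qed.

(* In a fan the face relation is inclusion: t = s /\ t is a face of s. *)
Lemma face_fanE s t : s \in fan_cones D -> t \in fan_cones D -> face t s <-> t `<=` s.
Proof.
move=> sD tD; split; first by move=> ts v; exact: face_sub.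
move=> ts; case: (fanP D) => _ _ _ /(_ _ _ sD tD)[+ _].
by rewrite (_ : s `&` t = t) //; apply/setIidr.
Qed.

Lemma fan_setI s t : s \in fan_cones D -> t \in fan_cones D -> s `&` t \in fan_cones D.
Proof.
move=> sD tD; apply: (face_fan sD).
by case: (fanP D) => _ _ _ /(_ _ _ sD tD)[].
Qed.

Lemma fan_ker s b : s \in fan_cones D -> (forall v, s v -> 0 <= b v) ->
  s `&` [set v | b v = 0] \in fan_cones D.
Proof.
by move=> sD b0; apply: (face_fan sD); exists b; split=> //; apply/seteqP; split.
Qed.

Lemma lspanS s t : s \in fan_cones D -> t \in fan_cones D -> t `<=` s -> (lspan t <= lspan s)%VS.
Proof.
by move=> sD tD ts; apply: lspan_face; [exact: fan_cone..|exact/face_fanE].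
Qed.

Lemma cone_dimS s t : s \in fan_cones D -> t \in fan_cones D -> t `<=` s ->
  (cone_dim t <= cone_dim s)%N.
Proof. by move=> sD tD ts; apply/dimvS/lspanS. Qed.

Lemma setI_lspan s t v : s \in fan_cones D -> t \in fan_cones D -> t `<=` s ->
  s v -> v \in lspan t -> t v.
Proof.
move=> sD tD /(face_fanE sD tD)[b [b0 tE]] sv vt.
rewrite tE; split=> //.
by apply: (lspan_eq0 (fan_cone tD) _ vt) => u; rewrite tE => -[].
Qed.

Lemma cone_dim_eq s t : s \in fan_cones D -> t \in fan_cones D -> t `<=` s ->
  (cone_dim s <= cone_dim t)%N -> t = s.
Proof.
move=> sD tD ts le; apply/seteqP; split=> // v sv.
apply: (setI_lspan sD tD ts sv).
have /eqP -> : lspan t == lspan s by rewrite eqEdim lspanS.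
exact: (lspan_mem (fan_cone sD)).
Qed.

Lemma cone_dim_lt s t : s \in fan_cones D -> t \in fan_cones D -> t `<=` s -> t <> s ->
  (cone_dim t < cone_dim s)%N.
Proof.
move=> sD tD ts; apply: contra_notT; rewrite -leqNgt; exact: cone_dim_eq.
Qed.

(** By strict convexity the sum of the defining forms is a supporting form that vanishes on the cone
    only at the origin. *)
Lemma set0_fan : [set 0] \in fan_cones D.
Proof.
case: (fanP D) => /fset0Pn[s sD] _ _ _; have [l [l0 sE lc]] := fan_cone sD.
apply: (face_fan sD); exists (\sum_(a <- l) a)%R.
have bE v : (\sum_(a <- l) a) v = \sum_(a <- l) (a v : R).
  by rewrite sum_lfunE.
have pos v : s v -> forall a, a \in l -> 0 <= a v by rewrite sE => /(_ _ _).
split.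
  by move=> v sv; rewrite bE big_seq sumr_ge0 // => a al; exact: pos.
apply/seteqP; split=> v /=.
  by move=> ->; split; [exact: (cone0 (fan_cone sD))|rewrite hom0].
case=> sv; rewrite bE => /eqP; rewrite big_seq psumr_eq0; last by move=> a; apply: pos.
move=> /allP H; apply: lc => a al; have := H a al.
by rewrite al => /eqP.
Qed.

Lemma set0_sub s : s \in fan_cones D -> [set 0] `<=` s.
Proof. by move=> sD v ->; exact: (cone0 (fan_cone sD)). Qed.

Lemma cone_dim_eq0 s : s \in fan_cones D -> cone_dim s = 0%N -> s = [set 0].
Proof.
move=> sD s0; apply/esym/cone_dim_eq => //; [exact: set0_fan|exact: set0_sub|].
by rewrite s0.
Qed.

Lemma loc_fan_both s t v : s \in fan_cones D -> t \in fan_cones D -> t `<=` s ->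
  loc s t v -> loc s t (- v) -> v \in lspan t.
Proof.
by move=> sD tD ts; apply: loc_both; [exact: fan_cone|exact/face_fanE].
Qed.

(** The half-line from [u] along [- z] leaves the tangent cone because [- z] is not in it. The form
    [a] is the first to become tight and cuts out the face [f]; adding [w] moves the exit point from
    the tangent cone back into [s]. *)
Lemma shoot s t u z : s \in fan_cones D -> t \in fan_cones D -> t `<=` s ->
  loc s t u -> ~ loc s t (- z) ->
  exists c f w a, [/\ 0 <= c, f \in fan_cones D, t `<=` f & f `<=` s] /\
   [/\ t w, f (u - c *: z + w), forall v, s v -> 0 <= a v,
       (forall v, f v <-> s v /\ a v = 0) & 0 < a z].
Proof.
move=> sD tD ts; have [l [l0 sE lc]] := fan_cone sD.
have ct := fan_cone tD.
have lF := loc_forms ct ts sE.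
move=> /lF Hu nz.
pose P a := `[< forall u, t u -> a u = 0 >].
have Hu' a : a \in l -> P a -> 0 <= a u by move=> al /asboolP; exact: Hu.
have ex : exists2 a, (a \in l) && P a & 0 < a z.
  apply: contrapT => nex; apply: nz; apply/lF => a al at0; rewrite homN oppr_ge0.
  by rewrite leNgt; apply/negP => az; apply: nex; exists a; rewrite // al; apply/asboolP.
have [c [c0 Hc [a /andP[al /asboolP at0] [az ac]]]] := hom_pos_min Hu' ex.
have spos v : s v -> 0 <= a v by rewrite sE => /(_ a al).
have [|w tw sw] := iffRL (lF (u - c *: z)).
  by move=> b bl bt; apply: Hc => //; apply/asboolP.
exists c, (s `&` [set v | a v = 0]), w, a; split; split=> //.
- exact: fan_ker.
- by move=> v tv; split; [exact: ts|exact: at0].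
- by split=> //=; rewrite homD ac at0 // addr0.
Qed.

Lemma shoot_proper s z a f : s \in fan_cones D -> z \in lspan s -> 0 < a z ->
  (forall v, f v <-> s v /\ a v = 0) -> f <> s.
Proof.
move=> sD zs az fE fs; subst f.
suff : a z = 0 by move=> H; rewrite H ltxx in az.
by apply: (lspan_eq0 (fan_cone sD) _ zs) => v /fE[].
Qed.

Lemma vspace_ltP (U W : {vspace V}) : (\dim U < \dim W)%N ->
  exists2 v, v \in W & v \notin U.
Proof.
move=> lt; have /subvPn[v vW vU] : ~~ (W <= U)%VS.
  by apply: contraL lt => /dimvS; rewrite -leqNgt.
by exists v.
Qed.

Lemma cone_not_lspan s t : s \in fan_cones D -> t \in fan_cones D -> t `<=` s -> t <> s ->
  exists2 u, s u & u \notin lspan t.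
Proof.
move=> sD tD ts tns; apply: contrapT => nex; apply: tns.
apply: (cone_dim_eq sD tD ts); apply/dimvS/(lspan_subv (fan_cone sD)) => v sv.
by apply: contrapT => /negP vt; apply: nex; exists v.
Qed.

(** With [u] in [s] and [z] independent of [u] modulo V_t, shooting from [u] along [- z] ends on a
    proper face. It is not [t], for the exit point is outside V_t. *)
Lemma intermediate s t : s \in fan_cones D -> t \in fan_cones D -> t `<=` s ->
  (cone_dim t + 2 <= cone_dim s)%N ->
  exists f, [/\ f \in fan_cones D, t `<=` f, f `<=` s, f <> t & f <> s].
Proof.
move=> sD tD ts dts.
have [|u su ut] := cone_not_lspan sD tD ts.
  by move=> E; move: dts; rewrite E; lia.
have [z zs zt] : exists2 z, z \in lspan s & z \notin (lspan t + <[u]>)%VS.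
  have [le _] := dimv_add_leqif (lspan t) <[u]>.
  apply: vspace_ltP; apply: (leq_ltn_trans le); rewrite dim_vline.
  by move: dts; rewrite /cone_dim; case: (u != 0) => /=; lia.
(* If both [z] and [- z] were tangent, [z] would lie in V_t; so one of the two signs is
   admissible. *)
wlog nz : z zs zt / ~ loc s t (- z).
  move=> H; have [l1|] := pselect (loc s t (- z)); last exact: H.
  apply: (H (- z)); rewrite ?rpredN // opprK => l2.
  have := loc_fan_both sD tD ts l2 l1 => zt'.
  by move: zt; rewrite (subvP (addvSl _ _)).
have [c [f [w [a [[c0 fD tf fs] [tw fw apos fE az]]]]]] :=
  shoot sD tD ts (loc_sub (fan_cone tD) su) nz.
have fns := shoot_proper sD zs az fE.
exists f; split=> //.
move=> ft; subst f.
have yt : u - c *: z \in lspan t.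
  by rewrite -[_ - _](addrK w) rpredB ?lspan_mem //; exact: fan_cone.
have [c00|c00] := eqVneq c 0.
  by move: yt; rewrite c00 scale0r subr0 (negbTE ut).
case/negP: zt.
have -> : z = c^-1 *: (- (u - c *: z)) + c^-1 *: u.
  by rewrite -scalerDr opprB subrK scalerA mulVf // scale1r.
by rewrite memv_add // ?memvZ ?rpredN ?memv_line.
Qed.

(** Modulo V_t such an [r] is a ray of the star of [t], hence the name. *)
Lemma ray_exists s t : s \in fan_cones D -> t \in fan_cones D -> t `<=` s -> t <> s ->
  exists r, [/\ r \in fan_cones D, t `<=` r, r `<=` s & cone_dim r = (cone_dim t).+1].
Proof.
move: {2}(cone_dim s) (leqnn (cone_dim s)) => n.
elim: n s => [|n IH] s les sD tD ts tns; have lt := cone_dim_lt sD tD ts tns.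
  by move: les lt; case: (cone_dim s).
have [le|gt] := leqP (cone_dim t + 2) (cone_dim s); last first.
  by exists s; split=> //; lia.
have [f [fD tf fs fnt fns]] := intermediate sD tD ts le.
have ltf := cone_dim_lt sD fD fs fns.
have [||r [rD tr rf rd]] := IH f _ fD tD tf; [lia|by move/esym|].
by exists r; split=> //; exact: subset_trans rf fs.
Qed.

Lemma rays_generate g t (b : 'Hom(V, R^o)) : g \in fan_cones D -> t \in fan_cones D -> t `<=` g ->
  (forall v, t v -> b v = 0) ->
  (forall r v, r \in fan_cones D -> t `<=` r -> r `<=` g ->
     cone_dim r = (cone_dim t).+1 -> r v -> 0 <= b v) ->
  forall v, g v -> 0 <= b v.
Proof.
move=> + tD + bt; move: {2}(cone_dim g) (leqnn (cone_dim g)) => n.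
elim: n g => [|n IH] g leg gD tg br v gv.
  have [tE|tng] := pselect (t = g); first by subst g; rewrite bt.
  by have := cone_dim_lt gD tD tg tng; move: leg; case: (cone_dim g).
have [tE|tng] := pselect (t = g); first by subst g; rewrite bt.
have [r [rD tr rg rd]] := ray_exists gD tD tg tng.
have [y ry yt] : exists2 y, r y & y \notin lspan t.
  by apply: (cone_not_lspan rD tD tr) => E; move: rd; rewrite E; lia.
have gy := rg _ ry.
have ny : ~ loc g t (- y).
  move=> ly; case/negP: yt; apply: (loc_fan_both gD tD tg _ ly).
  exact: (loc_sub (fan_cone tD) gy).
have [c [f [w [a [[c0 fD tf fs] [tw fw apos fE ay]]]]]] :=
  shoot gD tD tg (loc_sub (fan_cone tD) gv) ny.
have fg := shoot_proper gD (lspan_mem (fan_cone gD) gy) ay fE.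
have ltf := cone_dim_lt gD fD fs fg.
have : 0 <= b (v - c *: y + w).
  apply: (IH f) => //; first by lia.
  by move=> r' v' r'D tr' rf; apply: br => //; exact: subset_trans rf fs.
have := br r y rD tr rg rd ry.
rewrite homD homB homZ (bt w tw) addr0 => by0.
by have := mulr_ge0 c0 by0; lra.
Qed.

End FanBasics.

(** * Intervals of length two and walls *)

Section FanGeometry.
Variables (R : realType) (V : vectType R) (D : fan V).
Implicit Types (s t r g : set V) (a b : 'Hom(V, R^o)).
Local Notation n := (\dim {:V}).

Lemma relint_fan s : s \in fan_cones D ->
  exists2 u, s u & forall r, r \in fan_cones D -> r `<=` s -> r u -> r = s.
Proof.
move=> sD; have cs := fan_cone sD; have [l [l0 sE lc]] := cs.
have [|u su Hu] := @relint_exists _ _ l s cs.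
  by move=> a v al; rewrite sE => /(_ a al).
exists u => // r rD rs ru; apply/seteqP; split=> // v sv.
apply: (setI_lspan sD rD rs sv); apply: (loc_fan_both sD rD rs).
  exact: (loc_sub (fan_cone rD)).
apply/(loc_forms (fan_cone rD) rs sE) => a al ar.
by rewrite homN (Hu a al (ar u ru) v sv) oppr0.
Qed.

Lemma lspan_ray t r y : r \in fan_cones D -> t \in fan_cones D -> t `<=` r ->
  cone_dim r = (cone_dim t).+1 -> y \in lspan r -> y \notin lspan t ->
  lspan r = (lspan t + <[y]>)%VS.
Proof.
move=> rD tD tr rd yr yt; apply/esym/eqP; rewrite eqEdim; apply/andP; split.
  by apply/subvP => v /memv_addP[a /(subvP (lspanS rD tD tr)) ar [b /vlineP[k ->] ->]];
    rewrite rpredD // rpredZ.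
by rewrite -/(cone_dim r) rd dimv_add_line.
Qed.

Lemma ray_capE t r1 r2 v : t \in fan_cones D -> r1 \in fan_cones D -> r2 \in fan_cones D ->
  t `<=` r1 -> t `<=` r2 ->
  cone_dim r1 = (cone_dim t).+1 -> cone_dim r2 = (cone_dim t).+1 ->
  r1 v -> r2 v -> v \notin lspan t -> r1 = r2.
Proof.
move=> tD r1D r2D tr1 tr2 d1 d2 v1 v2 vt.
have rD := fan_setI r1D r2D.
have d : (cone_dim t < cone_dim (r1 `&` r2))%N.
  apply: (cone_dim_lt rD tD); first by move=> x tx; split; [exact: tr1|exact: tr2].
  move=> E; case/negP: vt; apply: (lspan_mem (fan_cone tD)).
  by rewrite E.
have E1 : r1 `&` r2 = r1 by apply: (cone_dim_eq r1D rD); [move=> ? []|rewrite d1].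
have E2 : r1 `&` r2 = r2 by apply: (cone_dim_eq r2D rD); [move=> ? []|rewrite d2].
by rewrite -E1 E2.
Qed.

Lemma ray_vec t r : t \in fan_cones D -> r \in fan_cones D -> t `<=` r ->
  cone_dim r = (cone_dim t).+1 -> exists2 y, r y & y \notin lspan t.
Proof.
move=> tD rD tr rd; apply: (cone_not_lspan rD tD tr) => E; move: rd; rewrite E; lia.
Qed.

(** A two-dimensional cone has exactly two rays, read modulo V_t. The second is found where the
    half-line from an interior point away from the first leaves [s]; a third ray would be a
    nonnegative combination of the two on which its own supporting form vanishes. *)
Lemma diamond s t : s \in fan_cones D -> t \in fan_cones D -> t `<=` s ->
  cone_dim s = (cone_dim t).+2 ->
  exists r1 r2, [/\ r1 \in fan_cones D, t `<=` r1, r1 `<=` s & cone_dim r1 = (cone_dim t).+1]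
    /\ [/\ r2 \in fan_cones D, t `<=` r2, r2 `<=` s & cone_dim r2 = (cone_dim t).+1]
    /\ r1 <> r2 /\
    forall r, r \in fan_cones D -> t `<=` r -> r `<=` s -> cone_dim r = (cone_dim t).+1 ->
      r = r1 \/ r = r2.
Proof.
move=> sD tD ts sd.
have tns : t <> s by move=> E; move: sd; rewrite E; lia.
have [r1 [r1D tr1 r1s r1d]] := ray_exists sD tD ts tns.
have [y1 ry1 y1t] := ray_vec tD r1D tr1 r1d.
have [u su Hu] := relint_fan sD.
have ur1 : u \notin lspan r1.
  apply/negP => ur; have E := Hu _ r1D r1s (setI_lspan sD r1D r1s su ur).
  by move: r1d; rewrite E sd; lia.
have ny : ~ loc s t (- y1).
  move=> ly; case/negP: y1t; apply: (loc_fan_both sD tD ts _ ly).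
  by apply: (loc_sub (fan_cone tD)); exact: r1s.
have [c [r2 [w [a [[c0 r2D tr2 r2s] [tw fw apos fE ay]]]]]] :=
  shoot sD tD ts (loc_sub (fan_cone tD) su) ny.
have r2ns := shoot_proper sD (lspan_mem (fan_cone sD) (r1s _ ry1)) ay fE.
have w1 : w \in lspan r1 by apply: (lspan_mem (fan_cone r1D)); exact: tr1.
have yy1 : y1 \in lspan r1 by apply: (lspan_mem (fan_cone r1D)).
set y2 := u - c *: y1 + w in fw.
have y2r1 : y2 \notin lspan r1.
  apply: contra ur1 => H.
  have -> : u = y2 - w + c *: y1 by rewrite /y2 addrK subrK.
  by rewrite rpredD ?rpredB ?rpredZ.
clearbody y2.
have y2t : y2 \notin lspan t.
  by apply: contra y2r1; apply: (subvP (lspanS r1D tD tr1)).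
have r2t : t <> r2.
  by move=> E; case/negP: y2t; rewrite E; exact: (lspan_mem (fan_cone r2D)).
have lt1 := cone_dim_lt r2D tD tr2 r2t.
have lt2 := cone_dim_lt sD r2D r2s r2ns.
have r2d : cone_dim r2 = (cone_dim t).+1.
  by apply/eqP; rewrite eqn_leq lt1 andbT -ltnS -sd.
exists r1, r2; do !split=> //.
  by move=> E; case/negP: y2r1; rewrite E; exact: (lspan_mem (fan_cone r2D)).
move=> r rD tr rs rd.
have [|rn1] := pselect (r = r1); [by left|have [|rn2] := pselect (r = r2); [by right|]].
have [y ry yt] := ray_vec tD rD tr rd.
have [b [bp bE]] := iffRL (face_fanE sD rD) rs.
have [b1 [b1p b1E]] := iffRL (face_fanE sD r1D) r1s.
have [b2 [b2p b2E]] := iffRL (face_fanE sD r2D) r2s.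
have pos r' v (b' : 'Hom(V, R^o)) : r' = s `&` [set x | b' x = 0] ->
    (forall v, s v -> 0 <= b' v) -> s v -> ~ r' v -> 0 < b' v.
  move=> E bp' sv nv; rewrite lt_neqAle bp' // andbT eq_sym.
  by apply/eqP => E0; apply: nv; rewrite E; split.
have by1 : 0 < b y1.
  apply: (pos r) => //; first exact: r1s.
  move=> ry1'; apply: rn1; exact: (ray_capE tD rD r1D tr tr1 rd r1d ry1' ry1 y1t).
have by2 : 0 < b y2.
  apply: (pos r) => //; first exact: r2s.
  move=> ry2'; apply: rn2; exact: (ray_capE tD rD r2D tr tr2 rd r2d ry2' fw y2t).
have b1y2 : 0 < b1 y2.
  apply: (pos r1) => //; first exact: r2s.
  by move=> r1y2; case/negP: y2r1; exact: (lspan_mem (fan_cone r1D)).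
have b2y1 : 0 < b2 y1.
  apply: (pos r2) => //; first exact: r1s.
  move=> r2y1; case/negP: y2r1.
  by rewrite (ray_capE tD r1D r2D tr1 tr2 r1d r2d ry1 r2y1 y1t) (lspan_mem (fan_cone r2D)).
have tker (b' : 'Hom(V, R^o)) r' : t `<=` r' -> r' = [set v | s v /\ b' v = 0] ->
    forall v, v \in lspan t -> b' v = 0.
  move=> tr' E v; apply: (lspan_eq0 (fan_cone tD)) => x /tr'; rewrite E; by case.
have : y \in lspan s by apply: (lspan_mem (fan_cone sD)); exact: rs.
rewrite (lspan_ray sD r1D r1s _ (lspan_mem (fan_cone sD) (r2s _ fw)) y2r1) ?sd ?r1d //.
case/memv_addP => z; rewrite (lspan_ray r1D tD tr1 r1d yy1 y1t).
case/memv_addP => v vt [_ /vlineP[k1 ->] ->] [_ /vlineP[k2 ->] yE].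
have E0 : b y = 0 by move: ry; rewrite bE => -[].
have y1E : b1 y1 = 0 by move: ry1; rewrite b1E => -[].
have y2E : b2 y2 = 0 by move: fw; rewrite b2E => -[].
have p1 := b1p _ (rs _ ry); have p2 := b2p _ (rs _ ry).
(* The supporting forms of [r1] and [r2] at [y] give [k2 >= 0] and [k1 >= 0]; that of [r] then
   forces both to be zero. *)
move: E0 p1 p2; rewrite yE !(homD, homZ) (tker b r tr bE v vt) (tker b1 r1 tr1 b1E v vt)
  (tker b2 r2 tr2 b2E v vt) y1E y2E !mulr0 !(addr0, add0r) pmulr_lge0 // pmulr_lge0 //.
move=> /eqP E0 k20 k10; move: E0.
rewrite paddr_eq0 ?(mulr_ge0 k10 (ltW by1)) ?(mulr_ge0 k20 (ltW by2)) //.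
rewrite !mulf_eq0 (gt_eqF by1) (gt_eqF by2) !orbF => /andP[/eqP k1E /eqP k2E].
by move: yt; rewrite yE k1E k2E !scale0r !addr0 vt.
Qed.

Lemma wall_vec g r : g \in fan_cones D -> r \in fan_cones D -> r `<=` g ->
  cone_dim g = n -> (cone_dim r).+1 = n ->
  exists y, [/\ g y, y \notin lspan r & {:V}%VS = (lspan r + <[y]>)%VS].
Proof.
move=> gD rD rg gd rd; have rd' : cone_dim g = (cone_dim r).+1 by rewrite gd rd.
have [y gy yr] := ray_vec rD gD rg rd'.
exists y; split=> //.
rewrite -(lspan_ray gD rD rg rd' (lspan_mem (fan_cone gD) gy) yr).
exact/esym/lspan_top.
Qed.

(** If [b v > 0], then [v] is on the side of [g1], hence in its tangent cone along [r]. So [v + w]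
    is in both cones for some [w] in [r], and their common face exceeds the wall. *)
Lemma wall_opposite g1 g2 r b : g1 \in fan_cones D -> g2 \in fan_cones D ->
  r \in fan_cones D -> r `<=` g1 -> r `<=` g2 -> cone_dim g1 = n -> cone_dim g2 = n ->
  (cone_dim r).+1 = n -> g1 <> g2 -> (forall v, g1 v -> 0 <= b v) ->
  (forall v, r v <-> g1 v /\ b v = 0) -> forall v, g2 v -> b v <= 0.
Proof.
move=> g1D g2D rD rg1 rg2 d1 d2 rd ne bp bE v g2v.
rewrite leNgt; apply/negP => bv; apply: ne.
have [y [g1y yr VE]] := wall_vec g1D rD rg1 d1 rd.
have by0 := pos_off_face (fan_cone rD) bp bE g1y yr.
have rk (b' : 'Hom(V, R^o)) : (forall u, r u -> b' u = 0) -> forall u, u \in lspan r -> b' u = 0.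
  by move=> H; apply: (lspan_eq0 (fan_cone rD)).
have brk := rk b (fun u ru => (iffLR (bE u) ru).2).
have [w rw g1vw] : loc g1 r v.
  have [l [_ gE _]] := fan_cone g1D.
  apply/(loc_forms (fan_cone rD) rg1 gE) => a al ar.
  have : v \in (lspan r + <[y]>)%VS by rewrite -VE memvf.
  case/memv_addP => z zr [_ /vlineP[k ->] E].
  move: bv; rewrite E !(homD, homZ) (brk _ zr) (rk a ar _ zr) !add0r pmulr_lgt0 // => k0.
  by apply: mulr_ge0; [exact: ltW|move: g1y; rewrite gE => /(_ a al)].
have g2vw : g2 (v + w) by apply: coneD; [exact: (fan_cone g2D)|exact: g2v|exact: rg2].
have iD := fan_setI g1D g2D.
have d : (cone_dim r < cone_dim (g1 `&` g2))%N.
  apply: (cone_dim_lt iD rD); first by move=> x rx; split; [exact: rg1|exact: rg2].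
  move=> E; have : r (v + w) by rewrite E.
  by case/bE => _; rewrite homD (brk _ (lspan_mem (fan_cone rD) rw)) addr0; lra.
have E1 : g1 `&` g2 = g1 by apply: (cone_dim_eq g1D iD); [move=> ? []|rewrite d1 -rd].
have E2 : g1 `&` g2 = g2 by apply: (cone_dim_eq g2D iD); [move=> ? []|rewrite d2 -rd].
by rewrite -E1 E2.
Qed.

Lemma wall_form g r : g \in fan_cones D -> r \in fan_cones D -> r `<=` g ->
  exists2 b : 'Hom(V, R^o), forall v, g v -> 0 <= b v & forall v, r v <-> g v /\ b v = 0.
Proof.
by move=> gD rD /(face_fanE gD rD)[b [bp bE]]; exists b => // v; rewrite bE.
Qed.

(** A hyperplane has only two sides: [g2] and [g3] both lie opposite [g1], yet distinct cones at [r]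
    lie opposite each other. *)
Lemma wall_le2 g1 g2 g3 r : g1 \in fan_cones D -> g2 \in fan_cones D ->
  g3 \in fan_cones D -> r \in fan_cones D -> r `<=` g1 -> r `<=` g2 -> r `<=` g3 ->
  cone_dim g1 = n -> cone_dim g2 = n -> cone_dim g3 = n -> (cone_dim r).+1 = n ->
  g1 <> g2 -> g1 <> g3 -> g2 = g3.
Proof.
move=> g1D g2D g3D rD r1 r2 r3 d1 d2 d3 rd n12 n13; apply: contrapT => n23.
have [b1 b1p b1E] := wall_form g1D rD r1.
have [b2 b2p b2E] := wall_form g2D rD r2.
have H2 := wall_opposite g1D g2D rD r1 r2 d1 d2 rd n12 b1p b1E.
have H3 := wall_opposite g1D g3D rD r1 r3 d1 d3 rd n13 b1p b1E.
have H23 := wall_opposite g2D g3D rD r2 r3 d2 d3 rd n23 b2p b2E.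
have [y1 [gy1 y1r VE1]] := wall_vec g1D rD r1 d1 rd.
have [y2 [gy2 y2r VE2]] := wall_vec g2D rD r2 d2 rd.
have [y3 [gy3 y3r VE3]] := wall_vec g3D rD r3 d3 rd.
have k1 := lspan_eq0 (fan_cone rD) (fun u ru => (iffLR (b1E u) ru).2).
have k2 := lspan_eq0 (fan_cone rD) (fun u ru => (iffLR (b2E u) ru).2).
have : y3 \in (lspan r + <[y2]>)%VS by rewrite -VE2 memvf.
case/memv_addP => z zr [_ /vlineP[k ->] E].
have b2y2 := pos_off_face (fan_cone rD) b2p b2E gy2 y2r.
have b1y1 := pos_off_face (fan_cone rD) b1p b1E gy1 y1r.
have b1y3 : b1 y3 < 0.
  rewrite lt_neqAle H3 // andbT; apply/eqP => E0.
  have : y1 \in (lspan r + <[y3]>)%VS by rewrite -VE3 memvf.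
  case/memv_addP => z' z'r [_ /vlineP[k' ->] E'].
  by move: b1y1; rewrite E' homD homZ E0 (k1 _ z'r) mulr0 addr0 ltxx.
have := H23 _ gy3; move: b1y3.
rewrite E !(homD, homZ) (k1 _ zr) (k2 _ zr) !add0r pmulr_lle0 // => lt k0.
have := mulr_le0 k0 (H2 _ gy2); lra.
Qed.

End FanGeometry.

(** * Connectedness of stars *)

Lemma In_nthP (T : Type) (x0 : T) (s : seq T) (x : T) :
  List.In x s <-> exists2 m, (m < size s)%N & nth x0 s m = x.
Proof.
elim: s => [|a s IHs] /=; first by split=> // -[].
split.
  case=> [->|/IHs[m ms E]]; first by exists 0%N.
  by exists m.+1.
case=> -[|m] ms E; [by left|right].
by apply/IHs; exists m.
Qed.

Section Generic.
Variables (R : realType) (V : lmodType R).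

(** A vector space over an infinite field is not a finite union of proper subspaces, with an
    additive monoid [P] in place of the space. Here [x] avoids the earlier subspaces and [z] the new
    one. It supplies generic points of cones and generic linear forms. *)
Lemma generic_vector (I : Type) (Is : seq I) (P : set V) (U : I -> set V) :
  P 0 -> (forall u v, P u -> P v -> P (u + v)) ->
  (forall i, U i 0) ->
  (forall i (c : R) u v, U i u -> U i v -> U i (c *: (u - v))) ->
  (forall i, List.In i Is -> exists2 v, P v & ~ U i v) ->
  exists2 v, P v & forall i, List.In i Is -> ~ U i v.
Proof.
move=> P0 PD U0 UB; elim: Is => [|i Is IH] H; first by exists 0.
have [|x Px Hx] := IH; first by move=> j jI; apply: H; right.
have [z Pz Uz] := H i (or_introl erefl).
have PN k : P (x *+ k + z).
  by elim: k => [|k IHk]; [rewrite mulr0n add0r|rewrite mulrSr addrAC; apply: PD].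
suff [k Hk] : exists k : nat, forall j, List.In j (i :: Is) -> ~ U j (x *+ k + z).
  by exists (x *+ k + z).
apply: contrapT => nex.
(* Each [U j] contains at most one of the points x *+ k + z. *)
have one j k l : List.In j (i :: Is) -> U j (x *+ k + z) -> U j (x *+ l + z) -> k = l.
  move=> jI Uk Ul; apply/eqP/negPn/negP => kl.
  have Ux : U j x.
    have -> : x = (k%:R - l%:R)^-1 *: ((x *+ k + z) - (x *+ l + z)).
      rewrite opprD addrACA subrr addr0 -!scaler_nat -scalerBl scalerA mulVf ?scale1r //.
      by rewrite subr_eq0 eqr_nat.
    exact: UB.
  case: jI => [ij|jI]; last exact: (Hx _ jI).
  subst j; apply: Uz.
  have -> : z = 1 *: ((x *+ k + z) - (x *+ k)) by rewrite scale1r addrAC subrr add0r.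
  apply: (UB) => //; elim: (k) => [|m IHm]; first by rewrite mulr0n.
  rewrite mulrS -[x *+ m]opprK -[X in U i X]scale1r; apply: (UB) => //.
  by rewrite -[X in U i X]scale1r -sub0r; apply: (UB).
have {nex} bad k : exists2 j, List.In j (i :: Is) & U j (x *+ k + z).
  apply: contrapT => nj; apply: nex; exists k => j jI Uj; apply: nj; by exists j.
clear H IH Hx Uz.
pose s := i :: Is.
have bad' k : exists m : 'I_(size s), U (nth i s m) (x *+ k + z).
  have [j /(In_nthP i)[m ms <-] Uj] := bad k.
  by exists (Ordinal ms).
have [f Hf] := choice bad'.
have sI (m : 'I_(size s)) : List.In (nth i s m) s by apply/In_nthP; exists m.
(* There is one more point than there are subspaces, so two points share one. *)
pose g (k : 'I_(size s).+1) := f k.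
have inj : injective g.
  move=> k l E; apply/val_inj/(one _ _ _ (sI (f k))); first exact: Hf.
  by rewrite -/(g k) E; exact: Hf.
by have := leq_card g inj; rewrite !card_ord ltnn.
Qed.

End Generic.

Section Connected.
Variables (R : realType) (V : vectType R) (D : fan V).
Implicit Types (s t r g : set V) (a b : 'Hom(V, R^o)).
Local Notation n := (\dim {:V}).
Hypothesis pureD : purely_dim n D.

Lemma sub_top s : s \in fan_cones D -> exists g, [/\ g \in fan_cones D, s `<=` g & cone_dim g = n].
Proof.
move=> sD.
move: {2}(n - cone_dim s)%N (leqnn (n - cone_dim s)%N) => k.
elim: k s sD => [|k IH] s sD le.
  exists s; split=> //.
  have : (cone_dim s <= n)%N by exact/dimvS/subvf.
  lia.
have [maxs|] := pselect (forall t, t \in fan_cones D -> s `<=` t -> t = s).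
  by exists s; split=> //; exact: pureD.
move=> /existsNP[t /not_implyP[tD /not_implyP[st ts]]].
have lt := cone_dim_lt tD sD st (nesym ts).
have len : (cone_dim t <= n)%N by exact/dimvS/subvf.
have [|g [gD tg gd]] := IH t tD; first by lia.
by exists g; split=> //; exact: subset_trans st tg.
Qed.

Section Star.
Variables (t : set V) (tD : t \in fan_cones D).
Definition is_ray r := [/\ r \in fan_cones D, t `<=` r & cone_dim r = (cone_dim t).+1].
Definition is_2cone g := [/\ g \in fan_cones D, t `<=` g & cone_dim g = (cone_dim t).+2].
Variable P : set V -> Prop.
Hypothesis Padj : forall r1 r2 g, is_ray r1 -> is_ray r2 -> is_2cone g ->
  r1 `<=` g -> r2 `<=` g -> P r1 -> P r2.

(* Simplex method: from a ray of [g] minimizing a form that vanishes exactly on [r2]. *)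
Lemma ray_connect g r1 r2 : g \in fan_cones D -> is_ray r1 -> is_ray r2 ->
  r1 `<=` g -> r2 `<=` g -> P r1 -> P r2.
Proof.
move=> gD ray1 ray2 r1g r2g P1.
have [r1D tr1 r1d] := ray1; have [r2D tr2 r2d] := ray2.
have tg := subset_trans tr1 r1g.
have [b bp bE] := wall_form gD r2D r2g.
have [e ep eE] := wall_form gD tD tg.
have [u Hu] : exists u : set V -> V, forall r, is_ray r -> r (u r) /\ u r \notin lspan t.
  have /choice[u Hu] : forall r, exists v, is_ray r -> r v /\ v \notin lspan t.
    move=> r; have [[rD tr rd]|nr] := pselect (is_ray r); last by exists 0.
    by have [y ry yt] := ray_vec tD rD tr rd; exists y.
  by exists u.
have epos v : g v -> v \notin lspan t -> 0 < e v := pos_off_face (fan_cone tD) ep eE.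
pose Q (r : D) := `[< [/\ is_ray (val r), val r `<=` g & P (val r)] >].
(* On [g] the form [e] vanishes only on [t]; dividing by it makes [F] independent of the vector
   chosen on the ray. *)
pose F (r : D) := b (u (val r)) / e (u (val r)) : R.
have Q1 : Q (FSetSub r1D) by apply/asboolP.
case: (arg_minP F Q1) => r /asboolP[ray_r rg Pr] minr.
have [rD tr rd] := ray_r; have [ur urt] := Hu _ ray_r.
have er : 0 < e (u (val r)) by apply: epos => //; exact: rg.
have [E|rn2] := pselect (val r = r2); first by rewrite -E.
have br : 0 < b (u (val r)).
  apply: (pos_off_face (fan_cone r2D) bp bE (rg _ ur)); apply/negP => ur2.
  have r2u := setI_lspan gD r2D r2g (rg _ ur) ur2.
  by apply: rn2; exact: (ray_capE tD rD r2D tr tr2 rd r2d ur r2u urt).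
(* [p] vanishes on [r] and is negative at the vector of [r2]; minimality will make it nonnegative on
   the neighbours of [r], and thereby on all of [g]. *)
pose p := b - (F r) *: e.
have pv v : p v = b v - F r * e v by rewrite add_lfunE opp_lfunE scale_lfunE.
have bt v : t v -> b v = 0 by move=> /tr2/bE[].
have et v : t v -> e v = 0 by move/eE => [].
have pt v : t v -> p v = 0 by move=> tv; rewrite pv bt // et // mulr0 subrr.
have pu : p (u (val r)) = 0 by rewrite pv divfK ?subrr // gt_eqF.
have pr v : val r v -> p v = 0.
  move=> rv; have : v \in lspan (val r) by exact: (lspan_mem (fan_cone rD)).
  rewrite (lspan_ray rD tD tr rd (lspan_mem (fan_cone rD) ur) urt).
  case/memv_addP => x xt [_ /vlineP[k ->] ->].
  by rewrite homD homZ pu mulr0 addr0; apply: (lspan_eq0 (fan_cone tD) pt).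
have [u2 u2t] := Hu _ ray2.
have pu2 : p (u r2) < 0.
  rewrite pv (iffLR (bE _) u2).2 sub0r oppr_lt0 mulr_gt0 ?divr_gt0 //.
  by apply: epos => //; exact: r2g.
suff : 0 <= p (u r2) by lra.
(* Modulo V_r the rays of [g] are the cones [h] one dimension above [r]. The rays of [h] over [t]
   have property [P] by adjacency and so compete in the minimum. *)
apply: (rays_generate gD rD rg pr _ (r2g _ u2)) => h v hD rh hg hd hv.
have th := subset_trans tr rh.
apply: (rays_generate hD tD th pt _ hv) => r' v' r'D tr' r'h r'd r'v.
have ray' : is_ray r' by [].
have P' : P r' by apply: (Padj ray_r ray' (g := h)) => //; split=> //; rewrite hd rd.
have [ur' urt'] := Hu _ ray'.
have Q' : Q (FSetSub r'D) by apply/asboolP; split=> //; exact: subset_trans r'h hg.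
have := minr _ Q'; rewrite /F /= => le.
have er' : 0 < e (u r') by apply: epos => //; apply: hg; exact: r'h.
have {le} pu' : 0 <= p (u r').
  by rewrite pv subr_ge0 /F -ler_pdivlMr.
have : v' \in lspan r' by exact: (lspan_mem (fan_cone r'D)).
rewrite (lspan_ray r'D tD tr' r'd (lspan_mem (fan_cone r'D) ur') urt').
case/memv_addP => x xt [_ /vlineP[k ->] vE].
have p0 := lspan_eq0 (fan_cone tD) pt xt.
have e0 := lspan_eq0 (fan_cone tD) et xt.
rewrite vE homD homZ p0 add0r mulr_ge0 //.
have : 0 <= e v' by apply: ep; apply: hg; exact: r'h.
by rewrite vE homD homZ e0 add0r pmulr_lge0.
Qed.

End Star.
End Connected.

(** * Following a generic segment through a star *)

Section Walk.
Variables (R : realType) (V : vectType R) (D : fan V).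
Implicit Types (s r g : set V) (a b : 'Hom(V, R^o)).
Local Notation n := (\dim {:V}).
Variables (t : set V) (tD : t \in fan_cones D).

Section Step.
Variables x y : V.
Let p (c : R) := x + c *: (y - x).

(** The segment is followed in the tangent cones along [t]; the decreasing form [a] certifies that
    it leaves that of [g] right after the parameter [c]. *)
Definition exit_time g c := [/\ 0 <= c, c < 1, loc g t (p c) &
  exists a, [/\ forall v, g v -> 0 <= a v, forall v, t v -> a v = 0,
    a (p c) = 0 & a (y - x) < 0]].

Lemma exit_exists g c : g \in fan_cones D -> t `<=` g -> 0 <= c -> c < 1 ->
  loc g t (p c) -> ~ loc g t y -> exists2 c', c <= c' & exit_time g c'.
Proof.
move=> gD tg c0 c1 lc ly.
have [l [l0 gE _]] := fan_cone gD.
have lF := loc_forms (fan_cone tD) tg gE.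
pose P (a : 'Hom(V, R^o)) := `[< forall u, t u -> a u = 0 >].
have pE c' : y = p c' + (1 - c') *: (y - x).
  by rewrite /p -addrA -scalerDl [c' + _]addrC subrK scale1r addrC subrK.
have Hp a : a \in l -> P a -> 0 <= a (p c).
  by move=> al /asboolP; apply: (iffLR (lF _) lc).
have ex : exists2 a, (a \in l) && P a & 0 < a (x - y).
  apply: contrapT => nex; apply: ly; apply/lF => a al at0.
  rewrite (pE c) homD homZ addr_ge0 //; first by apply: Hp => //; apply/asboolP.
  apply: mulr_ge0; first by rewrite subr_ge0 ltW.
  rewrite -opprB homN oppr_ge0 leNgt; apply/negP => H; apply: nex.
  by exists a; rewrite // al; apply/asboolP.
have [d [d0 Hd [a /andP[al /asboolP at0] [az ad]]]] := hom_pos_min Hp ex.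
have pd : p c - d *: (x - y) = p (c + d).
  by rewrite /p scalerDl addrA -[x - y]opprB scalerN opprK.
have {ad} ad : a (p (c + d)) = 0 by rewrite -pd.
have {}Hd b : b \in l -> (forall u, t u -> b u = 0) -> 0 <= b (p (c + d)).
  by move=> bl bt; rewrite -pd; apply: Hd => //; apply/asboolP.
exists (c + d); first by rewrite lerDl.
have ayx : a (y - x) < 0 by rewrite -opprB homN oppr_lt0.
split; first by rewrite addr_ge0.
(* Otherwise each form active on [t] is nonnegative at the parameters [c < 1 <= c + d], hence at
   [y]. *)
- rewrite ltNge; apply/negP => cd1; apply: ly; apply/lF => b bl bt.
  have bp : 0 <= b (p c) by apply: Hp => //; apply/asboolP.
  have := Hd b bl bt.
  have -> : y = p 1 by rewrite /p scale1r addrC subrK.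
  move: bp; rewrite /p !homD !homZ; set m := b (y - x); set b0 := b x => h1 h2.
  have [m0|m0] := lerP 0 m.
    by apply: le_trans h1 _; rewrite lerD2l ler_wpM2r // ltW.
  by apply: le_trans h2 _; rewrite lerD2l ler_wnM2r // ltW.
- by apply/lF.
- exists a; split=> // v; first by rewrite gE => /(_ a al).
Qed.

Hypothesis generic : forall f, f \in fan_cones D -> (cone_dim f + 2 <= n)%N ->
  x \notin (lspan f + <[y]>)%VS.

(** A point of the segment other than [y] in V_f would put [x] into the sum of V_f and the line of
    [y], which genericity excludes in codimension two or more. *)
Lemma generic_dim f c w : f \in fan_cones D -> t `<=` f -> c < 1 ->
  t w -> f (p c + w) -> (n <= (cone_dim f).+1)%N.
Proof.
move=> fD tf c1 tw fw; rewrite leqNgt; apply/negP => lt.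
have /negP[] : x \notin (lspan f + <[y]>)%VS by apply: generic => //; lia.
have pf : p c \in lspan f.
  by rewrite -[p c](addrK w) rpredB ?(lspan_mem (fan_cone fD)) //; exact: tf.
have c1' : 1 - c != 0 by rewrite subr_eq0 gt_eqF.
have E : (1 - c) *: x = p c + (- c) *: y.
  by rewrite scalerBl scale1r /p scalerBr scaleNr [c *: y - _]addrC addrA addrK.
rewrite -[x](scalerK c1') E scalerDr.
by apply: memv_add; apply: rpredZ => //; apply: rpredZ; exact: memv_line.
Qed.

(** The exit face is a wall by genericity. Another cone [g'] at this wall contains the segment for
    some time after [c] in its tangent cone: the forms of [g'] that are active on [t] and vanish at
    the exit point vanish on the whole wall and do not decrease along the segment. *)
Lemma cross g c : g \in fan_cones D -> t `<=` g -> cone_dim g = n -> exit_time g c ->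
  exists2 r, [/\ r \in fan_cones D, t `<=` r, r `<=` g & (cone_dim r).+1 = n] &
   forall g', g' \in fan_cones D -> r `<=` g' -> cone_dim g' = n -> g' <> g ->
   exists e, [/\ 0 < e, loc g' t (p c) & loc g' t (p (c + e))].
Proof.
move=> gD tg gd [c0 c1 [w tw gw] [a [ap at0 ac ayx]]].
have tf : t `<=` g `&` [set v | a v = 0].
  by move=> v tv; split; [exact: tg|exact: at0].
have fD := fan_ker gD ap.
set f := g `&` _ in tf fD.
have fg : f `<=` g by move=> v [].
have fw : f (p c + w) by split=> //=; rewrite homD ac at0 // addr0.
have fn : f <> g.
  move=> fg'; have /(lspan_eq0 (fan_cone gD)) H : forall v, g v -> a v = 0.
    by move=> v; rewrite -{1}fg' => -[].
  by move: ayx; rewrite H ?ltxx // lspan_top ?memvf.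
have fd : (cone_dim f).+1 = n.
  have := generic_dim fD tf c1 tw fw; have := cone_dim_lt gD fD fg fn; lia.
exists f => // g' g'D fg' g'd g'g.
have tg' := subset_trans tf fg'.
have [l [l0 gE _]] := fan_cone g'D.
have lF := loc_forms (fan_cone tD) tg' gE.
pose P (b : 'Hom(V, R^o)) := `[< forall u, t u -> b u = 0 >].
have [v [g'v vf VE]] := wall_vec g'D fD fg' g'd fd.
have aop : a v <= 0.
  apply: (wall_opposite gD g'D fD fg fg' gd g'd fd (nesym g'g) ap) => //.
have akf := lspan_eq0 (b := a) (fan_cone fD) (fun u fu => fu.2).
have yxE : y - x \in (lspan f + <[v]>)%VS by rewrite -VE memvf.
have [||N N0 HN] := @forms_push _ _ [seq b <- l | P b] (y - x) (p c).
- move=> b; rewrite mem_filter => /andP[/asboolP bt bl].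
  have : 0 <= b (p c + w) by move: (fg' _ fw); rewrite gE => /(_ b bl).
  by rewrite homD (bt w tw) addr0.
- move=> b; rewrite mem_filter => /andP[/asboolP bt bl] bc.
  have bp u : g' u -> 0 <= b u by rewrite gE => /(_ b bl).
  have f'D := fan_ker g'D bp.
  set f' := g' `&` _ in f'D.
  have iD := fan_setI fD f'D.
  have if_ : f `&` f' `<=` f by move=> u [].
  (* The part of the wall where [b] vanishes still contains the exit point, up to [w], so it has
     codimension one by genericity. *)
  have E : f `&` f' = f.
    apply: (cone_dim_eq fD iD if_).
    have : (n <= (cone_dim (f `&` f')).+1)%N.
      apply: (generic_dim iD _ c1 tw).
        by move=> u tu; split; [exact: tf|split; [exact: tg'|exact: bt]].
      by split=> //; split; [exact: fg'|rewrite /= homD bc bt // addr0].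
    by rewrite -fd ltnS.
  have bf u : f u -> b u = 0 by rewrite -{1}E => -[_ []].
  have bkf := lspan_eq0 (fan_cone fD) bf.
  (* [a] decreases along the segment and is nonpositive at [v], so the coefficient [k] of the
     direction along [v] is not negative. *)
  case/memv_addP: yxE ayx => z zf [_ /vlineP[k ->] ->].
  rewrite !homD !homZ (akf _ zf) (bkf _ zf) !add0r => kn.
  apply: mulr_ge0; last exact: bp.
  rewrite leNgt; apply/negP => k0; move: kn.
  by rewrite ltNge mulr_le0 // ltW.
have N1 : 0 < N + 1 by rewrite ltr_wpDl.
exists (N + 1)^-1; split; first by rewrite invr_gt0.
  by exists w => //; exact: fg'.
apply/lF => b bl bt.
have : 0 <= b (y - x + N *: p c) by apply: HN; rewrite mem_filter bl andbT; apply/asboolP.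
have bpc : 0 <= b (p c).
  have : 0 <= b (p c + w) by move: (fg' _ fw); rewrite gE => /(_ b bl).
  by rewrite homD (bt w tw) addr0.
have -> : p (c + (N + 1)^-1) = p c + (N + 1)^-1 *: (y - x) by rewrite /p scalerDl addrA.
move: (p c) (y - x) bpc => u1 u2 bpc; rewrite !homD !homZ => h.
rewrite -(pmulr_rge0 _ N1) mulrDr mulrA mulfV ?mul1r ?gt_eqF //.
by rewrite mulrDl mul1r addrC addrA addr_ge0.
Qed.

End Step.
End Walk.

Section StarConnected.
Variables (R : realType) (V : vectType R) (D : fan V).
Implicit Types (s r g : set V) (a b : 'Hom(V, R^o)).
Local Notation n := (\dim {:V}).
Variables (t : set V) (tD : t \in fan_cones D).

Definition is_top g := [/\ g \in fan_cones D, t `<=` g & cone_dim g = n].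
Definition is_wall r := [/\ r \in fan_cones D, t `<=` r & (cone_dim r).+1 = n].

(* Follow the segment from a generic point x of g0 to a relative interior point y
   of g1. The cone satisfying Q that it leaves last is left through a wall, behind
   which there is another cone satisfying Q, which it leaves later. *)
Lemma walk (Q : set V -> Prop) g0 g1 :
  (forall g r, is_top g -> is_wall r -> r `<=` g -> Q g ->
     exists g', [/\ is_top g', r `<=` g', g' <> g & Q g']) ->
  is_top g0 -> is_top g1 -> Q g0 -> Q g1.
Proof.
move=> step top0 top1 Q0; apply: contrapT => nQ1.
have [g0D tg0 g0d] := top0; have [g1D tg1 g1d] := top1.
have [y g1y Hy] := relint_fan g1D.
pose fs := [seq f <- enum_fset (fan_cones D) | (cone_dim f + 2 <= n)%N].
have [|||||x g0x Hx] := @generic_vector R V _ fs g0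
    (fun f => [set v | v \in (lspan f + <[y]>)%VS]).
- exact: (cone0 (fan_cone g0D)).
- by move=> u v; exact: (coneD (fan_cone g0D)).
- by move=> f /=; exact: mem0v.
- by move=> f c u v /= uf vf; rewrite rpredZ // rpredB.
- move=> f /(In_nthP set0)[m ms <-].
  have : nth set0 fs m \in fs by apply: mem_nth.
  move: (nth _ _ _) => {}f; rewrite mem_filter => /andP[fd fD].
  apply: contrapT => nex.
  have : (lspan g0 <= lspan f + <[y]>)%VS.
    apply: (lspan_subv (fan_cone g0D)) => v g0v.
    by apply: contrapT => /negP nv; apply: nex; exists v => //; exact/negP.
  move/dimvS; rewrite -/(cone_dim g0) g0d.
  have [le _] := dimv_add_leqif (lspan f) <[y]>.
  move=> /leq_trans/(_ le); rewrite dim_vline; move: fd; rewrite /cone_dim.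
  by case: (y != 0) => /=; lia.
have gen f : f \in fan_cones D -> (cone_dim f + 2 <= n)%N -> x \notin (lspan f + <[y]>)%VS.
  move=> fD fd; apply/negP; apply: (Hx f).
  have : f \in fs by rewrite mem_filter fd.
  by move/(nthP set0) => [m ms <-]; apply/(In_nthP set0); exists m.
(* As [y] is interior to [g1], only [g1] has it in its tangent cone along [t], and [g1] does not
   satisfy [Q]. *)
have nly g : is_top g -> Q g -> ~ loc g t y.
  move=> [gD tg gd] Qg [w tw gyw]; apply: nQ1; suff <- : g = g1 by [].
  have iD := fan_setI g1D gD.
  have Ei : g1 `&` g = g1.
    apply: Hy; [exact: iD|by move=> u []|].
    have : (g1 `&` g) (y + w).
      by split=> //; apply: (coneD (fan_cone g1D)) => //; exact: tg1.
    have [fc _] : face (g1 `&` g) g1 /\ face (g1 `&` g) g.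
      by case: (fanP D) => _ _ _; apply.
    exact: (face_addl fc g1y (tg1 _ tw)).
  have g1g : g1 `<=` g by rewrite -Ei => u [].
  by apply/esym/(cone_dim_eq gD g1D g1g); rewrite gd g1d.
pose ex g (c : R) := exit_time t x y g c.
have exitP g (c : R) : is_top g -> Q g -> 0 <= c -> c < 1 -> loc g t (x + c *: (y - x)) ->
    exists2 c', c <= c' & ex g c'.
  move=> top Qg c0 c1 lc; have [gD tg _] := top.
  exact: (exit_exists tD gD tg c0 c1 lc (nly g top Qg)).
pose P (g : D) := `[< [/\ is_top (val g), Q (val g) & exists c, ex (val g) c] >].
have exU g (c c' : R) : is_top g -> ex g c -> ex g c' -> c <= c'.
  move=> [gD tg _] [_ _ [w tw gw] _] [_ _ _ [a [ap at0 ac ad]]].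
  have := ap _ gw; rewrite homD (at0 w tw) addr0 homD homZ.
  move: ac; rewrite homD homZ; move: (a x) (a (y - x)) ad => a1 a2 a20.
  move=> E H; rewrite leNgt; apply/negP => cc.
  have : (c - c') * a2 < 0 by rewrite nmulr_llt0 // subr_gt0.
  by rewrite mulrBl; lra.
(* The exit time is unique by [exU]; cones without one do not enter the maximum. *)
pose F (g : D) := xget 0 [set c | ex (val g) c] : R.
have exF (g : D) (c : R) : ex (val g) c -> ex (val g) (F g).
  by move=> exc; apply: (xgetPex 0 (P := [set c | ex (val g) c])); exists c.
have P0 : P (FSetSub g0D).
  apply/asboolP; split=> //.
  have [|c' _ ec'] := exitP g0 0 top0 Q0 (lexx _) ltr01; last by exists c'.
  by rewrite scale0r addr0; exact: (loc_sub (fan_cone tD)).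
case: (arg_maxP F P0) => g /asboolP[top Qg [c exc]] maxg.
have {}exc := exF _ _ exc; set c' := F g in exc maxg.
have [gD tg gd] := top.
have [r [rD tr rg rd] Hr] := cross tD gen gD tg gd exc.
have [g' [top' rg' g'g Qg']] := step _ _ top (And3 rD tr rd) rg Qg.
have [g'D tg' g'd] := top'.
have [e [e0 l0 le]] := Hr _ g'D rg' g'd g'g.
have [c0 c1 _ _] := exc.
have [ce1|ce1] := ltrP (c' + e) 1.
  have [|c2 c2e ec2] := exitP g' _ top' Qg' _ ce1 le; first by rewrite addr_ge0 // ltW.
  have Pg' : P (FSetSub g'D) by apply/asboolP; split=> //; exists c2.
  have : F (FSetSub g'D) <= c' := maxg _ Pg'.
  have H := exU g' _ _ top' ec2 (exF (FSetSub g'D) _ ec2).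
  rewrite leNgt => /negP; apply; apply: lt_le_trans H.
  by apply: lt_le_trans c2e; rewrite ltrDl.
(* The segment stays in the tangent cone of [g'] until [y], a convex combination of its points at
   [c'] and [c' + e]. *)
apply: (nly g' top' Qg').
have [w tw g'w] := le; have [w' tw' g'w'] := l0.
pose k := (1 - c') / e.
have k0 : 0 <= k by rewrite divr_ge0 ?subr_ge0 // ltW.
have k1 : 0 <= 1 - k by rewrite subr_ge0 /k ler_pdivrMr // mul1r; lra.
exists (k *: w + (1 - k) *: w').
  by apply: (coneD (fan_cone tD)); apply: (coneZ (fan_cone tD)).
have -> : y + (k *: w + (1 - k) *: w') =
    k *: (x + (c' + e) *: (y - x) + w) + (1 - k) *: (x + c' *: (y - x) + w').
  have -> : y = x + (y - x) by rewrite addrC subrK.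
  have -> : x + (y - x) - x = y - x by rewrite addrAC subrr add0r.
  move: (y - x) => d; rewrite !scalerDr !scalerA [RHS]addrACA; congr (_ + _).
  rewrite [RHS]addrACA -!scalerDl [k + _]addrC subrK scale1r; congr (_ + _).
  have -> : k * (c' + e) + (1 - k) * c' = 1.
    by rewrite mulrDr mulrBl mul1r /k divfK ?gt_eqF //; ring.
  by rewrite scale1r.
by apply: (coneD (fan_cone g'D)); apply: (coneZ (fan_cone g'D)).
Qed.

End StarConnected.

(** * Orientations and incidence numbers *)

Section Orientations.
Variables (R : realType) (V : vectType R).
Implicit Types (U W : {vspace V}) (X Y b e : seq V) (F G : nat -> nat -> R).

(** Indexing by natural numbers lets bases be plain sequences and blocks be cut without casts. *)
Definition detn N F : R := \det (\matrix_(i < N, j < N) F i j).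

Lemma detn_block N M F : (forall i j, (i < N)%N -> (N <= j)%N -> F i j = 0) ->
  detn (N + M) F = detn N F * detn M (fun i j => F (N + i)%N (N + j)%N).
Proof.
move=> F0; rewrite /detn -(det_lblock _ (\matrix_(i < M, j < N) F (N + i)%N j)).
congr (\det _); apply/matrixP => i j; rewrite !mxE.
case: splitP => i' Ei; rewrite !mxE; case: splitP => j' Ej; rewrite ?mxE Ei Ej //.
by rewrite F0 // leq_addr.
Qed.

Lemma detn1 N F : (forall i j, (i < N)%N -> (j < N)%N -> F i j = (i == j)%:R) ->
  detn N F = 1.
Proof.
move=> F1; rewrite /detn -(det1 _ N); congr (\det _); apply/matrixP => i j.
by rewrite !mxE F1.
Qed.

Lemma basis_size U X : basis_of U X -> size X = \dim U.
Proof. by move=> bX; rewrite (@vector.size_basis _ _ _ _ (in_tuple X) bX). Qed.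

Lemma ori_detn U (o : seq V -> bool) X Y F : is_orientation U o ->
  basis_of U X -> basis_of U Y ->
  (forall i, (i < size X)%N -> Y`_i = \sum_(j < size X) F i j *: X`_j) ->
  (o X == o Y) = (0 < detn (size X) F).
Proof.
move=> ho bX bY H.
have sX : size X == \dim U by rewrite (basis_size bX).
have sY : size Y == \dim U by rewrite (basis_size bY).
have := ho (Tuple sX) (Tuple sY) bX bY => /= ->.
congr (_ < _); rewrite (eqP sX); congr (\det _); apply/matrixP => i j; rewrite !mxE /=.
rewrite H ?(eqP sX) //.
exact: (@coord_sum_free _ _ _ (Tuple sX) (fun j => F i j) j (basis_free bX)).
Qed.

Lemma coef_exists U b e : basis_of U b -> (forall v, v \in e -> v \in U) ->
  exists F : nat -> nat -> R, forall i, (i < size e)%N ->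
    e`_i = \sum_(j < size b) F i j *: b`_j.
Proof.
move=> bb eU.
exists (fun i j => if insub j is Some j' then coord (in_tuple b) j' e`_i else 0) => i ie.
have := @coord_basis _ _ _ _ (in_tuple b) _ bb (eU _ (mem_nth 0 ie)).
move=> {1}->; apply: eq_bigr => j _; congr (_ *: _).
by rewrite insubT //= => jb; congr (coord _ _ _); apply: val_inj.
Qed.

(** The base change is block triangular, with block [F] on U and block [G] on W/U, so only the two
    determinants count. *)
Lemma ori_cat U W (o : seq V -> bool) b1 b2 e1 e2 F G :
  is_orientation W o -> basis_of U b1 -> size b2 = size b1 -> size e2 = size e1 ->
  basis_of W (b1 ++ e1) -> basis_of W (b2 ++ e2) ->
  (forall i, (i < size b1)%N -> b2`_i = \sum_(j < size b1) F i j *: b1`_j) ->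
  (forall i, (i < size e1)%N -> e2`_i - \sum_(j < size e1) G i j *: e1`_j \in U) ->
  (o (b1 ++ e1) == o (b2 ++ e2)) = (0 < detn (size b1) F * detn (size e1) G).
Proof.
move=> ho bb1 sb se bW1 bW2 HF HG.
set m := size b1 in HF *; set k := size e1 in HG *.
pose z := [seq e2`_i - \sum_(j < k) G i j *: e1`_j | i <- iota 0 k].
have [|K HK] := coef_exists (e := z) bb1.
  by move=> v /mapP[i]; rewrite mem_iota => ik ->; apply: HG.
pose H i j := if (i < m)%N then (if (j < m)%N then F i j else 0)
  else (if (j < m)%N then K (i - m)%N j else G (i - m)%N (j - m)%N).
have hb : (o (b1 ++ e1) == o (b2 ++ e2)) = (0 < detn (size (b1 ++ e1)) H).
  apply: (ori_detn ho bW1 bW2) => i; rewrite size_cat -/m -/k => imk.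
  rewrite big_split_ord /= nth_cat sb -/m.
  have E1 : \sum_(j < m) H i j *: (b1 ++ e1)`_j
      = \sum_(j < m) (if (i < m)%N then F i j else K (i - m)%N j) *: b1`_j.
    by apply: eq_bigr => j _; rewrite /H nth_cat -/m (ltn_ord j).
  have E2 : \sum_(j < k) H i (m + j)%N *: (b1 ++ e1)`_(m + j)
      = \sum_(j < k) (if (i < m)%N then 0 else G (i - m)%N j) *: e1`_j.
    apply: eq_bigr => j _.
    have jm : (m + j < m)%N = false by rewrite ltnNge leq_addr.
    by rewrite /H nth_cat -/m jm addKn.
  rewrite E1 E2; case: ltnP => im.
    rewrite [X in _ + X]big1 ?addr0 ?HF // => j _; by rewrite scale0r.
  have ik : (i - m < k)%N by lia.
  have sz : size z = k by rewrite size_map size_iota.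
  rewrite -HK ?sz // (nth_map 0%N) ?size_iota // nth_iota // add0n.
  by rewrite subrK.
rewrite hb size_cat detn_block; last first.
  by move=> i j im mj; rewrite /H im ltnNge mj.
congr (_ < _ * _).
  by congr (\det _); apply/matrixP => i j; rewrite !mxE /H !ltn_ord.
congr (\det _); apply/matrixP => i j; rewrite !mxE /H.
by rewrite !ltnNge !leq_addr /= !addKn.
Qed.

Lemma basis_rcons U v b : basis_of U b -> v \notin U ->
  basis_of (U + <[v]>)%VS (rcons b v).
Proof.
move=> bb vU; rewrite -cats1; apply: cat_basis => //; last first.
  by apply: seq1_basis; apply: contraNneq vU => ->; exact: mem0v.
exact/directv_addP/(line_disjoint vU).
Qed.

Lemma ori_rcons U W oU oW b1 b2 v1 v2 w c :
  is_orientation U oU -> is_orientation W oW ->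
  basis_of U b1 -> basis_of U b2 -> basis_of W (rcons b1 v1) -> basis_of W (rcons b2 v2) ->
  w \in U -> v2 = c *: v1 + w ->
  (0 < c -> (oW (rcons b1 v1) == oW (rcons b2 v2)) = (oU b1 == oU b2)) /\
  (c < 0 -> b1 = b2 -> oW (rcons b1 v1) != oW (rcons b2 v2)).
Proof.
move=> hU hW bb1 bb2 bW1 bW2 wU vE.
have sb : size b2 = size b1 by rewrite (basis_size bb1) (basis_size bb2).
have b2U v : v \in b2 -> v \in U by apply: basis_mem.
have [F] := coef_exists bb1 b2U; rewrite sb => HF.
rewrite -!cats1 in bW1 bW2 *.
have H i : (i < size [:: v1])%N ->
    [:: v2]`_i - \sum_(j < size [:: v1]) (fun _ _ => c) i j *: [:: v1]`_j \in U.
  by case: i => // _; rewrite big_ord1 /= vE addrAC subrr add0r.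
have := ori_cat hW bb1 sb _ bW1 bW2 HF H => /(_ erefl).
have -> : detn (size [:: v1]) (fun _ _ => c) = c.
  by rewrite /detn /= det_mx11 mxE.
move=> E; split=> c0.
  by rewrite E pmulr_lgt0 // (ori_detn hU bb1 bb2 HF).
move=> bE; rewrite E nmulr_lgt0 //.
have : oU b1 == oU b2 by rewrite bE.
by rewrite (ori_detn hU bb1 bb2 HF) -leNgt => /ltW.
Qed.

Lemma ori_swap U W oW b v1 v2 : is_orientation W oW -> basis_of U b ->
  basis_of W (rcons (rcons b v1) v2) -> basis_of W (rcons (rcons b v2) v1) ->
  oW (rcons (rcons b v1) v2) != oW (rcons (rcons b v2) v1).
Proof.
move=> hW bb; rewrite -!cats1 -!catA /= => bW1 bW2.
have [F HF] := coef_exists bb (fun v => @basis_mem _ _ v U b bb).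
have H1 : detn (size b) (fun i j => (i == j)%:R) = 1 by apply: detn1.
pose G (i j : nat) : R := (i != j)%:R.
have H i : (i < size [:: v1; v2])%N ->
    [:: v2; v1]`_i - \sum_(j < size [:: v1; v2]) G i j *: [:: v1; v2]`_j \in U.
  by case: i => [|[|]] // _; rewrite !big_ord_recl big_ord0 /= /G /=
    ?scale0r ?scale1r ?add0r ?addr0 subrr mem0v.
rewrite (ori_cat (F := fun i j => (i == j)%:R) hW bb erefl _ bW1 bW2 _ H) //.
  rewrite H1 mul1r /detn /= (expand_det_row _ ord0) !big_ord_recl big_ord0.
  rewrite /cofactor !det_mx11 !mxE /G /=.
  by rewrite mul0r mul1r add0r addr0 expr1 mulr1 oppr_gt0 ltr10.
move=> i ib; rewrite (bigD1 (Ordinal ib)) //= eqxx scale1r big1 ?addr0 // => j.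
by rewrite -val_eqE /= eq_sym => /negbTE ->; rewrite scale0r.
Qed.

End Orientations.

Section Incidence.
Variables (R : realType) (V : vectType R).
Implicit Types (D : {fset set V}).

(** What incidence numbers need of a cone; it is also available for the images of cones in a
    quotient space. *)
Definition lspan_spec (s : set V) : Prop :=
  s 0 /\ forall v, v \in lspan s <-> exists a b, [/\ s a, s b & v = a - b].

Lemma cone_lspan_spec s : is_cone s -> lspan_spec s.
Proof. by move=> cs; split; [exact: cone0|exact: mem_lspan]. Qed.

(** Another basis or inward vector changes both orientations by the same sign, so one choice
    decides. The vector [v] may leave [s] within [v0 + V_t], as lifts from a quotient do. *)
Lemma incidence_eq D (o : orientation D) (s t : D) b v v0 :
  lspan_spec (val s) -> lspan_spec (val t) -> facet (val t) (val s) ->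
  basis_of (lspan (val t)) b -> val s v0 -> v0 \notin lspan (val t) ->
  v - v0 \in lspan (val t) ->
  incidence o s t = if o t b == o s (rcons b v) then 1 else -1.
Proof.
move=> [s0 sP] [t0 tP] [[h [hp tE]] dE] bb sv0 v0t vv0.
have ls v' : val s v' -> v' \in lspan (val s).
  by move=> sv; apply/sP; exists v', 0; rewrite subr0.
have lt v' : val t v' -> v' \in lspan (val t).
  by move=> sv; apply/tP; exists v', 0; rewrite subr0.
have tsub : (lspan (val t) <= lspan (val s))%VS.
  apply/subvP => u /tP[x [y [tx ty ->]]]; rewrite rpredB // ls //.
    by move: tx; rewrite tE => -[].
  by move: ty; rewrite tE => -[].
have hk u : u \in lspan (val t) -> h u = 0.
  by move=> /tP[x [y [+ + ->]]]; rewrite tE homB => -[_ ->] [_ ->]; rewrite subrr.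
have hpos u : val s u -> u \notin lspan (val t) -> 0 < h u.
  move=> su ut; rewrite lt_neqAle hp // andbT eq_sym; apply/eqP => E.
  by case/negP: ut; apply: lt; rewrite tE.
have WE u : u \in lspan (val s) -> u \notin lspan (val t) ->
    lspan (val s) = (lspan (val t) + <[u]>)%VS.
  move=> us ut; apply/esym/eqP; rewrite eqEdim; apply/andP; split.
    apply/subvP => _ /memv_addP[x /(subvP tsub) xs [_ /vlineP[k ->] ->]].
    by rewrite rpredD // rpredZ.
  by rewrite dimv_add_line // -/(cone_dim (val s)) -dE.
have vs : v \in lspan (val s).
  by rewrite -[v](subrK v0); apply: rpredD; [exact: (subvP tsub)|exact: ls].
have vt : v \notin lspan (val t).
  by apply: contra v0t => vt; rewrite -[v0](subKr v) rpredB.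
have bW := basis_rcons bb vt; rewrite -(WE _ vs vt) in bW.
have key b' v' : basis_of (lspan (val t)) b' -> val s v' -> v' \notin lspan (val t) ->
   (o s (rcons b' v') == o s (rcons b v)) = (o t b' == o t b).
  move=> bb' sv' vt'.
  have bW' := basis_rcons bb' vt'; rewrite -(WE _ (ls _ sv') vt') in bW'.
  have : v \in (lspan (val t) + <[v']>)%VS by rewrite -WE // ls.
  case/memv_addP => w wt [_ /vlineP[c ->] vE].
  have [+ _] := ori_rcons (@oriP _ _ _ o t) (@oriP _ _ _ o s) bb' bb bW' bW wt
    (etrans vE (addrC _ _)).
  apply; have h0 := hpos _ sv0 v0t; have h' := hpos _ sv' vt'.
  have hv : h v = h v0 by rewrite -[v](subrK v0) homD hk // add0r.
  by move: h0; rewrite -hv vE homD homZ hk // add0r pmulr_lgt0.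
rewrite /incidence; case: asboolP => [[b' [v' [bb' sv' vt' E]]]|nex].
  have := key b' v' bb' sv' vt'; rewrite -E.
  by case: (o t b'); case: (o t b); case: (o s _) => //= /eqP.
case: eqP => // E; case: nex; exists b, v0; split=> //.
have := key b v0 bb sv0 v0t; rewrite eqxx E.
by case: (o s (rcons b v)); case: (o s (rcons b v0)).
Qed.

End Incidence.

Section FanIncidence.
Variables (R : realType) (V : vectType R) (D : fan V) (o : orientation D).
Implicit Types (s t r g : D).
Local Notation n := (\dim {:V}).

Lemma facetE s t : facet (val t) (val s) <->
  val t `<=` val s /\ cone_dim (val s) = (cone_dim (val t)).+1.
Proof.
split=> -[h1 h2].
  by split=> //; apply/(face_fanE (valP s) (valP t)).
by split=> //; apply/(face_fanE (valP s) (valP t)).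
Qed.

Lemma incidence_fan s t b v : facet (val t) (val s) ->
  basis_of (lspan (val t)) b -> val s v -> v \notin lspan (val t) ->
  incidence o s t = if o t b == o s (rcons b v) then 1 else -1.
Proof.
move=> ts bb sv vt; apply: (@incidence_eq _ _ _ o s t b v v) => //.
- exact/cone_lspan_spec/(fan_cone (valP s)).
- exact/cone_lspan_spec/(fan_cone (valP t)).
- by rewrite subrr mem0v.
Qed.

(** Both products compare [o t b] with [o g] on [b] extended by [v1] and [v2], in opposite
    orders. *)
Lemma diamond_sign g r1 r2 t : facet (val t) (val r1) -> facet (val t) (val r2) ->
  facet (val r1) (val g) -> facet (val r2) (val g) -> r1 != r2 ->
  incidence o g r1 * incidence o r1 t = - (incidence o g r2 * incidence o r2 t).
Proof.
move=> f1 f2 g1 g2 ne.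
have [t1 d1] := iffLR (facetE _ _) f1; have [t2 d2] := iffLR (facetE _ _) f2.
have [rg1 e1] := iffLR (facetE _ _) g1; have [rg2 e2] := iffLR (facetE _ _) g2.
have [v1 rv1 v1t] := ray_vec (valP t) (valP r1) t1 d1.
have [v2 rv2 v2t] := ray_vec (valP t) (valP r2) t2 d2.
have lm (s : D) v : val s v -> v \in lspan (val s).
  by apply: lspan_mem; exact: fan_cone (valP s).
have nin (r r' : D) v : val r <> val r' -> val t `<=` val r -> val t `<=` val r' ->
    cone_dim (val r) = (cone_dim (val t)).+1 -> cone_dim (val r') = (cone_dim (val t)).+1 ->
    val r `<=` val g -> val r' `<=` val g ->
    val r v -> v \notin lspan (val t) -> v \notin lspan (val r').
  move=> ne' tr tr' d d' rg rg' rv vt; apply/negP => vr'; apply: ne'.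
  apply: (ray_capE (valP t) (valP r) (valP r') tr tr' d d' rv _ vt).
  exact: (setI_lspan (valP g) (valP r') rg' (rg _ rv) vr').
have n12 : val r1 <> val r2 by move/val_inj/eqP; rewrite (negbTE ne).
have v1r2 := nin _ _ _ n12 t1 t2 d1 d2 rg1 rg2 rv1 v1t.
have v2r1 := nin _ _ _ (nesym n12) t2 t1 d2 d1 rg2 rg1 rv2 v2t.
pose b : seq V := vbasis (lspan (val t)).
have bb : basis_of (lspan (val t)) b by exact: vbasisP.
have b1 := basis_rcons bb v1t; have b2 := basis_rcons bb v2t.
rewrite -(lspan_ray (valP r1) (valP t) t1 d1 (lm _ _ rv1) v1t) in b1.
rewrite -(lspan_ray (valP r2) (valP t) t2 d2 (lm _ _ rv2) v2t) in b2.
have b12 := basis_rcons b1 v2r1; have b21 := basis_rcons b2 v1r2.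
rewrite -(lspan_ray (valP g) (valP r1) rg1 e1 (lm _ _ (rg2 _ rv2)) v2r1) in b12.
rewrite -(lspan_ray (valP g) (valP r2) rg2 e2 (lm _ _ (rg1 _ rv1)) v1r2) in b21.
have sw := ori_swap (@oriP _ _ _ o g) bb b12 b21.
rewrite (incidence_fan f1 bb rv1 v1t) (incidence_fan f2 bb rv2 v2t).
rewrite (incidence_fan g1 b1 (rg2 _ rv2) v2r1) (incidence_fan g2 b2 (rg1 _ rv1) v1r2).
move: sw; case: (o t b); case: (o r1 _); case: (o r2 _);
  by case: (o g (rcons (rcons _ v1) v2)); case: (o g (rcons (rcons _ v2) v1)).
Qed.

(** The inward normals point to opposite sides of the wall, while the orientations of the two
    n-cones agree. *)
Lemma wall_sign g1 g2 r : facet (val r) (val g1) -> facet (val r) (val g2) ->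
  cone_dim (val g1) = n -> cone_dim (val g2) = n -> g1 != g2 ->
  incidence o g1 r = - incidence o g2 r.
Proof.
move=> f1 f2 e1 e2 ne.
have [r1 d1] := iffLR (facetE _ _) f1; have [r2 d2] := iffLR (facetE _ _) f2.
have rd : (cone_dim (val r)).+1 = n by rewrite -d1.
have [v1 [gv1 v1r VE1]] := wall_vec (valP g1) (valP r) r1 e1 rd.
have [v2 [gv2 v2r VE2]] := wall_vec (valP g2) (valP r) r2 e2 rd.
pose b : seq V := vbasis (lspan (val r)).
have bb : basis_of (lspan (val r)) b by exact: vbasisP.
have b1 := basis_rcons bb v1r; have b2 := basis_rcons bb v2r.
rewrite (incidence_fan f1 bb gv1 v1r) (incidence_fan f2 bb gv2 v2r).
have LE (g : D) : cone_dim (val g) = n -> lspan (val g) = {:V}%VS by exact: lspan_top.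
have [h hp hE] := wall_form (valP g1) (valP r) r1.
have n12 : val g1 <> val g2 by move/val_inj/eqP; rewrite (negbTE ne).
have hop := wall_opposite (valP g1) (valP g2) (valP r) r1 r2 e1 e2 rd n12 hp hE.
have hk := lspan_eq0 (b := h) (fan_cone (valP r)) (fun u ru => (iffLR (hE u) ru).2).
have h1 := pos_off_face (fan_cone (valP r)) hp hE gv1 v1r.
have : v2 \in (lspan (val r) + <[v1]>)%VS by rewrite -VE1 memvf.
case/memv_addP => w wr [_ /vlineP[c ->] vE].
have c0 : c < 0.
  have := hop _ gv2; rewrite vE homD homZ hk // add0r pmulr_lle0 //.
  rewrite le_eqVlt => /orP[/eqP c0|//].
  by case/negP: v2r; rewrite vE c0 scale0r addr0.
rewrite -VE1 -(LE g1 e1) in b1; rewrite -VE2 -(LE g1 e1) in b2.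
have [_ /(_ c0 erefl)] := ori_rcons (@oriP _ _ _ o r) (@oriP _ _ _ o g1) bb bb b1 b2 wr
  (etrans vE (addrC _ _)).
rewrite [o g1 (rcons b v2)](@ori_top _ _ _ o g1 g2) //; last by rewrite -(LE g1 e1).
by case: (o r b); case: (o g1 _); case: (o g2 _).
Qed.

End FanIncidence.

(** * Cellular complexes *)

Section Exactness.
Variables (R : realType) (V : vectType R) (D : {fset set V}).
Variables (o : orientation D) (F : fan_sheaf D).
Local Notation n := (\dim {:V}).
Local Notation family := (forall s : D, F s).
Local Notation coboundary := (@coboundary R V D o F).
Local Notation cochain := (@cochain R V D F).

(** These cones index the relative cochains of degree [m]; elsewhere a family may take any
    values. *)
Definition interior (m : nat) (s : D) : Prop :=
  (cone_dim (val s) + m)%N = n /\ s \notin bd_fan D.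

(* The complex with its augmentation: index 0 stands for degree -1, where a
   global section is a compatible family and the first map is the identity. *)
Definition augmented (m : nat) (y : family) : Prop :=
  m = 0%N -> forall s t : D, face (val t) (val s) -> res F s t (y s) = y t.

Definition exact_in (m : nat) : Prop :=
  forall x : family, (forall t, interior m.+1 t -> coboundary x t = 0) ->
    exists y : family, augmented m y /\
      forall s, interior m s -> x s = if m is 0%N then y s else coboundary y s.

Definition trunc (k : nat) (x : family) : family :=
  fun s => if (cone_dim (val s) + k == n)%N then x s else 0.

Lemma trunc_cochain k x : cochain k (trunc k x).
Proof. by move=> s /eqP/negbTE; rewrite /trunc => ->. Qed.

Lemma coboundary_cochain k x : cochain k x -> cochain k.+1 (coboundary x).
Proof.
move=> xk t tn; rewrite /coboundary big1 // => s /asboolP[_ d].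
by rewrite xk ?raddf0 ?mul0rz // -d => E; apply: tn; rewrite -E addSnnS.
Qed.

Lemma eq_coboundary x y t :
  (forall s : D, facet (val t) (val s) -> x s = y s) -> coboundary x t = coboundary y t.
Proof. by move=> E; apply: eq_bigr => s /asboolP/E ->. Qed.

Lemma coboundary_trunc k x t : (cone_dim (val t) + k.+1)%N = n ->
  coboundary (trunc k x) t = coboundary x t.
Proof.
move=> tn; apply: eq_coboundary => s [_ d].
by rewrite /trunc -d addSnnS tn eqxx.
Qed.

Hypothesis aug_inj : forall y : sections F [set: D]%SET,
  (forall s, interior 0 s -> sec_val y s (finset.in_setT s) = 0) -> y = 0.

(** Truncation turns a family into a cochain without changing its coboundary in codimension [k.+1].
    Exactness in degree -1 is the hypothesis [aug_inj], as [exact_in] begins with degree 0. *)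
Lemma reduced_acyclicE : reduced_acyclic o F <-> forall m, exact_in m.
Proof.
split.
  move=> [_ H0 HS] m x xc.
  have cc : bd_cochain m.+1 (coboundary (trunc m x)).
    split=> [|t tb]; first exact/coboundary_cochain/trunc_cochain.
    have [d|d] := eqVneq (cone_dim (val t) + m.+1)%N n.
      by rewrite coboundary_trunc // xc.
    by apply: (coboundary_cochain (@trunc_cochain m x)) => /eqP; rewrite (negbTE d).
  have eqt s z : interior m s -> trunc m x s - z = 0 -> x s = z.
    by move=> [sd _]; rewrite /trunc sd eqxx => /eqP; rewrite subr_eq0 => /eqP.
  case: m x xc cc eqt => [|k] x xc cc eqt.
    have [y [_ Hy]] := H0 _ (@trunc_cochain 0 x) cc.
    exists (fun s => sec_val y s (finset.in_setT s)); split=> [_ s t|s Is].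
      exact: (svalP y).
    apply: (eqt s _ Is); have := Hy s Is.2; rewrite /augmentation.
    by have [sd _] := Is; rewrite addn0 in sd; rewrite sd eqxx.
  have [y _ [_ Hy]] := HS k _ (@trunc_cochain k.+1 x) cc.
  by exists y; split=> // s Is; apply: (eqt s _ Is); exact: Hy Is.2.
move=> H; split.
- move=> x [_ Hx]; apply: aug_inj => s [sd sb].
  by have := Hx s sb; rewrite /augmentation; rewrite addn0 in sd; rewrite sd eqxx.
- move=> x x0 [_ xb]; have [|y [cy Hy]] := H 0%N x; first by move=> t [_ tb]; exact: xb.
  have cy' : compatible (L := [set: D]%SET) (fun s _ => y s) by move=> s t _ _; exact: cy.
  exists (exist _ _ cy'); split=> s.
    move=> sd; rewrite (x0 s sd) /augmentation ifN ?subrr //.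
    by apply/eqP => E; apply: sd; rewrite addn0.
  move=> sb; rewrite /augmentation; case: eqP => sd; last first.
    by rewrite (x0 s) ?subrr // addn0.
  by rewrite Hy ?subrr //; split; rewrite ?addn0.
- move=> k x xk [_ xb]; have [|y [_ Hy]] := H k.+1 x; first by move=> t [_ tb]; exact: xb.
  exists (trunc k y); first exact: trunc_cochain.
  split=> s.
    by move=> sd; rewrite xk // (coboundary_cochain (trunc_cochain y)) // subrr.
  move=> sb; have [sd|/eqP sd] := eqVneq (cone_dim (val s) + k.+1)%N n.
    by rewrite coboundary_trunc // Hy ?subrr.
  by rewrite xk // (coboundary_cochain (trunc_cochain y)) // subrr.
Qed.

End Exactness.

Section FanComplex.
Variables (R : realType) (V : vectType R) (D : fan V).
Variable (o : orientation D).
Local Notation n := (\dim {:V}).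
Hypothesis pureD : purely_dim n D.

Lemma face_sub_fan (s t : D) : face (val t) (val s) <-> val t `<=` val s.
Proof. exact: (face_fanE (valP s) (valP t)). Qed.

Lemma bd_fan_sub (s t : D) : val t `<=` val s -> s \in bd_fan D -> t \in bd_fan D.
Proof.
move=> ts; rewrite !finset.in_set => /asboolP[r [r1 r2 sr]]; apply/asboolP.
exists r; split=> //; apply/face_sub_fan.
by apply: (subset_trans ts); apply/face_sub_fan.
Qed.

Lemma bd_fan_facet (s t : D) : facet (val t) (val s) -> s \in bd_fan D -> t \in bd_fan D.
Proof. by move/facetE => [ts _]; exact: bd_fan_sub. Qed.

Lemma bd_fan_top (s : D) : cone_dim (val s) = n -> s \notin bd_fan D.
Proof.
move=> sn; rewrite finset.in_set; apply/asboolP => -[r [r1 _ /face_sub_fan sr]].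
by have := cone_dimS (valP r) (valP s) sr; rewrite sn -r1 ltnn.
Qed.

Lemma top_exists (s : D) : exists2 g : D, val s `<=` val g & cone_dim (val g) = n.
Proof.
by have [g [gD sg gd]] := sub_top pureD (valP s); exists (FSetSub gD).
Qed.

(** By purity every cone is a face of an n-cone, and n-cones are never in the boundary. *)
Lemma aug_inj_fan (F : fan_sheaf D) (y : sections F [set: D]%SET) :
  (forall s, interior 0 s -> sec_val y s (finset.in_setT s) = 0) -> y = 0.
Proof.
move=> Hy; apply: sections_ext => s hs.
have [g sg gd] := top_exists s.
have := svalP y _ _ (finset.in_setT g) hs (iffRL (face_sub_fan _ _) sg).
rewrite [X in res _ _ _ X](_ : _ = 0) ?raddf0; last first.
  by apply: Hy; split; rewrite ?addn0 //; exact: bd_fan_top.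
by move=> E; rewrite /sec_val -E.
Qed.

(** The sum is empty or consists of the two terms of a diamond, which have opposite signs. *)
Lemma incidence_diamond (s t : D) :
  \sum_(r : D | `[< facet (val t) (val r) >] && `[< facet (val r) (val s) >])
    incidence o s r * incidence o r t = 0.
Proof.
have [[r0 /andP[/asboolP f1 /asboolP f2]]|nex] := pselect (exists r : D,
    `[< facet (val t) (val r) >] && `[< facet (val r) (val s) >]); last first.
  by rewrite big_pred0 // => r; apply/negbTE/negP => H; apply: nex; exists r.
have [t0 d0] := iffLR (facetE _ _) f1; have [s0 e0] := iffLR (facetE _ _) f2.
have [||r1 [r2 [[r1D tr1 rs1 d1] [[r2D tr2 rs2 d2] [ne H]]]]] :=
  diamond (valP s) (valP t); [exact: subset_trans t0 s0|by rewrite e0 d0|].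
pose q1 : D := FSetSub r1D; pose q2 : D := FSetSub r2D.
have q12 : q1 != q2 by apply/eqP => /(congr1 val).
have ft1 : facet (val t) (val q1) by apply/facetE.
have ft2 : facet (val t) (val q2) by apply/facetE.
have fs1 : facet (val q1) (val s) by apply/facetE; rewrite /= d1 e0 d0.
have fs2 : facet (val q2) (val s) by apply/facetE; rewrite /= d2 e0 d0.
rewrite (bigD1 q1) /=; last by apply/andP; split; apply/asboolP.
rewrite (bigD1 q2) /=; last by rewrite eq_sym q12 andbT; apply/andP; split; apply/asboolP.
rewrite big_pred0 ?addr0; first by rewrite (diamond_sign o ft1 ft2 fs1 fs2 q12) addNr.
move=> r; apply/negbTE/negP.
move=> /andP[/andP[/andP[/asboolP/facetE[tr dr] /asboolP/facetE[rs es]] n1] n2].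
have [E|E] := H (val r) (valP r) tr rs dr.
  by case/eqP: n1; apply: val_inj.
by case/eqP: n2; apply: val_inj.
Qed.

Lemma coboundary_sq (F : fan_sheaf D) (x : forall s : D, F s) t :
  coboundary (F := F) o (coboundary (F := F) o x) t = 0.
Proof.
rewrite /coboundary.
under eq_bigr => r _ do rewrite raddf_sum /= mulrz_suml.
rewrite (exchange_big_dep xpredT) //=; apply: big1 => s _.
transitivity (res F s t (x s) *~ (\sum_(r : D | `[< facet (val t) (val r) >] &&
    `[< facet (val r) (val s) >]) incidence o s r * incidence o r t)).
  rewrite mulrz_sumr; apply: eq_bigr => r /andP[/asboolP[rt _] /asboolP[sr _]].
  by rewrite raddfMz res_comp // mulrzA.
by rewrite incidence_diamond mulr0z.
Qed.

(** A wall with exactly one n-cone belongs to the boundary, and purity provides at least one. *)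
Lemma wall_other (t g1 : D) : interior 1 t -> val t `<=` val g1 ->
  cone_dim (val g1) = n ->
  exists g2 : D, [/\ cone_dim (val g2) = n, facet (val t) (val g2) & g2 != g1].
Proof.
move=> [td tb] tg1 gd1; rewrite addn1 in td.
apply: contrapT => nex; case/negP: tb; rewrite finset.in_set; apply/asboolP; exists t.
split=> //; last by apply/face_sub_fan.
suff -> : [set s : D | (cone_dim (val s) == n) && `[< facet (val t) (val s) >]]%SET
   = [set g1]%SET by rewrite cards1.
apply/setP => g; rewrite !inE; apply/idP/eqP => [/andP[/eqP gd /asboolP f]|->].
  by apply/eqP/negPn/negP => ne; apply: nex; exists g.
by rewrite gd1 eqxx; apply/asboolP/facetE; rewrite gd1.
Qed.

Lemma wall_third (t g1 g2 g : D) : (cone_dim (val t)).+1 = n ->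
  facet (val t) (val g1) -> facet (val t) (val g2) -> facet (val t) (val g) ->
  g2 != g1 -> g != g1 -> g = g2.
Proof.
move=> td /facetE[tg1 d1] /facetE[tg2 d2] /facetE[tg d] n1 n2.
apply/val_inj/esym.
apply: (wall_le2 (valP g1) (valP g2) (valP g) (valP t)); rewrite -?td //.
- by move/val_inj/esym/eqP; rewrite (negbTE n1).
- by move/val_inj/esym/eqP; rewrite (negbTE n2).
Qed.

Lemma incidence_wall (t : D) : interior 1 t ->
  \sum_(s : D | `[< facet (val t) (val s) >]) incidence o s t = 0.
Proof.
move=> It; have [g1 tg1 gd1] := top_exists t.
have [g2 [gd2 f2 g21]] := wall_other It tg1 gd1.
have [td tb] := It; rewrite addn1 in td.
have f1 : facet (val t) (val g1) by apply/facetE; rewrite gd1.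
rewrite (bigD1 g1) /=; last exact/asboolP.
rewrite (bigD1 g2) /=; last by rewrite g21 andbT; apply/asboolP.
rewrite big_pred0 ?addr0.
  by rewrite (wall_sign o f1 f2 gd1 gd2) ?addNr // eq_sym.
move=> g; apply/negbTE/negP => /andP[/andP[/asboolP f n1] n2].
by case/eqP: n2; apply: (wall_third td f1 f2 f).
Qed.

Lemma coboundary_aug (F : fan_sheaf D) (y : sections F [set: D]%SET) t : interior 1 t ->
  coboundary (F := F) o (fun s => sec_val y s (finset.in_setT s)) t = 0.
Proof.
move=> It; rewrite /coboundary.
under eq_bigr => s /asboolP[st _] do
  rewrite (svalP y _ _ (finset.in_setT s) (finset.in_setT t) st).
by rewrite -mulrz_sumr incidence_wall // mulr0z.
Qed.

End FanComplex.

(** * Transversal fans *)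

Lemma mem_lspan_sub (R : realType) (V : vectType R) (s : set V) :
  (exists U : {vspace V}, forall v, v \in U <-> exists a b, [/\ s a, s b & v = a - b]) ->
  forall v, v \in lspan s <-> exists a b, [/\ s a, s b & v = a - b].
Proof. by move/(xgetPex (P := [set U : {vspace V} | _]) 0%VS). Qed.

Section StarComplex.
Variables (R : realType) (V : vectType R) (D : {fset set V}).
Variables (o : orientation D).

Definition scob (M : zmodType) (c : D -> M) (t : D) : M :=
  \sum_(s : D | `[< facet (val t) (val s) >]) c s *~ incidence o s t.

Definition dstar (M : zmodType) (m : nat) (b : D -> M) : D -> M :=
  if m is 0%N then b else scob b.

(** Exactness in degree [m] of the star complex of [u]. For [m = 0] the cochain [b] has degree -1,
    where cochains are constants and [dstar] is the augmentation. *)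
Definition star_exact (u : D) (m : nat) : Prop :=
  forall c : D -> R,
    (forall t, val u `<=` val t -> interior m.+1 t -> scob c t = 0) ->
    exists b : D -> R, (m = 0%N -> forall s t, b s = b t) /\
      forall s, val u `<=` val s -> interior m s -> c s = dstar m b s.

End StarComplex.

Section Transversal.
Variables (R : realType) (V : vectType R) (D : fan V) (o : orientation D).
Local Notation n := (\dim {:V}).
Hypothesis pureD : purely_dim n D.
Variable u : D.
Local Notation S := (val u).
Local Notation W := (lspan S).
Local Notation D' := (transversal_fan D S).
Variable oT : orientation D'.
Local Notation p := (quot_proj W).
Implicit Types (g t s : D).

Lemma quot_proj_eq0 v : (p v == 0) = (v \in W).
Proof. by rewrite -memv_ker lker_quot_proj. Qed.

Lemma quot_lift v : vsval (p v) - v \in W.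
Proof.
rewrite {2}(quot_proj_split W v) opprD addrA subrr add0r rpredN.
exact: memv_pi.
Qed.

Lemma proj_lspan g : S `<=` val g ->
  lspan_spec (p @` val g) /\ lspan (p @` val g) = (p @: lspan (val g))%VS.
Proof.
move=> Sg; have cg := fan_cone (valP g).
have spec (U : {vspace quot W}) : U = (p @: lspan (val g))%VS ->
   forall v, v \in U <-> exists a b, [/\ (p @` val g) a, (p @` val g) b & v = a - b].
  move=> -> v; split.
    case/memv_imgP => x /(mem_lspan cg)[a [b [ga gb ->]]] ->.
    by exists (p a), (p b); rewrite linearB; split=> //.
  case=> _ [_ [[a ga <-] [b gb <-] ->]]; rewrite -linearB memv_img //.
  by rewrite rpredB ?lspan_mem.
have lE : forall v, v \in lspan (p @` val g) <->
    exists a b, [/\ (p @` val g) a, (p @` val g) b & v = a - b].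
  apply: mem_lspan_sub.
  by exists (p @: lspan (val g))%VS => v; exact: (spec _ erefl).
split; first by split=> //; exists 0; [exact: (cone0 cg)|rewrite linear0].
apply/vspaceP => v; apply/idP/idP => [/lE/(spec _ erefl)|/(spec _ erefl)/lE] //.
Qed.

Lemma proj_mem_lspan g v : S `<=` val g -> (p v \in lspan (p @` val g)) = (v \in lspan (val g)).
Proof.
move=> Sg; have [_ ->] := proj_lspan Sg; apply/idP/idP => [|vg]; last exact: memv_img.
case/memv_imgP => x xg /eqP; rewrite -subr_eq0 -linearB quot_proj_eq0 => h.
rewrite -[v](subrK x) rpredD //; apply: subvP h.
exact: (lspanS (valP g) (valP u) Sg).
Qed.

Lemma proj_dim g : S `<=` val g ->
  (cone_dim (p @` val g) + cone_dim S)%N = cone_dim (val g).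
Proof.
move=> Sg; rewrite /cone_dim (proj_lspan Sg).2 addnC -(limg_ker_dim p (lspan (val g))).
congr (_ + _)%N; rewrite lker_quot_proj; congr (\dim _).
by apply/esym/capv_idPr/(lspanS (valP g) (valP u) Sg).
Qed.

Lemma quot_dim : (\dim {: quot W} + cone_dim S)%N = n.
Proof.
rewrite -(limg_ker_dim p {:V}) limg_quot_proj lker_quot_proj addnC capvC.
by congr (\dim _ + _)%N; apply/esym/capv_idPl/subvf.
Qed.

(** The projection does not merge cones of the star: [v] plus an element of sigma lies in both
    cones, and their common face is extreme in [g]. *)
Lemma proj_mem g t v : S `<=` val g -> S `<=` val t -> val g v ->
  (p @` val t) (p v) -> val t v.
Proof.
move=> Sg St gv [x tx /eqP]; rewrite -subr_eq0 -linearB quot_proj_eq0.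
move=> /(mem_lspan (fan_cone (valP u)))[a [b [Sa Sb E]]].
have E' : v + a = x + b.
  have -> : x = a - b + v by rewrite -E subrK.
  by rewrite addrAC subrK addrC.
have iD := fan_setI (valP g) (valP t).
have [fc _] : face (val g `&` val t) (val g) /\ face (val g `&` val t) (val t).
  by case: (fanP D) => _ _ _; apply; exact: valP.
suff : (val g `&` val t) v by case.
apply: (face_addl fc gv (Sg _ Sa)); split.
  by apply: (coneD (fan_cone (valP g)) gv); exact: Sg.
by rewrite E'; apply: (coneD (fan_cone (valP t)) tx); exact: St.
Qed.

Lemma proj_sub g t : S `<=` val g -> S `<=` val t ->
  p @` val t `<=` p @` val g <-> val t `<=` val g.
Proof.
move=> Sg St; split=> [H v tv|H _ [v tv <-]]; last by exists v => //; exact: H.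
by apply: (proj_mem St Sg tv); apply: H; exists v.
Qed.

Lemma proj_face g t : S `<=` val g -> S `<=` val t ->
  face (p @` val t) (p @` val g) <-> val t `<=` val g.
Proof.
move=> Sg St; split; first by move=> fc; apply/(proj_sub Sg St) => v; exact: face_sub.
move=> tg; have [b bp bE] := wall_form (valP g) (valP t) tg.
have bW : forall w, w \in W -> b w = 0.
  by apply: (lspan_eq0 (fan_cone (valP u))) => v /St/bE[].
(* [b] is constant on classes modulo [W], so it may be evaluated on the representatives in the
   complement. *)
pose b' : 'Hom(quot W, R^o) := (b \o linfun vsval)%VF.
have b'E v : b' (p v) = b v.
  rewrite comp_lfunE lfunE /=; apply/eqP.
  by rewrite -subr_eq0 -homB bW // quot_lift.
exists b'; split; first by move=> _ [v gv <-]; rewrite b'E bp.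
apply/seteqP; split=> [_ [v /bE[gv bv] <-]|_ [[v gv <-]]] /=.
  by rewrite b'E; split=> //; exists v.
by rewrite b'E => bv; exists v => //; apply/bE.
Qed.

Lemma proj_in g : S `<=` val g -> (p @` val g)%classic \in D'.
Proof.
move=> Sg; apply/imfsetP => /=; exists (val g) => //.
rewrite !inE (valP g) /=; apply/asboolP.
exact/(face_fanE (valP g) (valP u)).
Qed.

(** The bijection from the star of [u] to the transversal fan, made total by [insubd]; its values
    outside the star are immaterial. *)
Definition qcone (g : D) : D' :=
  insubd (FSetSub (proj_in (@subset_refl _ S))) (p @` val g)%classic.

Lemma val_qcone g : S `<=` val g -> val (qcone g) = p @` val g.
Proof. by move=> Sg; rewrite /qcone val_insubd proj_in. Qed.

Lemma qcone_surj (s' : D') : exists g, S `<=` val g /\ qcone g = s'.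
Proof.
have /imfsetP[/= g] := valP s'; rewrite !inE => /andP[gD /asboolP fc] E.
have Sg : S `<=` g by apply/(face_fanE gD (valP u)).
exists (FSetSub gD); split=> //; apply: val_inj.
by rewrite val_qcone //= E.
Qed.

Lemma qcone_facet g t : S `<=` val g -> S `<=` val t ->
  facet (val (qcone t)) (val (qcone g)) <-> facet (val t) (val g).
Proof.
move=> Sg St; rewrite !val_qcone // facetE; split=> -[h1 h2].
  split; first exact/(proj_face Sg St).
  by rewrite -(proj_dim Sg) -(proj_dim St) -h2 addSn.
split; first exact/(proj_face Sg St).
by move: h2; rewrite -(proj_dim Sg) -(proj_dim St); lia.
Qed.

Lemma qcone_inj g t : S `<=` val g -> S `<=` val t -> qcone g = qcone t -> g = t.
Proof.
move=> Sg St /(congr1 val); rewrite !val_qcone // => E.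
by apply: val_inj; apply/seteqP; split; [apply/(proj_sub St Sg)|apply/(proj_sub Sg St)];
  rewrite E.
Qed.

Lemma qcone_dim g : S `<=` val g ->
  forall m, (cone_dim (val (qcone g)) + m)%N = \dim {: quot W} <->
            (cone_dim (val g) + m)%N = n.
Proof.
move=> Sg m; rewrite val_qcone // -(proj_dim Sg) -quot_dim; lia.
Qed.

Lemma qcone_card g : S `<=` val g ->
  #|[set s : D' | (cone_dim (val s) == \dim {: quot W})
      && `[< facet (val (qcone g)) (val s) >]]%SET| =
  #|[set s : D | (cone_dim (val s) == n) && `[< facet (val g) (val s) >]]%SET|.
Proof.
move=> Sg; set A := [set s : D | _]%SET.
have SA s : s \in A -> S `<=` val s.
  rewrite finset.in_set => /andP[_ /asboolP/facetE[gs _]]; exact: subset_trans Sg gs.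
have <- : #|qcone @: A| = #|A|.
  by apply: card_in_imset => s t sA tA; apply: qcone_inj; exact: SA.
congr #|pred_of_set _|; apply/setP => s'; rewrite finset.in_set; apply/idP/imsetP.
  have [s [Ss <-]] := qcone_surj s'.
  move=> /andP[/eqP sd /asboolP/(qcone_facet Ss Sg) fc].
  exists s => //; rewrite finset.in_set; apply/andP; split; last exact/asboolP.
  by apply/eqP; move: (iffLR (qcone_dim Ss 0)); rewrite !addn0; apply.
move=> [s sA ->]; have Ss := SA _ sA.
move: sA; rewrite finset.in_set => /andP[/eqP sd /asboolP fc].
apply/andP; split; last exact/asboolP/(qcone_facet Ss Sg).
by apply/eqP; move: (iffRL (qcone_dim Ss 0)); rewrite !addn0; apply.
Qed.

(** The n-cones having a cone of the star as a facet are in the star themselves, so both fans count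
    the same n-cones at a wall. *)
Lemma qcone_bd g : S `<=` val g -> (qcone g \in bd_fan D') = (g \in bd_fan D).
Proof.
move=> Sg; rewrite !finset.in_set; apply/asboolP/asboolP.
  case=> r' [h1 h2 h3]; have [r [Sr rE]] := qcone_surj r'; subst r'.
  exists r; split.
  - by move: (iffLR (qcone_dim Sr 1)); rewrite !addn1; apply.
  - by rewrite -qcone_card.
  - by apply/face_sub_fan/(proj_face Sr Sg); rewrite -!val_qcone.
case=> r [h1 h2 /face_sub_fan gr]; have Sr := subset_trans Sg gr.
exists (qcone r); split.
- by move: (iffRL (qcone_dim Sr 1)); rewrite !addn1; apply.
- by rewrite qcone_card.
- by rewrite !val_qcone //; apply/proj_face.
Qed.

Lemma qcone_interior g m : S `<=` val g -> interior m (qcone g) <-> interior m g.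
Proof. by move=> Sg; rewrite /interior qcone_bd // (qcone_dim Sg). Qed.

End Transversal.

(** * Signs in the transversal fan *)

Section TransversalSigns.
Variables (R : realType) (V : vectType R) (D : fan V) (o : orientation D).
Local Notation n := (\dim {:V}).
Hypothesis pureD : purely_dim n D.
Variable u : D.
Local Notation S := (val u).
Local Notation W := (lspan S).
Local Notation D' := (transversal_fan D S).
Variable oT : orientation D'.
Local Notation p := (quot_proj W).
Local Notation q := (@qcone _ _ _ u).
Implicit Types (g t s : D) (b : seq (quot W)).

Definition lift_basis b : seq V := vbasis W ++ map vsval b.

Definition lift_hom : 'Hom(quot W, V) := linfun vsval.

Lemma lift_homE w : lift_hom w = vsval w. Proof. by rewrite lfunE. Qed.

Lemma lift_basisP g b : S `<=` val g -> basis_of (lspan (val (q g))) b ->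
  basis_of (lspan (val g)) (lift_basis b).
Proof.
move=> Sg; rewrite val_qcone // => bb.
have ker0 : lker lift_hom = 0%VS.
  apply/eqP; rewrite -subv0; apply/subvP => w; rewrite memv_ker lift_homE memv0.
  by move=> /eqP h; apply/eqP/val_inj; rewrite /= h.
have bl : basis_of (lift_hom @: lspan (p @` val g)) (map vsval b).
  rewrite -(eq_map (f := lift_hom)); last by move=> w; rewrite lift_homE.
  by apply: limg_basis_of => //; rewrite ker0 capv0.
have dir : directv (W + lift_hom @: lspan (p @` val g)).
  apply/directv_addP/eqP; rewrite -subv0 -(capv_compl W); apply: capvS => //.
  by apply/subvP => _ /memv_imgP[w _ ->]; rewrite lift_homE subvsP.
have := cat_basis dir (vbasisP W) bl.
suff -> : (W + lift_hom @: lspan (p @` val g))%VS = lspan (val g) by [].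
have WS := lspanS (valP g) (valP u) Sg.
apply/eqP; rewrite eqEdim; apply/andP; split.
  apply/subvP => _ /memv_addP[a /(subvP WS) ag [_ /memv_imgP[w wg ->] ->]].
  rewrite rpredD // lift_homE; move: wg; rewrite (proj_lspan Sg).2.
  move=> /memv_imgP[v vg ->]; rewrite -[vsval _](subrK v) rpredD //.
  exact: (subvP WS _ (quot_lift _ _)).
rewrite (directvP dir) /= limg_dim_eq ?ker0 ?capv0 //.
by rewrite -/(cone_dim (val g)) -(proj_dim Sg) addnC.
Qed.

Lemma lift_basis_rcons b w : rcons (lift_basis b) (vsval w) = lift_basis (rcons b w).
Proof. by rewrite /lift_basis map_rcons rcons_cat. Qed.

Lemma lift_basis_ori g b1 b2 : S `<=` val g ->
  basis_of (lspan (val (q g))) b1 -> basis_of (lspan (val (q g))) b2 ->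
  (o g (lift_basis b1) == o g (lift_basis b2)) = (oT (q g) b1 == oT (q g) b2).
Proof.
move=> Sg bb1 bb2.
have sb : size b2 = size b1 by rewrite (basis_size bb1) (basis_size bb2).
have [G] := coef_exists bb1 (fun v => @basis_mem _ _ v _ b2 bb2); rewrite sb => HG.
rewrite (ori_detn (@oriP _ _ _ oT (q g)) bb1 bb2 HG).
have HG' i : (i < size (map vsval b1))%N -> (map vsval b2)`_i -
    \sum_(j < size (map vsval b1)) G i j *: (map vsval b1)`_j \in W.
  rewrite size_map => ib.
  rewrite (nth_map 0) ?sb // HG // -lift_homE linear_sum /=.
  rewrite [X in _ - X](_ : _ = \sum_(j < size b1) lift_hom (G i j *: b1`_j)) ?subrr ?mem0v //.
  by apply: eq_bigr => j _; rewrite linearZ /= lift_homE (nth_map 0).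
have sW : size (map vsval b2) = size (map (@vsval _ _ _) b1) by rewrite !size_map.
rewrite (ori_cat (F := fun i j => (i == j)%:R) (@oriP _ _ _ o g) (vbasisP W) erefl sW
  (lift_basisP Sg bb1) (lift_basisP Sg bb2) _ HG').
  by rewrite detn1 ?mul1r ?size_map.
move=> i ib; rewrite (bigD1 (Ordinal ib)) //= eqxx scale1r big1 ?addr0 // => j.
by rewrite -val_eqE /= eq_sym => /negbTE ->; rewrite scale0r.
Qed.

(** Compares the orientation of [g] with the one composed of [vbasis W] and the orientation of the
    projected cone; by [qsignE] the basis of the latter is immaterial. *)
Definition qsign g : int :=
  if o g (lift_basis (vbasis (lspan (val (q g))))) == oT (q g) (vbasis (lspan (val (q g))))
  then 1 else -1.

Lemma qsignE g b : S `<=` val g -> basis_of (lspan (val (q g))) b ->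
  qsign g = if o g (lift_basis b) == oT (q g) b then 1 else -1.
Proof.
move=> Sg bb; have := lift_basis_ori Sg (vbasisP (lspan (val (q g)))) bb.
rewrite /qsign; case: (o g _); case: (oT _ _); case: (o g _); case: (oT _ _) => //.
Qed.

Lemma qsign_sq g : qsign g * qsign g = 1.
Proof. by rewrite /qsign; case: ifP. Qed.

(** The two systems of incidence numbers differ by a multiplicative coboundary, so rescaling
    cochains by [qsign] identifies the two complexes. *)
Lemma qsign_incidence g t : S `<=` val t -> facet (val t) (val g) ->
  incidence oT (q g) (q t) = qsign g * qsign t * incidence o g t.
Proof.
move=> St fc; have [tg dg] := iffLR (facetE _ _) fc.
have Sg := subset_trans St tg.
have [v gv vt] := ray_vec (valP t) (valP g) tg dg.
pose b : seq (quot W) := vbasis (lspan (val (q t))).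
have bb : basis_of (lspan (val (q t))) b by exact: vbasisP.
have fc' : facet (val (q t)) (val (q g)) by apply/(qcone_facet Sg St).
have spec s : S `<=` val s -> lspan_spec (val (q s)).
  by move=> Ss; rewrite val_qcone //; exact: (proj_lspan Ss).1.
have pvt : p v \notin lspan (val (q t)) by rewrite val_qcone // proj_mem_lspan.
have pvg : val (q g) (p v) by rewrite val_qcone //; exists v.
have i1 : incidence oT (q g) (q t) =
    if oT (q t) b == oT (q g) (rcons b (p v)) then 1 else -1.
  apply: (@incidence_eq _ _ _ oT (q g) (q t) b (p v) (p v)) => //; try exact: spec.
  by rewrite subrr mem0v.
have i2 : incidence o g t =
    if o t (lift_basis b) == o g (rcons (lift_basis b) (vsval (p v))) then 1 else -1.
  apply: (@incidence_eq _ _ _ o g t (lift_basis b) (vsval (p v)) v) => //.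
  - exact/cone_lspan_spec/(fan_cone (valP g)).
  - exact/cone_lspan_spec/(fan_cone (valP t)).
  - exact: lift_basisP.
  - exact: (subvP (lspanS (valP t) (valP u) St) _ (quot_lift _ _)).
have bg : basis_of (lspan (val (q g))) (rcons b (p v)).
  have lg x : val g x -> x \in lspan (val g) by apply: lspan_mem; exact: fan_cone (valP g).
  have -> : lspan (val (q g)) = (lspan (val (q t)) + <[p v]>)%VS; last exact: basis_rcons.
  rewrite !val_qcone // (proj_lspan Sg).2 (proj_lspan St).2.
  by rewrite (lspan_ray (valP g) (valP t) tg dg (lg _ gv) vt) limgD limg_line.
rewrite i1 i2 (qsignE St bb) (qsignE Sg bg) lift_basis_rcons.
by case: (oT (q t) _); case: (oT (q g) _); case: (o t _); case: (o g _).
Qed.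

(** Both fans orient their top-dimensional cones uniformly; therefore the rescaling respects the
    augmentation by constants. *)
Lemma qsign_top g t : S `<=` val g -> S `<=` val t -> cone_dim (val g) = n ->
  cone_dim (val t) = n -> qsign g = qsign t.
Proof.
move=> Sg St gd td.
have LE s : S `<=` val s -> cone_dim (val s) = n -> lspan (val (q s)) = {: quot W}%VS.
  by move=> Ss sd; apply: lspan_top; move: (iffRL (qcone_dim Ss 0)); rewrite !addn0 => ->.
pose b : seq (quot W) := vbasis (lspan (val (q g))).
have bg : basis_of (lspan (val (q g))) b by exact: vbasisP.
have bt : basis_of (lspan (val (q t))) b by rewrite LE // -(LE g).
rewrite (qsignE Sg bg) (qsignE St bt).
have qd s : S `<=` val s -> cone_dim (val s) = n -> cone_dim (val (q s)) = \dim {: quot W}.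
  by move=> Ss sd; rewrite /cone_dim LE.
rewrite (@ori_top _ _ _ o g t) //; last by rewrite -(lspan_top gd); exact: lift_basisP.
by rewrite (@ori_top _ _ _ oT (q g) (q t)) ?qd // -(LE g).
Qed.

Lemma transversal_coboundary (x : D' -> R) t : S `<=` val t ->
  coboundary (F := constant_sheaf D') oT x (q t) =
  scob o (fun s => x (q s) *~ qsign s) t *~ qsign t.
Proof.
move=> St; rewrite /coboundary /scob mulrz_suml.
have [q' Hq'] := choice (fun s' : D' => qcone_surj s').
rewrite (reindex_onto q q') /=; last by move=> s' _; exact: (Hq' s').2.
apply: eq_big => [s|s].
  apply/andP/idP => [[/asboolP fc /eqP E]|/asboolP fc].
    by apply/asboolP/(qcone_facet _ St) => //; rewrite -E; exact: (Hq' _).1.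
  have Ss := subset_trans St (iffLR (facetE _ _) fc).1.
  split; first by apply/asboolP/(qcone_facet Ss St).
  by apply/eqP/(@qcone_inj _ _ _ u) => //; [exact: (Hq' _).1|exact: (Hq' _).2].
move=> /andP[/asboolP fc /eqP E].
have Ss : S `<=` val s by rewrite -E; exact: (Hq' _).1.
move/(qcone_facet Ss St): fc => fc.
by rewrite qsign_incidence // -!mulrzA; congr (_ *~ _); ring.
Qed.

Lemma transversal_acyclicE :
  reduced_acyclic oT (constant_sheaf D') <->
  forall m, star_exact o u m.
Proof.
have Su : S `<=` S by [].
have q0 s : S `<=` val s -> face (val (q u)) (val (q s)).
  by move=> Ss; rewrite !val_qcone //; apply/proj_face.
have secE (y : sections (constant_sheaf D') [set: D']%SET) (s' : D') (hs : s' \in [set: D']%SET):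
    sec_val y s' hs = sec_val y (q u) (finset.in_setT _).
  have [s [Ss E]] := qcone_surj s'; subst s'.
  exact: (svalP y _ _ hs (finset.in_setT (q u)) (q0 _ Ss)).
have sgn0 (r : R) s : r *~ qsign s = 0 -> r = 0.
  by rewrite /qsign; case: ifP => _; rewrite ?mulrN1z ?mulr1z // => /eqP; rewrite oppr_eq0 => /eqP.
have [top Stop topd] := top_exists pureD u.
have aug (y : sections (constant_sheaf D') [set: D']%SET) :
    (forall s : D', interior 0 s -> sec_val y s (finset.in_setT s) = 0) -> y = 0.
  move=> Hy; apply: sections_ext => s' hs; rewrite secE.
  rewrite -(secE y (q top) (finset.in_setT _)) Hy //; apply/(qcone_interior _ Stop).
  by split; [rewrite addn0|exact: bd_fan_top].
rewrite (reduced_acyclicE oT aug).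
have [q' Hq'] := choice (fun s' : D' => qcone_surj s').
have q'K s : S `<=` val s -> q' (q s) = s.
  by move=> Ss; apply: (@qcone_inj _ _ _ u) => //; [exact: (Hq' _).1|exact: (Hq' _).2].
(* [q'] inverts [qcone] on the star; [down] transports a cochain and rescales it. *)
pose down (c : D -> R) : D' -> R := fun s' : D' => c (q' s') *~ qsign (q' s').
have downE c s : S `<=` val s -> down c (q s) = c s *~ qsign s.
  by move=> Ss; rewrite /down q'K.
have scobE c t : S `<=` val t -> scob o (fun s => down c (q s) *~ qsign s) t = scob o c t.
  move=> St; apply: eq_bigr => s /asboolP/facetE[ts _].
  by congr (_ *~ _); rewrite downE ?qsign_sq; [rewrite -mulrzA qsign_sq mulr1z|exact: subset_trans St ts].
split=> H m.
  move=> c Hc; have [|y [cy Hy]] := H m (down c).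
    move=> t' It; have [t [St E]] := qcone_surj t'; subst t'.
    rewrite transversal_coboundary // scobE // Hc ?mul0rz //.
    exact/(qcone_interior _ St).
  have key s (r : R) : down c (q s) = r -> S `<=` val s -> c s = r *~ qsign s.
    by move=> + Ss; rewrite downE // => <-; rewrite -mulrzA qsign_sq mulr1z.
  case: m {Hc} cy Hy => [|m] cy Hy.
    exists (fun _ => y (q u) *~ qsign top); split=> // s Ss Is.
    have E : qsign s = qsign top by apply: qsign_top => //; case: Is; rewrite addn0.
    rewrite /= -E; apply: key => //.
    by rewrite Hy; [exact: (cy erefl (q s) (q u) (q0 _ Ss))|exact/(qcone_interior _ Ss)].
  exists (fun s => y (q s) *~ qsign s); split=> // s Ss Is.
  have := Hy (q s) (iffRL (qcone_interior _ Ss) Is).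
  by rewrite transversal_coboundary // => /key/(_ Ss) ->; rewrite -mulrzA qsign_sq mulr1z.
move=> x Hx; have [|b [cb Hb]] := H m (fun s => x (q s) *~ qsign s).
  move=> t St It; have := Hx (q t) (iffRL (qcone_interior _ St) It).
  by rewrite transversal_coboundary // => /sgn0.
have key (s' : D') : interior m s' -> exists s, [/\ S `<=` val s, interior m s, q s = s' &
    (x s' : R) = dstar o m b s *~ qsign s].
  move=> Is'; have [s [Ss E]] := qcone_surj s'; subst s'.
  have Is := iffLR (qcone_interior _ Ss) Is'.
  by exists s; split=> //; rewrite -(Hb s Ss Is) -mulrzA qsign_sq mulr1z.
case: m {Hx Hb} cb key => [|m] cb key.
  exists (fun _ => b u *~ qsign top); split=> // _ /key[s [Ss Is <- ->]] /=.
  have E : qsign s = qsign top by apply: qsign_top => //; case: Is; rewrite addn0.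
  by rewrite E (cb erefl s u).
exists (down b); split=> // _ /key[s [Ss Is <- ->]].
by rewrite transversal_coboundary // scobE.
Qed.

End TransversalSigns.

(** * Star complexes in the extreme degrees *)

Section StarGeometry.
Variables (R : realType) (V : vectType R) (D : fan V) (o : orientation D).
Local Notation n := (\dim {:V}).
Hypothesis pureD : purely_dim n D.
Variable u : D.
Implicit Types (g t s r : D).

Definition ray r := val u `<=` val r /\ cone_dim (val r) = (cone_dim (val u)).+1.
Definition cone2 g := val u `<=` val g /\ cone_dim (val g) = (cone_dim (val u)).+2.

Lemma ray_below s : val u `<=` val s -> (cone_dim (val u) < cone_dim (val s))%N ->
  exists2 r, ray r & val r `<=` val s.
Proof.
move=> us lt; have uns : val u <> val s by move=> E; rewrite E ltnn in lt.
by have [r [rD ur rs rd]] := ray_exists (valP s) (valP u) us uns; exists (FSetSub rD).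
Qed.

(** Inside an n-cone [P] spreads by [ray_connect]. A wall containing a ray with [P] is not in the
    boundary, since that ray is not, so there is an n-cone behind it and [walk] applies. Codimension
    at least two ensures that every wall contains a ray. *)
Lemma star_connected (P : D -> Prop) r0 : (cone_dim (val u) + 2 <= n)%N ->
  (forall r1 r2 g, ray r1 -> ray r2 -> cone2 g -> val r1 `<=` val g ->
     val r2 `<=` val g -> P r1 -> P r2) ->
  (forall r, ray r -> P r -> r \notin bd_fan D) ->
  ray r0 -> P r0 -> forall r, ray r -> P r.
Proof.
move=> ud adj nbd ray0 P0 r ray_r.
pose PS (s : set V) := exists2 s' : D, val s' = s & P s'.
have PSE s : PS (val s) <-> P s.
  by split=> [[s' /val_inj ->]|Ps] //; exists s.
have rayE s : is_ray D (val u) (val s) <-> ray s.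
  split; [by case=> _|by case=> us sd; split=> //; exact: valP].
have PSadj (r1 r2 g : set V) : is_ray D (val u) r1 -> is_ray D (val u) r2 -> is_2cone D (val u) g ->
  r1 `<=` g -> r2 `<=` g -> PS r1 -> PS r2.
  move=> [r1D ur1 d1] [r2D ur2 d2] [gD ug dg] r1g r2g.
  move=> /(PSE (FSetSub r1D)) P1; apply/(PSE (FSetSub r2D)).
  exact: (adj (FSetSub r1D) (FSetSub r2D) (FSetSub gD)).
have conn g r1 r2 : ray r1 -> ray r2 -> val r1 `<=` val g -> val r2 `<=` val g -> P r1 -> P r2.
  move=> /rayE ray1 /rayE ray2 r1g r2g /PSE P1; apply/PSE.
  exact: (ray_connect (valP u) PSadj (valP g) ray1 ray2 r1g r2g P1).
pose Q (g : set V) := forall s, ray s -> val s `<=` g -> P s.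
have [g0 r0g0 g0d] := top_exists pureD r0.
have [g1 rg1 g1d] := top_exists pureD r.
suff : Q (val g1) by apply.
apply: (@walk _ _ D (val u) (valP u) Q (val g0) (val g1)); last first.
- by move=> s rays sg; apply: (conn g0 r0 s).
- by split=> //; [exact: valP|exact: subset_trans ray_r.1 rg1].
- by split=> //; [exact: valP|exact: subset_trans ray0.1 r0g0].
move=> g w [gD ug gd] [wD uw wd] wg Qg.
pose w' : D := FSetSub wD; pose g' : D := FSetSub gD.
have [|s' rays sw] := @ray_below w' uw.
  by rewrite -ltnS [X in (_ < X)%N]wd; lia.
have Ps : P s' by apply: Qg => //=; exact: subset_trans sw wg.
have wb : w' \notin bd_fan D.
  by apply: contra (nbd _ rays Ps); apply: bd_fan_sub.
have Iw : interior 1 w' by split=> //=; rewrite addn1.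
have [g2 [gd2 /facetE[wg2 _] ne]] := wall_other Iw (wg : val w' `<=` val g') gd.
exists (val g2); split=> //.
- by split=> //; [exact: valP|exact: subset_trans uw wg2].
- by move=> E; case/eqP: ne; apply: val_inj.
- by move=> s2 rays2 s2g; apply: (conn g2 s' s2) => //; exact: subset_trans sw wg2.
Qed.

Lemma incidence_sq s t : incidence o s t * incidence o s t = 1.
Proof. by rewrite /incidence; case: ifP. Qed.

Lemma star_top s m : val u `<=` val s -> (cone_dim (val u) + m)%N = n ->
  (cone_dim (val s) + m)%N = n -> s = u.
Proof.
move=> us ud sd; apply/val_inj/esym/(cone_dim_eq (valP s) (valP u) us); lia.
Qed.

Lemma star_exact_dim0 : cone_dim (val u) = n -> star_exact o u 0.
Proof.
move=> ud c _; exists (fun _ => c u); split=> // s us [sd _]; congr c.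
by apply: (star_top us _ sd); rewrite addn0.
Qed.

(** A boundary wall has a single n-cone; otherwise the cocycle condition at [u] equates the values
    on its two n-cones, whose signs are opposite. *)
Lemma star_exact_dim1 : (cone_dim (val u) + 1)%N = n -> star_exact o u 0.
Proof.
move=> ud c Hc; have [g ug gd] := top_exists pureD u.
have ud' := ud; rewrite addn1 in ud'.
have fg : facet (val u) (val g) by apply/facetE; rewrite gd.
exists (fun _ => c g); split=> // s us [sd _] /=; rewrite addn0 in sd.
have fs : facet (val u) (val s) by apply/facetE; rewrite sd.
have [-> //|sg] := eqVneq s g.
have [ub|ub] := boolP (u \in bd_fan D).
  move: ub; rewrite finset.in_set => /asboolP[r [rd rc /face_sub_fan ur]].
  have ru : r = u by apply: (@star_top r 1); rewrite // addn1.
  move/eqP: rc => /cards1P[x xE].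
  have : s \in [set x]%SET by rewrite -xE ru finset.in_set sd eqxx; exact/asboolP.
  have : g \in [set x]%SET by rewrite -xE ru finset.in_set gd eqxx; exact/asboolP.
  by rewrite !finset.in_set1 => /eqP -> /eqP ->.
have Iu : interior 1 u by split.
have := Hc u (@subset_refl _ _) Iu; rewrite /scob.
rewrite (bigD1 g) /=; last exact/asboolP.
rewrite (bigD1 s) /=; last by rewrite sg andbT; apply/asboolP.
rewrite big_pred0 ?addr0; last first.
  move=> s'; apply/negbTE/negP => /andP[/andP[/asboolP f n1] n2].
  by case/eqP: n2; apply: (wall_third ud' fg fs f).
rewrite (wall_sign o fg fs gd sd) ?[g == s]eq_sym // mulrNz -mulNrz -mulrzDl.
move/(congr1 (fun z : R => z *~ incidence o s u)).
rewrite mul0rz -mulrzA incidence_sq mulr1z => /eqP.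
by rewrite addrC subr_eq0 => /eqP.
Qed.

(** In the last degree [u] is the only cone left, and its incidence number with any ray is
    invertible. *)
Lemma star_exact_last k : (cone_dim (val u) + k.+1)%N = n -> star_exact o u k.+1.
Proof.
move=> ud c _.
have [g ug gd] := top_exists pureD u.
have [|r [ur rd] rg] := ray_below ug; first by lia.
exists (fun s => if s == r then c u *~ incidence o r u else 0); split=> // s us [sd _].
have -> : s = u by apply: (star_top us ud sd).
rewrite /= /scob (bigD1 r) /=; last exact/asboolP/facetE.
rewrite eqxx -mulrzA incidence_sq mulr1z big1 ?addr0 //.
by move=> s' /andP[_ /negbTE ->]; rewrite mul0rz.
Qed.

Section Rays.
Variables (k : nat).
Hypothesis ud : (cone_dim (val u) + k.+2)%N = n.

Definition ray_exact (x : D -> R) :=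
  exists b : D -> R, forall s, val u `<=` val s -> interior k.+1 s -> x s = scob o b s.

(** The sign normalizes the coboundary at [u] to 1 for every ray. *)
Definition ray_delta r : D -> R := fun s => if s == r then (incidence o r u)%:~R else 0.

Lemma ray_exactD x y (c : R) : ray_exact x -> ray_exact y ->
  ray_exact (fun s => c * x s + y s).
Proof.
move=> [b Hb] [b' Hb']; exists (fun s => c * b s + b' s) => s us Is.
rewrite (Hb s us Is) (Hb' s us Is) /scob mulr_sumr -big_split /=.
by apply: eq_bigr => s' _; rewrite mulrzDl mulrzAr.
Qed.

Lemma ray_exact_ext x y : (forall s, ray s -> s \notin bd_fan D -> x s = y s) ->
  ray_exact x -> ray_exact y.
Proof.
move=> E [b Hb]; exists b => s us Is; rewrite -Hb // E //; last by case: Is.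
by split=> //; case: Is => sd _; lia.
Qed.

Lemma ray_exact0 : ray_exact (fun _ => 0).
Proof. by exists (fun _ => 0) => s _ _; rewrite /scob big1 // => t _; rewrite mul0rz. Qed.

(** For distinct rays this is, up to sign, the coboundary of the unit at [g], which in the star
    meets only [r1] and [r2], with the signs of [diamond_sign]. *)
Lemma ray_exact_adj r1 r2 g : ray r1 -> ray r2 -> cone2 g ->
  val r1 `<=` val g -> val r2 `<=` val g ->
  ray_exact (fun s => ray_delta r1 s - ray_delta r2 s).
Proof.
move=> [ur1 d1] [ur2 d2] [ug dg] r1g r2g.
have [->|ne] := eqVneq r1 r2.
  by apply: ray_exact_ext ray_exact0 => s _ _; rewrite subrr.
have f1 : facet (val r1) (val g) by apply/facetE; rewrite dg d1.
have f2 : facet (val r2) (val g) by apply/facetE; rewrite dg d2.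
have fu1 : facet (val u) (val r1) by apply/facetE; rewrite d1.
have fu2 : facet (val u) (val r2) by apply/facetE; rewrite d2.
pose e : int := incidence o g r1 * incidence o r1 u.
exists (fun s => if s == g then e%:~R else 0) => s us [sd _].
have sd' : cone_dim (val s) = (cone_dim (val u)).+1 by lia.
rewrite /scob; have [fs|nfs] := pselect (facet (val s) (val g)); last first.
  rewrite big1; last first.
    move=> s' /asboolP f; case: eqP => [E|_]; last by rewrite mul0rz.
    by case: nfs; rewrite -E.
  have E1 : s != r1 by apply: contra_not_neq nfs => ->.
  have E2 : s != r2 by apply: contra_not_neq nfs => ->.
  by rewrite /ray_delta (negbTE E1) (negbTE E2) subrr.
rewrite (bigD1 g) /=; last exact/asboolP.
rewrite eqxx big1 ?addr0; last by move=> s' /andP[_ /negbTE ->]; rewrite mul0rz.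
have [x1 [x2 [_ [_ [_ H]]]]] := diamond (valP g) (valP u) ug dg.
have H1 := H _ (valP r1) ur1 r1g d1; have H2 := H _ (valP r2) ur2 r2g d2.
have Hs := H _ (valP s) us (iffLR (facetE _ _) fs).1 sd'.
have nv : val r1 <> val r2 by move/val_inj/eqP; rewrite (negbTE ne).
have : s = r1 \/ s = r2.
  by case: H1 => E1; case: H2 => E2; case: Hs => Es;
    solve [by case: nv; rewrite E1 E2 | by left; apply: val_inj; rewrite Es E1
      | by right; apply: val_inj; rewrite Es E2].
rewrite -mulrzr -intrM /ray_delta => -[->|->]; rewrite eqxx.
  by rewrite (negbTE ne) subr0 /e mulrAC incidence_sq mul1r.
rewrite eq_sym (negbTE ne) sub0r /e (diamond_sign o fu1 fu2 f1 f2 ne).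
by rewrite mulNr mulrAC incidence_sq mul1r mulrNz.
Qed.

(** The degree before the last, where cochains are combinations of the units [ray_delta]. A ray in
    the boundary has an exact unit, since relative cochains ignore it, and exactness spreads to all
    rays. Without boundary rays all units are cohomologous, and the cocycle condition at [u] says
    that the coefficients add up to zero. *)
Lemma star_exact_rays : star_exact o u k.+1.
Proof.
move=> c Hc; suff [b Hb] : ray_exact c by exists b.
have ud2 : (cone_dim (val u) + 2 <= n)%N by lia.
have cE : forall s, ray s -> c s = \sum_(r : D | `[< facet (val u) (val r) >])
    (c r *~ incidence o r u) * ray_delta r s.
  move=> s [us sd]; rewrite (bigD1 s) /=; last by apply/asboolP/facetE.
  rewrite {1}/ray_delta eqxx mulrzr -mulrzA incidence_sq mulr1z big1 ?addr0 //.
  by move=> r /andP[_ ne]; rewrite /ray_delta eq_sym (negbTE ne) mulr0.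
have sumE (Q : D -> D -> R) : (forall r, ray r -> ray_exact (Q r)) ->
    ray_exact (fun s => \sum_(r : D | `[< facet (val u) (val r) >])
      (c r *~ incidence o r u) * Q r s).
  move=> HQ; elim: (index_enum _) => [|r l IH].
    by apply: ray_exact_ext ray_exact0 => s _ _; rewrite big_nil.
  have [f|nf] := pselect (facet (val u) (val r)); last first.
    apply: ray_exact_ext IH => s _ _; rewrite big_cons ifF //.
    by apply/asboolP.
  have Qr := HQ r (iffLR (facetE _ _) f).
  apply: (ray_exact_ext _ (ray_exactD (c r *~ incidence o r u) Qr IH)) => s _ _.
  by rewrite big_cons ifT //; apply/asboolP.
have [[rb [rayb bdb]]|nobd] := pselect (exists r, ray r /\ r \in bd_fan D).
  have Pb : ray_exact (ray_delta rb).
    apply: ray_exact_ext ray_exact0 => s _ sb; rewrite /ray_delta ifF //.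
    by apply/eqP => E; rewrite E bdb in sb.
  have all_exact r : ray r -> ray_exact (ray_delta r).
    move=> ray_r; apply: contrapT => nr.
    suff : ~ ray_exact (ray_delta rb) by [].
    (* The property that spreads is non-exactness, which can only occur at rays outside the
       boundary. *)
    apply: (star_connected (P := fun r => ~ ray_exact (ray_delta r)) ud2 _ _ ray_r nr rayb).
      move=> r1 r2 g ray1 ray2 c2 r1g r2g n1 e2; apply: n1.
      have := ray_exactD 1 (ray_exact_adj ray1 ray2 c2 r1g r2g) e2.
      by apply: ray_exact_ext => s _ _; rewrite mul1r subrK.
    move=> r' ray' n'; apply/negP => b'; apply: n'.
    apply: ray_exact_ext ray_exact0 => s _ sb; rewrite /ray_delta ifF //.
    by apply/eqP => E; rewrite E b' in sb.
  apply: (ray_exact_ext _ (sumE ray_delta all_exact)) => s rays _.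
  by rewrite -cE.
(* A boundary wall containing [u] would contain a ray, which would then be in the boundary. *)
have Iu : interior k.+2 u.
  split=> //; apply/negP; rewrite finset.in_set => /asboolP[r [rd rc /face_sub_fan ur]].
  have [|s rays sr] := ray_below ur; first by lia.
  apply: nobd; exists s; split=> //; rewrite finset.in_set; apply/asboolP.
  by exists r; split=> //; apply/face_sub_fan.
have [g ug gd] := top_exists pureD u.
have [|r0 ray0 _] := ray_below ug; first by lia.
have all_exact r : ray r -> ray_exact (fun s => ray_delta r s - ray_delta r0 s).
  apply: (star_connected (P := fun r => ray_exact (fun s => ray_delta r s - ray_delta r0 s))
    ud2 _ _ ray0).
  - move=> r1 r2 g' ray1 ray2 c2 r1g r2g e1.
    have := ray_exactD 1 (ray_exact_adj ray2 ray1 c2 r2g r1g) e1.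
    by apply: ray_exact_ext => s _ _; rewrite mul1r addrA subrK.
  - by move=> r' ray' _; apply/negP => b'; apply: nobd; exists r'.
  - by apply: ray_exact_ext ray_exact0 => s _ _; rewrite subrr.
apply: (ray_exact_ext _ (sumE (fun r s => ray_delta r s - ray_delta r0 s) all_exact)) => s rays _.
rewrite [RHS]cE //.
under eq_bigr => r _ do rewrite mulrBr.
rewrite big_split /= sumrN -mulr_suml.
by have := Hc u (@subset_refl _ _) Iu; rewrite /scob => ->; rewrite mul0r subr0.
Qed.

End Rays.

End StarGeometry.

(** * Linear forms and free modules *)

Section LinearForms.
Variables (R : realType) (V : vectType R).
Implicit Types (U W : {vspace V}) (h : 'Hom(V, R^o)) (hs : seq 'Hom(V, R^o)).

Definition linform U h : {mpoly R[\dim U]} := \sum_(i < \dim U) (h (vbasis U)`_i : R) *: 'X_i.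

HB.instance Definition _ U W := GRing.RMorphism.copy (@symres R V U W) (comp_mpoly _).

Lemma symresC U W c : symres U W c%:MP = c%:MP.
Proof. exact: comp_mpolyC. Qed.

Lemma symresX U W i : symres U W 'X_i =
  \sum_(j < \dim W) coord (vbasis U) i (vbasis W)`_j *: 'X_j.
Proof. by rewrite /symres comp_mpolyXU (nth_map i) ?size_enum_ord // nth_ord_enum. Qed.

Lemma symresZ U W c p : symres U W (c *: p) = c *: symres U W p.
Proof. exact: comp_mpolyZ. Qed.

Lemma symres_linform U W h : (W <= U)%VS -> symres U W (linform U h) = linform W h.
Proof.
move=> WU; rewrite /linform raddf_sum /=.
under eq_bigr => i _ do rewrite symresZ symresX scaler_sumr.
rewrite exchange_big /=; apply: eq_bigr => j _.
under eq_bigr => i _ do rewrite scalerA.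
rewrite -scaler_suml; congr (_ *: _).
have bj : (vbasis W)`_j \in U.
  by apply: (subvP WU); apply/vbasis_mem/mem_nth; rewrite size_tuple.
rewrite [in RHS](coord_vbasis bj) linear_sum /=.
by apply: eq_bigr => i _; rewrite homZ mulrC.
Qed.

Lemma mcoeff_sumX (m : nat) (c : 'I_m -> R) (j : 'I_m) :
  (\sum_(i < m) c i *: 'X_i : {mpoly R[m]})@_U_(j) = c j.
Proof.
rewrite raddf_sum /= (bigD1 j) //= mcoeffZ mcoeffX eqxx mulr1 big1 ?addr0 // => i ne.
by rewrite mcoeffZ mcoeffX eq_mnm1 (negbTE ne) mulr0.
Qed.

Lemma comp_mpoly_sumX (m k : nat) (c : 'I_m -> R) (t : m.-tuple {mpoly R[k]}) :
  (\sum_(i < m) c i *: 'X_i) \mPo t = \sum_(i < m) c i *: tnth t i.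
Proof.
rewrite (big_morph (comp_mpoly t) (comp_mpolyD t) (comp_mpoly0 t)).
by apply: eq_bigr => i _; rewrite comp_mpolyZ comp_mpolyXU (tnth_nth 0).
Qed.

Lemma linform_eq0 U h : (forall v, v \in U -> h v = 0) -> linform U h = 0.
Proof.
move=> h0; rewrite /linform big1 // => i _.
by rewrite h0 ?scale0r // vbasis_mem // mem_nth // size_tuple.
Qed.

Lemma linform_neq0 U h v : v \in U -> h v != 0 -> linform U h != 0.
Proof.
move=> vU hv; apply: contraNneq hv => E.
rewrite (coord_vbasis vU) linear_sum /= big1 // => i _.
have := congr1 (mcoeff U_(i)) E; rewrite mcoeff_sumX mcoeff0 => E'.
by rewrite homZ E' mulr0.
Qed.

Lemma linform_homog U h : linform U h \is 1.-homog.
Proof.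
apply: rpred_sum => i _; apply: rpredZ.
by rewrite dhomogX /= mdeg1.
Qed.

Lemma linform_mcoeff0 U h : (linform U h)@_0%MM = 0.
Proof. by rewrite (dhomog_nemf_coeff (linform_homog U h)) //= mdeg0. Qed.

Lemma symres_mcoeff0 U W p : (symres U W p)@_0%MM = p@_0%MM.
Proof.
elim/mpolyind: p => [|c m p _ _ IH]; first by rewrite raddf0 !mcoeff0.
rewrite raddfD /= !mcoeffD IH; congr (_ + _).
rewrite symresZ !mcoeffZ; congr (_ * _).
rewrite mpolyXE_id !rmorph_prod; apply: eq_bigr => i _.
rewrite !rmorphXn; congr (_ ^+ _) => /=; rewrite symresX.
rewrite mcoeffX mnm1_eq0 raddf_sum /= big1 // => j _.
by rewrite mcoeffZ mcoeffX mnm1_eq0 mulr0.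
Qed.

Lemma symres_homog U W q p : p \is q.-homog -> symres U W p \is q.-homog.
Proof.
move=> /dhomogP hp; rewrite (mpolyE p) raddf_sum /= big_seq.
apply: rpred_sum => m /hp <-; rewrite symresZ; apply: rpredZ.
rewrite mpolyXE_id rmorph_prod /= mdegE.
apply: (big_ind2 (fun a b => a \is b.-homog)).
- exact: dhomog1.
- by move=> ? ? ? ?; exact: dhomogM.
move=> i _; rewrite rmorphXn /= -[X in X.-homog]mul1n; apply: dhomogMn.
rewrite symresX; apply: rpred_sum => j _; apply: rpredZ.
by rewrite dhomogX /= mdeg1.
Qed.

Fixpoint zeros U hs : {vspace V} :=
  if hs is h :: hs' then (zeros U hs' :&: lker h)%VS else U.

Lemma memv_zeros U hs v :
  (v \in zeros U hs) = (v \in U) && all (fun h : 'Hom(V, R^o) => h v == 0) hs.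
Proof.
elim: hs => [|h hs IH] /=; first by rewrite andbT.
by rewrite memv_cap IH memv_ker andbAC -andbA.
Qed.

Lemma zeros_sub U hs : (zeros U hs <= U)%VS.
Proof. by apply/subvP => v; rewrite memv_zeros => /andP[]. Qed.

Lemma zeros_form U hs h v : h \in hs -> v \in zeros U hs -> h v = 0.
Proof. by rewrite memv_zeros => hh /andP[_ /allP/(_ _ hh)/eqP]. Qed.

(** Elimination: a vector [u] with [g u != 0] fixes the coefficient of [g], and the rest is a
    relation on the kernel of [g]. *)
Lemma form_comb U hs h : (forall v, v \in zeros U hs -> h v = 0) ->
  exists c : nat -> R, forall v, v \in U -> h v = \sum_(i < size hs) c i * hs`_i v.
Proof.
elim: hs U h => [|g hs IH] U h Hh.
  by exists (fun _ => 0) => v vU; rewrite big_ord0; apply: Hh.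
have [|c Hc] := IH (U :&: lker g)%VS h.
  move=> v; rewrite memv_zeros memv_cap memv_ker => /andP[/andP[vU vg] vhs].
  by apply: Hh; rewrite memv_zeros vU /= vg.
have Hc' v : v \in U -> g v = 0 -> h v = \sum_(i < size hs) c i * hs`_i v.
  by move=> vU gv; apply: Hc; rewrite memv_cap vU memv_ker gv eqxx.
have [[u uU gu]|nu] := pselect (exists2 u, u \in U & g u != 0); last first.
  exists (fun i => if i is j.+1 then c j else 0) => v vU; rewrite big_ord_recl /= mul0r add0r.
  apply: Hc' => //; apply/eqP/negPn/negP => gv; apply: nu; by exists v.
pose d := (h u - \sum_(i < size hs) c i * hs`_i u) / g u.
exists (fun i => if i is j.+1 then c j else d) => v vU; rewrite big_ord_recl /=.
pose w := v - (g v / g u) *: u.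
have vE : v = w + (g v / g u) *: u by rewrite subrK.
have gw : g w = 0 by rewrite homB homZ divfK // subrr.
have wU : w \in U by rewrite rpredB ?rpredZ.
rewrite [in LHS]vE homD homZ (Hc' w wU gw).
have -> : \sum_(i < size hs) c (bump 0 i).-1 * hs`_i v = \sum_(i < size hs) c i * hs`_i w
   + (g v / g u) * \sum_(i < size hs) c i * hs`_i u.
  rewrite mulr_sumr -big_split; apply: eq_bigr => i _ /=.
  by rewrite [in LHS]vE homD homZ mulrDr; congr (_ + _); rewrite mulrCA.
by rewrite /d; field.
Qed.

Lemma form_extend U (l : 'I_(\dim U) -> R) : exists h : 'Hom(V, R^o),
  forall v, v \in U -> h v = \sum_(i < \dim U) l i * coord (vbasis U) i v.
Proof.
pose f (v : V) : R^o := \sum_(i < \dim U) l i * coord (vbasis U) i v.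
have lf : linear f.
  move=> a x y; rewrite /f scaler_sumr -big_split; apply: eq_bigr => i _ /=.
  by rewrite linearP /= mulrDr [l i * (a * _)]mulrCA.
pose F : {linear V -> R^o} := HB.pack f (GRing.isLinear.Build R V R^o _ f lf).
by exists (linfun F) => v _; rewrite lfunE.
Qed.

(* Writing pi for a projection of U onto W, the polynomials p and p \o pi are
   congruent modulo the linear forms vanishing on W. *)
Lemma symres_ker U hs p : symres U (zeros U hs) p = 0 ->
  exists c : nat -> {mpoly R[\dim U]}, p = \sum_(i < size hs) c i * linform U hs`_i.
Proof.
set W := zeros U hs; have WU : (W <= U)%VS := zeros_sub U hs.
pose I q := exists c : nat -> {mpoly R[\dim U]}, q = \sum_(i < size hs) c i * linform U hs`_i.
have I0 : I 0 by exists (fun _ => 0); rewrite big1 // => i _; rewrite mul0r.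
have ID q r : I q -> I r -> I (q + r).
  move=> [c ->] [d ->]; exists (fun i => c i + d i).
  by rewrite -big_split; apply: eq_bigr => i _; rewrite mulrDl.
have IM q r : I q -> I (r * q).
  move=> [c ->]; exists (fun i => r * c i).
  by rewrite mulr_sumr; apply: eq_bigr => i _; rewrite mulrA.
(* The coordinates of W composed with the projection; thus [phi q] is [q] composed with the
   projection of U onto W. *)
pose lam (j : 'I_(\dim W)) : {mpoly R[\dim U]} :=
  \sum_(i < \dim U) coord (vbasis W) j (projv W (vbasis U)`_i) *: 'X_i.
pose phi q : {mpoly R[\dim U]} := symres U W q \mPo [tuple lam j | j < \dim W].
have key q : I (q - phi q).
  elim/mpolyind: q => [|c m q _ _ IH]; first by rewrite /phi raddf0 comp_mpoly0 subr0.
  rewrite /phi raddfD /= comp_mpolyD opprD addrACA; refine (ID _ _ _ IH).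
  rewrite symresZ comp_mpolyZ -scalerBr -mul_mpolyC; apply: (IM).
  rewrite mpolyXE_id !rmorph_prod /=.
  (* Telescoping over the factors of a monomial, and [subrXX] for powers, reduce the claim to a
     single variable. *)
  apply: (big_rec2 (fun a b => I (a - b))); first by rewrite subrr.
  move=> i a b _ Iab.
  set x := 'X_i ^+ m i; set y := _ \mPo _.
  have -> : x * a - y * b = x * (a - b) + b * (x - y) by ring.
  refine (ID _ _ (IM _ _ Iab) (IM _ _ _)); rewrite /x /y !rmorphXn /= subrXX.
  rewrite [_ * \sum_(_ < _) _]mulrC; apply: (IM).
  rewrite symresX comp_mpoly_sumX.
  under [X in _ - X]eq_bigr => j _ do rewrite tnth_mktuple.
  have [h Hh] := form_extend (fun k => (k == i)%:R : R).
  have hE v : v \in U -> h v = coord (vbasis U) i v.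
    move=> vU; rewrite Hh // (bigD1 i) //= eqxx mul1r big1 ?addr0 // => j /negbTE ->.
    by rewrite mul0r.
  (* A coordinate form minus its composition with the projection vanishes on W, so [form_comb]
     applies. *)
  pose h' : 'Hom(V, R^o) := h - (h \o projv W)%VF.
  have h'E v : h' v = h v - h (projv W v) by rewrite add_lfunE opp_lfunE comp_lfunE.
  have [|c' Hc'] := @form_comb U hs h'.
    by move=> v vW; rewrite h'E projv_id // subrr.
  exists (fun j => (c' j)%:MP).
  have projU v : projv W v \in U by apply: (subvP WU); exact: memv_proj.
  have -> : 'X_i - \sum_(j < \dim W) coord (vbasis U) i (vbasis W)`_j *: lam j = linform U h'.
    rewrite /lam.
    under [X in _ - X]eq_bigr => j _ do rewrite scaler_sumr.
    rewrite exchange_big /=.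
    have -> : 'X_i = \sum_(k < \dim U) (k == i)%:R *: 'X_k :> {mpoly R[\dim U]}.
      by rewrite (bigD1 i) //= eqxx scale1r big1 ?addr0 // => k /negbTE ->; rewrite scale0r.
    rewrite -sumrB; apply: eq_bigr => k _.
    under eq_bigr => j _ do rewrite scalerA.
    rewrite -scaler_suml -scalerBl; congr (_ *: _).
    have bk : (vbasis U)`_k \in U by apply/vbasis_mem/mem_nth; rewrite size_tuple.
    rewrite h'E !hE // coord_free ?(basis_free (vbasisP U)) //; congr (_%:R - _).
    rewrite [in RHS](coord_vbasis (memv_proj W (vbasis U)`_k)) linear_sum /=.
    by apply: eq_bigr => j _; rewrite linearZ /= mulrC.
  rewrite /linform.
  under [RHS]eq_bigr => j _ do rewrite mulr_sumr.
  rewrite exchange_big; apply: eq_bigr => k _ /=.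
  have bk : (vbasis U)`_k \in U by apply/vbasis_mem/mem_nth; rewrite size_tuple.
  rewrite Hc' // scaler_suml; apply: eq_bigr => j _.
  by rewrite mul_mpolyC scalerA.
by move=> p0; have := key p; rewrite /phi p0 comp_mpoly0 subr0.
Qed.

Lemma symres0 U W (p : {mpoly R[\dim U]}) : \dim W = 0%N ->
  symres U W p = (p@_0%MM)%:MP.
Proof.
move=> W0; rewrite -(symres_mcoeff0 W p); apply/mpolyP => m; rewrite mcoeffC.
suff -> : m = 0%MM by rewrite eqxx mulr1.
by apply/mnmP => i; have := ltn_ord i; rewrite {2}W0.
Qed.

End LinearForms.

Section Components.
Variables (I : eqType) (N M : zmodType) (ok : I -> N -> Prop) (e : I -> N -> M).
Hypothesis ok0 : forall i, ok i 0.
Hypothesis okB : forall i a b, ok i a -> ok i b -> ok i (a - b).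
Hypothesis eB : forall i a b, e i (a - b) = e i a - e i b.
Hypothesis gen : forall x, exists (l : seq I) (c : I -> N),
  (forall i, ok i (c i)) /\ x = \sum_(i <- l) e i (c i).
Hypothesis indep : forall (l : seq I) (c : I -> N), uniq l -> (forall i, ok i (c i)) ->
  \sum_(i <- l) e i (c i) = 0 -> forall i, i \in l -> c i = 0.

(** Common to gradings and bases. With [I] the degrees it yields homogeneous components; with
    [I = M] and [e b a = a *: b] it yields coordinates, [ok] forcing the coefficients outside the
    basis to vanish. *)
Lemma components : exists comp : M -> I -> N,
  [/\ forall x i, ok i (comp x i),
      forall x, exists l, [/\ uniq l, forall i, i \notin l -> comp x i = 0 &
                              x = \sum_(i <- l) e i (comp x i)],
      forall x y i, comp (x - y) i = comp x i - comp y i &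
      forall x l c, uniq l -> (forall i, ok i (c i)) -> (forall i, i \notin l -> c i = 0) ->
        x = \sum_(i <- l) e i (c i) -> comp x =1 c].
Proof.
have e0 i : e i 0 = 0 by have := eB i 0 0; rewrite !subrr.
have okD i a b : ok i a -> ok i b -> ok i (a + b).
  by move=> oa ob; rewrite -[b]opprK -[- b]sub0r; apply: okB => //; exact: okB.
have eD i a b : e i (a + b) = e i a + e i b.
  by rewrite -{1}[b]opprK eB -[- b]sub0r eB e0 sub0r opprK.
pose good x l c := [/\ uniq l, forall i, ok i (c i), forall i, i \notin l -> c i = 0 &
  x = \sum_(i <- l) e i (c i)].
have ex x : exists c : I -> N, exists l, good x l c.
  have [l0 [c0 [okc ->]]] := gen x; elim: l0 => [|i l [c [l' [ul okc' c0' E]]]].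
    by exists (fun _ => 0), [::]; split=> //; rewrite !big_nil.
  exists (fun j => if j == i then c i + c0 i else c j), (undup (i :: l')); split.
  - exact: undup_uniq.
  - by move=> j; case: eqP => [->|_] //; exact: okD.
  - move=> j; rewrite mem_undup inE negb_or => /andP[/negbTE -> /c0'] //.
  rewrite big_cons E; have [il|il] := boolP (i \in l').
    rewrite /= il undup_id //.
    rewrite (bigD1_seq i) //= [RHS](bigD1_seq i) //= eqxx eD [e i (c i) + _]addrC -addrA.
    by congr (_ + (_ + _)); apply: eq_bigr => j /negbTE ->.
  rewrite /= (negbTE il) undup_id // big_cons eqxx (c0' i il) add0r; congr (_ + _).
  rewrite big_seq [RHS]big_seq; apply: eq_bigr => j jl.
  by case: eqP => // ji; rewrite ji (negbTE il) in jl.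
have [comp Hc] := choice ex.
have wide l1 (c1 : I -> N) l2 : uniq l2 -> {subset l1 <= l2} -> uniq l1 ->
    (forall i, i \notin l1 -> c1 i = 0) ->
    \sum_(i <- l1) e i (c1 i) = \sum_(i <- l2) e i (c1 i).
  move=> u2 sub u1 z1; rewrite [RHS](bigID (mem l1)) /= [X in _ + X]big1 ?addr0; last first.
    by move=> j /z1 ->; rewrite e0.
  rewrite -[RHS]big_filter; apply: perm_big; apply: uniq_perm => //.
    by rewrite filter_uniq.
  by move=> j; rewrite mem_filter; case: (boolP (j \in l1)) => //= /sub ->.
have uni x l c : good x l c -> comp x =1 c.
  move=> [ul okc c0 E] i.
  have [l' [ul' okc' c0' E']] := Hc x.
  pose L := undup (l ++ l').
  have sl : {subset l <= L} by move=> j jl; rewrite mem_undup mem_cat jl.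
  have sl' : {subset l' <= L} by move=> j jl; rewrite mem_undup mem_cat jl orbT.
  have [iL|iL] := boolP (i \in L); last first.
    by rewrite c0' ?c0 //; [apply: contra iL; exact: sl|apply: contra iL; exact: sl'].
  apply/eqP; rewrite -subr_eq0; apply/eqP.
  apply: (@indep L (fun i => comp x i - c i)) => //; first exact: undup_uniq.
    by move=> j; apply: okB.
  under eq_bigr => j _ do rewrite eB.
  by rewrite sumrB -(wide l' (comp x) L) ?undup_uniq // -(wide l c L) ?undup_uniq // -E -E' subrr.
exists comp; split.
- by move=> x i; have [l []] := Hc x.
- by move=> x; have [l [ul _ c0 E]] := Hc x; exists l.
- move=> x y; have [l [ul ok1 c0 E]] := Hc x; have [l' [ul' ok2 c0' E']] := Hc y.
  apply: (uni _ (undup (l ++ l'))); split.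
  - exact: undup_uniq.
  - by move=> i; apply: okB.
  - by move=> i; rewrite mem_undup mem_cat negb_or => /andP[/c0 -> /c0' ->]; rewrite subrr.
  rewrite {1}E {1}E' (wide l _ (undup (l ++ l'))) ?undup_uniq //; last first.
    by move=> j jl; rewrite mem_undup mem_cat jl.
  rewrite (wide l' _ (undup (l ++ l'))) ?undup_uniq //; last first.
    by move=> j jl; rewrite mem_undup mem_cat jl orbT.
  by rewrite -sumrB; apply: eq_bigr => i _; rewrite eB.
- by move=> x l c ul okc c0 E; apply: (uni x l).
Qed.

End Components.

Section FreeCoords.
Variables (A : nzRingType) (M : lmodType A).

(** A dual basis, the form in which freeness is used: linear coordinates, finitely many nonzero at
    each [x], that reconstruct [x]. *)
Definition is_coords (cf : M -> M -> A) : Prop :=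
  (forall x, exists l, [/\ uniq l, forall b, b \notin l -> cf x b = 0 &
      x = \sum_(b <- l) cf x b *: b]) /\
  (forall a x y b, cf (a *: x + y) b = a * cf x b + cf y b).

Lemma free_coords : free_module M -> exists cf, is_coords cf.
Proof.
move=> [B [ind gen]].
pose ok (b : M) (a : A) := B b \/ a = 0.
have ok0 b : ok b 0 by right.
have okB b a a' : ok b a -> ok b a' -> ok b (a - a').
  by case=> [Bb _|->]; [left|case=> [Bb|->]; [left|right; rewrite subrr]].
have [||||cf [okc gen' cfB uni]] := @components M A M ok (fun b a => a *: b) ok0.
- exact: okB.
- by move=> b a a'; rewrite scalerBl.
- move=> x; have [l [c [Bl ->]]] := gen x.
  exists l, (fun b => if b \in l then c b else 0); split.
    by move=> b; case: ifP => [/Bl|]; [left|right].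
  by rewrite big_seq [RHS]big_seq; apply: eq_bigr => b ->.
- move=> l c ul okc s0 b bl.
  have [Bb|//] := okc b.
  pose l' := [seq b <- l | `[< B b >]].
  apply: (ind l' c); [exact: filter_uniq| | |by rewrite mem_filter bl andbT; apply/asboolP].
    by move=> b'; rewrite mem_filter => /andP[/asboolP].
  move: s0; rewrite big_filter (bigID (fun b => `[< B b >])) /= [X in _ + X]big1 ?addr0 //.
  by move=> b' /asboolP nB; have [//|->] := okc b'; rewrite scale0r.
exists cf; split; first exact: gen'.
move=> a x y b; have := cfB (a *: x) (- y) b; rewrite opprK => ->.
have := cfB 0 y b; rewrite sub0r => ->.
have cf0 : cf 0 b = 0 by have := cfB 0 0 b; rewrite !subrr.
rewrite cf0 sub0r opprK; congr (_ + _).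
have [l [ul z E]] := gen' x.
apply: (uni _ l (fun b => a * cf x b)) => //.
- move=> b'; have [Bb|->] := okc x b'; [by left|by right; rewrite mulr0].
- by move=> b' /z ->; rewrite mulr0.
by rewrite {1}E scaler_sumr; apply: eq_bigr => b' _; rewrite scalerA.
Qed.

Variable cf : M -> M -> A.
Hypothesis cfP : is_coords cf.

Lemma coords_inj x : (forall b, cf x b = 0) -> x = 0.
Proof.
move=> x0; have [l [_ _ ->]] := cfP.1 x.
by rewrite big1 // => b _; rewrite x0 scale0r.
Qed.

Lemma coords0 b : cf 0 b = 0.
Proof.
have := cfP.2 1 0 0 b; rewrite scale1r addr0 mul1r => E.
by apply: (addrI (cf 0 b)); rewrite addr0 -E.
Qed.

Lemma coordsD x y b : cf (x + y) b = cf x b + cf y b.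
Proof. by have := cfP.2 1 x y b; rewrite scale1r mul1r. Qed.

Lemma coordsZ a x b : cf (a *: x) b = a * cf x b.
Proof. by have := cfP.2 a x 0 b; rewrite addr0 coords0 addr0. Qed.

Lemma coords_sum (J : Type) (r : seq J) (f : J -> M) b :
  cf (\sum_(j <- r) f j) b = \sum_(j <- r) cf (f j) b.
Proof. by apply: (big_morph (fun x => cf x b)) => [x y|]; [exact: coordsD|exact: coords0]. Qed.

End FreeCoords.

(** * Regular sequences of linear forms *)

Section LinSpan.
Variables (R : realType) (V : vectType R) (U : {vspace V}).
Variable (M : lmodType {mpoly R[\dim U]}).
Implicit Types (h : 'Hom(V, R^o)) (hs : seq 'Hom(V, R^o)).

Definition lin_span hs (x : M) : Prop :=
  exists y : nat -> M, x = \sum_(i < size hs) linform U hs`_i *: y i.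

Lemma lin_span0 hs : lin_span hs 0.
Proof. by exists (fun _ => 0); rewrite big1 // => i _; rewrite scaler0. Qed.

Lemma lin_spanD hs x y : lin_span hs x -> lin_span hs y -> lin_span hs (x + y).
Proof.
move=> [u ->] [v ->]; exists (fun i => u i + v i).
by rewrite -big_split; apply: eq_bigr => i _; rewrite scalerDr.
Qed.

Lemma lin_spanZ hs a x : lin_span hs x -> lin_span hs (a *: x).
Proof.
move=> [u ->]; exists (fun i => a *: u i); rewrite scaler_sumr.
by apply: eq_bigr => i _; rewrite !scalerA mulrC.
Qed.

Lemma lin_spanN hs x : lin_span hs x -> lin_span hs (- x).
Proof. by rewrite -scaleN1r; exact: lin_spanZ. Qed.

Lemma lin_spanB hs x y : lin_span hs x -> lin_span hs y -> lin_span hs (x - y).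
Proof. by move=> hx hy; apply: lin_spanD => //; exact: lin_spanN. Qed.

Lemma lin_span_sum hs (J : Type) (r : seq J) (P : pred J) (f : J -> M) :
  (forall j, P j -> lin_span hs (f j)) -> lin_span hs (\sum_(j <- r | P j) f j).
Proof.
by move=> H; apply: (big_ind (lin_span hs)) => //; [exact: lin_span0|exact: lin_spanD].
Qed.

Lemma lin_span_nil x : lin_span [::] x <-> x = 0.
Proof.
by split=> [[y ->]|->]; [rewrite big_ord0|exact: lin_span0].
Qed.

Lemma lin_span_cons h hs x :
  lin_span (h :: hs) x <-> exists y, lin_span hs (x - linform U h *: y).
Proof.
split=> [[y ->]|[z [y E]]].
  exists (y 0%N), (fun i => y i.+1).
  by rewrite big_ord_recl /= addrAC subrr add0r.
exists (fun i => if i is j.+1 then y j else z).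
by rewrite big_ord_recl /= -[LHS](subrK (linform U h *: z)) E addrC.
Qed.

Lemma lin_span_weaken h hs x : lin_span hs x -> lin_span (h :: hs) x.
Proof. by move=> hx; apply/lin_span_cons; exists 0; rewrite scaler0 subr0. Qed.

Lemma lin_span_ideal hs (c : nat -> {mpoly R[\dim U]}) x :
  lin_span hs ((\sum_(i < size hs) c i * linform U hs`_i) *: x).
Proof.
exists (fun i => c i *: x); rewrite scaler_suml; apply: eq_bigr => i _.
by rewrite scalerA mulrC.
Qed.

Fixpoint lin_regular hs : Prop :=
  if hs is h :: hs' then lin_regular hs' /\
    forall x, lin_span hs' (linform U h *: x) -> lin_span hs' x
  else True.

Section Free.
Variable cf : M -> M -> {mpoly R[\dim U]}.
Hypothesis cfP : is_coords cf.

Lemma lin_span_coords hs x :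
  lin_span hs x <-> forall b, symres U (zeros U hs) (cf x b) = 0.
Proof.
split=> [[y ->] b|H].
  rewrite (coords_sum cfP) raddf_sum big1 // => i _ /=.
  rewrite (coordsZ cfP) rmorphM /= symres_linform ?zeros_sub //.
  rewrite linform_eq0 ?mul0r // => v; apply: zeros_form.
  exact: mem_nth.
have [l [_ _ ->]] := cfP.1 x; apply: lin_span_sum => b _.
have [c ->] := symres_ker (H b); exact: lin_span_ideal.
Qed.

(** Modulo [hs] the coordinates lie in the polynomial ring of [zeros U hs], a domain in which the
    restriction of [h] is not zero. *)
Lemma free_regular hs h w x : w \in zeros U hs -> h w != 0 ->
  lin_span hs (linform U h *: x) -> lin_span hs x.
Proof.
move=> ww hw /lin_span_coords H; apply/lin_span_coords => b.
have /eqP := H b; rewrite (coordsZ cfP) rmorphM /= symres_linform ?zeros_sub // mulf_eq0.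
by rewrite (negbTE (linform_neq0 ww hw)) => /eqP.
Qed.

End Free.

(* The coefficients restricted to zeros U hs are divisible by every power of h. *)
Lemma independence_descent h hs (l : seq M) :
  (forall x, lin_span hs (linform U h *: x) -> lin_span hs x) ->
  (forall p : M -> {mpoly R[\dim U]}, lin_span (h :: hs) (\sum_(b <- l) p b *: b) ->
     forall b, b \in l -> symres U (zeros U (h :: hs)) (p b) = 0) ->
  forall p : M -> {mpoly R[\dim U]}, lin_span hs (\sum_(b <- l) p b *: b) ->
     forall b, b \in l -> symres U (zeros U hs) (p b) = 0.
Proof.
move=> reg ind p Hp b bl.
set W := zeros U hs; set lam := linform W h.
(* The coefficients restrict to zero on the zeros of [h :: hs], hence lie in the ideal it generates;
   cancelling [h], which is regular modulo [hs], leaves a new relation. *)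
have step (p' : M -> {mpoly R[\dim U]}) : lin_span hs (\sum_(b <- l) p' b *: b) ->
    exists p'' : M -> {mpoly R[\dim U]}, lin_span hs (\sum_(b <- l) p'' b *: b) /\
      forall b, b \in l -> symres U W (p' b) = lam * symres U W (p'' b).
  move=> Hp'; have H := ind p' (lin_span_weaken h Hp').
  have /choice[c Hc] : forall b, exists c : nat -> {mpoly R[\dim U]}, b \in l ->
      p' b = \sum_(i < size (h :: hs)) c i * linform U (h :: hs)`_i.
    move=> b'; have [b'l|nb] := boolP (b' \in l); last by exists (fun _ => 0).
    by have [c E] := symres_ker (H b' b'l); exists c.
  exists (fun b => c b 0%N); split.
    apply: reg.
    have -> : linform U h *: (\sum_(b <- l) c b 0%N *: b) = \sum_(b <- l) p' b *: b -
        \sum_(b <- l) (\sum_(i < size hs) c b i.+1 * linform U hs`_i) *: b.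
      rewrite scaler_sumr -sumrB big_seq [RHS]big_seq; apply: eq_bigr => b' b'l.
      by rewrite Hc // big_ord_recl /= -scalerBl addrK scalerA mulrC.
    apply: lin_spanB => //; apply: lin_span_sum => b' _.
    exact: (lin_span_ideal hs (fun i => c b' i.+1)).
  move=> b' b'l; rewrite Hc // big_ord_recl /= rmorphD rmorphM /= symres_linform ?zeros_sub //.
  rewrite raddf_sum big1 ?addr0 1?mulrC // => i _ /=.
  rewrite rmorphM /= symres_linform ?zeros_sub // linform_eq0 ?mulr0 // => v vW.
  by apply: (zeros_form (hs := hs) _ vW); apply: mem_nth; exact: (ltn_ord i).
have iter_ k : exists p' : M -> {mpoly R[\dim U]}, lin_span hs (\sum_(b <- l) p' b *: b) /\
      forall b, b \in l -> symres U W (p b) = lam ^+ k * symres U W (p' b).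
  elim: k => [|k [p' [Hp' E]]]; first by exists p; split=> // b' _; rewrite expr0 mul1r.
  have [p'' [Hp'' E'']] := step p' Hp'; exists p''; split=> // b' b'l.
  by rewrite E // exprSr -mulrA E''.
apply/eqP/negPn/negP => nz.
have [p' [_ /(_ b bl) E]] := iter_ (msize (symres U W (p b))).
have lam0 : lam != 0.
  apply: contraNneq nz => l0; have [p1 [_ /(_ b bl) ->]] := iter_ 1%N.
  by rewrite expr1 l0 mul0r.
have q0 : symres U W (p' b) != 0 by apply: contraNneq nz => q0; rewrite E q0 mulr0.
(* [msize] of a nonzero polynomial is its degree plus one, so the powers of [lam] outgrow any fixed
   nonzero polynomial. *)
have sz k : (k < msize (lam ^+ k))%N.
  elim: k => [|k IH]; first by rewrite expr0 msize1.
  rewrite exprS msizeM ?expf_neq0 //.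
  have : (1 < msize lam)%N.
    rewrite ltnNge; apply: contra lam0 => /msize1_polyC ->.
    by rewrite linform_mcoeff0.
  by move: IH; move: (msize lam) (msize _) => a c; lia.
have := congr1 (fun q => msize q) E; rewrite msizeM ?expf_neq0 //.
have := sz (msize (symres U W (p b))).
have : (0 < msize (symres U W (p' b)))%N by rewrite lt0n mmeasure_poly_eq0.
move=> /=; move: (mmeasure mdeg (lam ^+ _)) => a.
move: (mmeasure _ _) (mmeasure _ _) => c d; lia.
Qed.

Lemma lin_regular_indep hs (l : seq M) : lin_regular hs ->
  (forall p : M -> {mpoly R[\dim U]}, lin_span hs (\sum_(b <- l) p b *: b) ->
     forall b, b \in l -> symres U (zeros U hs) (p b) = 0) ->
  forall p : M -> {mpoly R[\dim U]}, \sum_(b <- l) p b *: b = 0 ->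
     forall b, b \in l -> p b = 0.
Proof.
elim: hs => [|h hs IH] /=.
  move=> _ H p /lin_span_nil Hp b bl; have E := H p Hp b bl.
  by have [c ->] := @symres_ker _ _ U [::] _ E; apply: big1 => -[].
by move=> [reg1 reg2] H; apply: IH => //; exact: (independence_descent reg2 H).
Qed.

End LinSpan.

(** * Graded modules *)

Section MaximalIdealTheory.
Variables (R : realType) (m : nat) (M : lmodType {mpoly R[m]}).

Definition combinations (P : set ({mpoly R[m]} * M)) : set M := [set x |
  exists l : seq ({mpoly R[m]} * M), (forall p, p \in l -> P p) /\ x = \sum_(p <- l) p.1 *: p.2].

Lemma combinations0 P : combinations P 0.
Proof. by exists [::]; split=> //; rewrite big_nil. Qed.

Lemma combinationsD P x y : combinations P x -> combinations P y -> combinations P (x + y).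
Proof.
move=> [l [Hl ->]] [l' [Hl' ->]]; exists (l ++ l'); rewrite big_cat; split=> //.
by move=> p; rewrite mem_cat => /orP[]; [exact: Hl|exact: Hl'].
Qed.

Lemma mideal_mul0 : mideal_mul (0 : M).
Proof. exact: combinations0. Qed.

Lemma mideal_mulD (x y : M) : mideal_mul x -> mideal_mul y -> mideal_mul (x + y).
Proof. exact: combinationsD. Qed.

Lemma mideal_mulZ a (x : M) : mideal_mul x -> mideal_mul (a *: x).
Proof.
move=> [l [Hl ->]]; exists [seq (p.1, a *: p.2) | p <- l]; split.
  by move=> q /mapP[p pl ->]; exact: (Hl p pl).
by rewrite big_map scaler_sumr; apply: eq_bigr => p _ /=; rewrite !scalerA mulrC.
Qed.

Lemma mideal_mulB (x y : M) : mideal_mul x -> mideal_mul y -> mideal_mul (x - y).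
Proof. by move=> hx hy; rewrite -[- y]scaleN1r; apply: mideal_mulD => //; exact: mideal_mulZ. Qed.

Lemma mideal_mul_sum (J : eqType) (r : seq J) (f : J -> M) :
  (forall j, j \in r -> mideal_mul (f j)) -> mideal_mul (\sum_(j <- r) f j).
Proof.
move=> H; rewrite big_seq; apply: (big_ind (@mideal_mul R m M)) => //.
- exact: mideal_mul0.
- exact: mideal_mulD.
Qed.

Lemma mideal_mul_scale a (x : M) : a@_0%MM = 0 -> mideal_mul (a *: x).
Proof.
move=> a0; exists [:: (a, x)]; rewrite big_seq1; split=> //.
by move=> p; rewrite inE => /eqP ->.
Qed.

End MaximalIdealTheory.

Section Graded.
Variables (R : realType) (m : nat) (M : lmodType {mpoly R[m]}) (g : int -> set M).
Hypothesis gradM : is_grading g.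
Hypothesis gradZ : forall (q : nat) (d : int) (a : {mpoly R[m]}) (x : M),
  a \is q.-homog -> g d x -> g (d + (2 * q)%N%:Z) (a *: x).

Definition is_comp (comp : M -> int -> M) : Prop :=
  [/\ forall x d, g d (comp x d),
      forall x, exists l, [/\ uniq l, forall d, d \notin l -> comp x d = 0 &
                              x = \sum_(d <- l) comp x d],
      forall x y d, comp (x - y) d = comp x d - comp y d,
      forall d x, g d x -> comp x d = x &
      forall d e x, g d x -> e != d -> comp x e = 0].

Lemma grading_comp : exists comp, is_comp comp.
Proof.
have [g0B gen ind] := gradM.
have [|||||comp [c1 c2 c3 c4]] := @components _ M M (fun d x => g d x) (fun _ x => x).
- by move=> d; exact: (g0B d).1.
- by move=> d; exact: (g0B d).2.
- by [].
- exact: gen.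
- by move=> l c ul okc s0; exact: (ind l c ul okc s0).
exists comp; split=> //.
  move=> d x gx; rewrite (c4 x [:: d] (fun e => if e == d then x else 0)) ?eqxx //.
  - by move=> e; case: eqP => [->|_] //; exact: (g0B e).1.
  - by move=> e; rewrite inE => /negbTE ->.
  - by rewrite big_seq1 eqxx.
move=> d e x gx ed; rewrite (c4 x [:: d] (fun e => if e == d then x else 0)) ?(negbTE ed) //.
- by move=> e'; case: eqP => [->|_] //; exact: (g0B e').1.
- by move=> e'; rewrite inE => /negbTE ->.
- by rewrite big_seq1 eqxx.
Qed.

Section Comp.
Variable comp : M -> int -> M.
Hypothesis compP : is_comp comp.

Lemma comp0 d : comp 0 d = 0.
Proof. by have [_ _ H _ _] := compP; have := H 0 0 d; rewrite !subrr. Qed.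

Lemma compB x y d : comp (x - y) d = comp x d - comp y d.
Proof. by have [_ _ H _ _] := compP. Qed.

Lemma compD x y d : comp (x + y) d = comp x d + comp y d.
Proof. by rewrite -{1}[y]opprK compB -[- y]sub0r compB comp0 sub0r opprK. Qed.

Lemma comp_sum (J : Type) (r : seq J) (f : J -> M) d :
  comp (\sum_(j <- r) f j) d = \sum_(j <- r) comp (f j) d.
Proof. by apply: (big_morph (fun x => comp x d)) => [x y|]; [exact: compD|exact: comp0]. Qed.

(** A component of a product is a sum of products of homogeneous parts; the induction principle
    avoids writing the double sum. *)
Lemma comp_scale_ind (P : M -> Prop) a x d : P 0 -> (forall y z, P y -> P z -> P (y + z)) ->
  (forall q e, (d = e + (2 * q)%N%:Z) -> P (pihomog mdeg q a *: comp x e)) ->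
  P (comp (a *: x) d).
Proof.
move=> P0 PD PH; have [c1 c2 _ c4 c5] := compP.
have [l [ul _ E]] := c2 x.
rewrite {1}(pihomog_partitionE (leqnn (mmeasure mdeg a))) {1}E scaler_suml comp_sum.
apply: (big_ind P) => // q _.
rewrite scaler_sumr comp_sum; apply: (big_ind P) => // e _.
have gd := gradZ (pihomogP mdeg q a) (c1 x e).
have [E'|ne] := eqVneq d (e + (2 * q)%N%:Z); last by rewrite (c5 _ _ _ gd ne).
by rewrite E' (c4 _ _ gd); exact: PH.
Qed.

(** Coefficients without constant term have homogeneous parts of positive degree only, so what they
    multiply has smaller degree. *)
Lemma comp_mideal x d : mideal_mul x -> 
  combinations [set p | p.1@_0%MM = 0 /\ exists2 e, e < d & g e p.2] (comp x d).
Proof.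
move=> [l [Hl ->]]; rewrite comp_sum big_seq.
apply: big_ind => [|y z|p pl]; [exact: combinations0|exact: combinationsD|].
apply: comp_scale_ind => [|y z|q e dE]; [exact: combinations0|exact: combinationsD|].
have [c1 _ _ _ _] := compP.
have [q0|q0] := posnP q.
  rewrite q0 pihomogE big1 ?scale0r; first exact: combinations0.
  move=> k.
  by rewrite mdeg_eq0 => /eqP ->; rewrite (Hl p pl) scale0r.
exists [:: (pihomog mdeg q p.1, comp p.2 e)]; rewrite big_seq1; split=> // p'.
rewrite inE => /eqP -> /=.
split; first by rewrite (dhomog_nemf_coeff (pihomogP mdeg q p.1)) //= mdeg0; lia.
by exists e => //; rewrite dE; lia.
Qed.

(** Modulo [M'] a homogeneous element is a combination of elements of smaller degree, and the lower
    bound [d0] starts the induction; it takes the place of finite generation. *)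
Lemma graded_nakayama (d0 : int) (M' : set M) :
  (forall d x, d < d0 -> g d x -> x = 0) ->
  M' 0 -> (forall x y, M' x -> M' y -> M' (x + y)) -> (forall a x, M' x -> M' (a *: x)) ->
  (forall x d, M' x -> M' (comp x d)) ->
  (forall x, exists2 z, M' z & mideal_mul (x - z)) ->
  forall x, M' x.
Proof.
move=> bnd M0 MD MZ MC Mgen.
have [c1 c2 _ c4 _] := compP.
suff H d x : g d x -> M' x.
  move=> x; have [l [_ _ ->]] := c2 x.
  by apply: (big_ind M') => // d _; apply: (H d); exact: c1.
have : d < d0 + (absz (d - d0 + 1))%:Z by lia.
move: (absz _) => k; elim: k d x => [|k IH] d x dk gx.
  by rewrite (bnd d x) //; lia.
have [z Mz xz] := Mgen x.
have [l [Hl E]] := comp_mideal d xz.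
rewrite compB (c4 d x gx) in E.
have -> : x = comp z d + \sum_(p <- l) p.1 *: p.2 by rewrite -E addrC subrK.
apply: (MD); first exact: MC.
rewrite big_seq; apply: (big_ind M') => // p /Hl[_ [e ed ge]].
by apply: (MZ); apply: (IH e) => //; lia.
Qed.

(** Such elements lie in every power of the maximal ideal times M, since the elements multiplied
    have still smaller degree. The basis need not be homogeneous, so the coordinates are killed
    monomial by monomial. *)
Lemma free_graded_bounded (d0 : int) : free_module M ->
  (forall d x, d < d0 -> g d x -> mideal_mul x) -> forall d x, d < d0 -> g d x -> x = 0.
Proof.
move=> /free_coords[cf cfP] H.
have [c1 c2 _ c4 _] := compP.
have key k : forall d x b (mon : 'X_{1..m}), d < d0 -> g d x -> (mdeg mon < k)%N ->
    (cf x b)@_mon = 0.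
  elim: k => [//|k IH] d x b mon dd gx mk.
  have [l [Hl E]] := comp_mideal d (H d x dd gx).
  rewrite -(c4 d x gx) E (coords_sum cfP) raddf_sum big_seq /=.
  apply: big1 => p /Hl[p0 [e ed ge]].
  rewrite (coordsZ cfP) mcoeffM; apply: big1 => -[k1 k2] /= /eqP kE.
  have [k10|k10] := eqVneq (bmnm k1) 0%MM; first by rewrite k10 p0 mul0r.
  rewrite (IH e) ?mulr0 //; first by lia.
  have : (0 < mdeg k1)%N by rewrite lt0n mdeg_eq0.
  have E2 := congr1 mdeg kE; rewrite mdegD in E2; lia.
move=> d x dd gx; apply: (coords_inj cfP) => b; apply/mpolyP => mon.
by rewrite mcoeff0; apply: (key (mdeg mon).+1 d).
Qed.

End Comp.
End Graded.

Section GradedFree.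
Variables (R : realType) (V : vectType R) (U : {vspace V}).
Local Notation A := {mpoly R[\dim U]}.
Variables (M : lmodType A) (g : int -> set M).
Hypothesis gradM : is_grading g.
Hypothesis gradZ : forall (q : nat) (d : int) (a : A) (x : M),
  a \is q.-homog -> g d x -> g (d + (2 * q)%N%:Z) (a *: x).
Variable d0 : int.
Hypothesis bounded : forall d x, d < d0 -> g d x -> x = 0.
Variable hs : seq 'Hom(V, R^o).
Hypothesis reg : lin_regular M hs.
Hypothesis zeros0 : \dim (zeros U hs) = 0%N.

Let indep_mod (B : set M) : Prop :=
  (forall b, B b -> exists d, g d b) /\
  (forall (l : seq M) (c : M -> R), uniq l -> (forall b, b \in l -> B b) ->
     mideal_mul (\sum_(b <- l) ((c b)%:MP : A) *: b) -> forall b, b \in l -> c b = 0).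

(** A homogeneous basis of M modulo the maximal ideal generates M by Nakayama; the regular sequence,
    whose common zero is the origin, makes it independent. *)
Lemma graded_regular_free : free_module M.
Proof.
have [comp compP] := grading_comp gradM.
have [c1 c2 cB c4 c5] := compP.
(* Independence is a condition on finite lists, so it passes to unions of chains and Zorn's lemma
   applies. *)
have [B [[Bg Bind] Bmax]] : exists B, indep_mod B /\ forall C, B `<` C -> ~ indep_mod C.
  apply: Zorn_bigcup => F FP tot; split.
    by move=> b [X FX Xb]; exact: (FP X FX).1.
  move=> l c ul lF.
  have [->//|[X [FX lX]]] : l = [::] \/ exists X, F X /\ forall b, b \in l -> X b.
    elim: l {ul} lF => [|b l IH] lF; [by left|right].
    have [X FX Xb] := lF b (mem_head _ _).
    have [|->|[Y [FY lY]]] := IH; first by move=> b' b'l; apply: lF; rewrite inE b'l orbT.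
      by exists X; split=> // b'; rewrite inE => /eqP ->.
    have [XY|YX] := tot X Y FX FY.
      by exists Y; split=> // b'; rewrite inE => /orP[/eqP ->|/lY //]; exact: XY.
    by exists X; split=> // b'; rewrite inE => /orP[/eqP -> //|/lY]; exact: YX.
  exact: (FP X FX).2.
pose M' : set M := combinations [set p : A * M | B p.2].
have M0 : M' 0 by exact: combinations0.
have MD x y : M' x -> M' y -> M' (x + y) by exact: combinationsD.
have MZ a x : M' x -> M' (a *: x).
  move=> [l [Hl ->]]; exists [seq (a * p.1, p.2) | p <- l]; split.
    by move=> q /mapP[p pl ->]; exact: (Hl p pl).
  by rewrite big_map scaler_sumr; apply: eq_bigr => p _; rewrite !scalerA.
have MB b : B b -> M' b.
  move=> Bb; exists [:: (1, b)]; rewrite big_seq1 scale1r; split=> // p.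
  by rewrite inE => /eqP ->.
have MC x d : M' x -> M' (comp x d).
  move=> [l [Hl ->]]; rewrite (comp_sum compP) big_seq; apply: (big_ind M') => // p pl.
  apply: (comp_scale_ind gradZ compP) => // q e _; apply: (MZ).
  have [f gf] := Bg _ (Hl p pl).
  have [->|ne] := eqVneq e f; first by rewrite (c4 _ _ gf); apply: MB; exact: Hl.
  by rewrite (c5 _ _ _ gf ne).
(* Otherwise adjoining [x] to [B] would contradict maximality. *)
have gen_hom d x : g d x -> exists2 z, M' z & mideal_mul (x - z).
  move=> gx; apply: contrapT => nz.
  have nB : ~ B x.
    move=> Bx; apply: nz; exists x; first exact: MB.
    by rewrite subrr; exact: mideal_mul0.
  have sub : B `<` (B `|` [set x]).
    split; first by move=> b Bb; left.
    by move=> H; apply: nB; apply: H; right.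
  apply: (Bmax _ sub); split; first by move=> b [/Bg //|->]; exists d.
  move=> l c ul lB s0.
  have lB' b : b \in l -> b != x -> B b by move=> bl /eqP bx; case: (lB b bl).
  have [xl|xl] := boolP (x \in l); last first.
    apply: Bind => // b bl; apply: lB' => //.
    by apply: contraNneq xl => <-.
  have cx : c x = 0.
    apply/eqP/negPn/negP => cx; apply: nz.
    pose z := (- (((c x)^-1)%:MP : A)) *: \sum_(b <- rem x l) ((c b)%:MP : A) *: b.
    exists z.
      apply: (MZ); rewrite big_seq; apply: (big_ind M') => // b.
      by rewrite mem_rem_uniq // inE => /andP[bx bl]; apply/MZ/MB/lB'.
    have -> : x - z = (((c x)^-1)%:MP : A) *: \sum_(b <- l) ((c b)%:MP : A) *: b.
      rewrite (big_rem x xl) /= scalerDr scalerA -mpolyCM mulVf //.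
      by rewrite mpolyC1 scale1r /z scaleNr opprK.
    exact: mideal_mulZ.
  have s0' : mideal_mul (\sum_(b <- rem x l) ((c b)%:MP : A) *: b).
    by move: s0; rewrite (big_rem x xl) /= cx mpolyC0 scale0r add0r.
  move=> b bl; have [-> //|bx] := eqVneq b x.
  apply: (Bind (rem x l) c) => //; first exact: rem_uniq.
    by move=> b'; rewrite mem_rem_uniq // inE => /andP[b'x b'l]; exact: lB'.
  by rewrite mem_rem_uniq // inE bx.
have Mgen x : exists2 z, M' z & mideal_mul (x - z).
  have [l [_ _ ->]] := c2 x; elim: l => [|d l [z Mz xz]].
    by exists 0 => //; rewrite big_nil subrr; exact: mideal_mul0.
  have [z' Mz' xz'] := gen_hom d (comp x d) (c1 x d).
  exists (z' + z); first exact: MD.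
  by rewrite big_cons opprD addrACA; apply: mideal_mulD.
have Mall := graded_nakayama gradZ compP bounded M0 MD MZ MC Mgen.
exists B; split.
  move=> l c ul lB; apply: (lin_regular_indep reg) => p Hp b bl.
  (* Restricting a coefficient to the origin leaves its constant term. *)
  rewrite symres0 //; suff -> : (p b)@_0%MM = 0 by rewrite mpolyC0.
  apply: (Bind l (fun b => (p b)@_0%MM)) => //.
  have -> : \sum_(b <- l) (((p b)@_0%MM)%:MP : A) *: b = \sum_(b <- l) p b *: b -
      \sum_(b <- l) (p b - ((p b)@_0%MM)%:MP) *: b.
    by rewrite -sumrB; apply: eq_bigr => b' _; rewrite -scalerBl opprB addrCA subrr addr0.
  apply: mideal_mulB.
    have [y ->] := Hp; apply: mideal_mul_sum => i _; apply: mideal_mul_scale.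
    exact: linform_mcoeff0.
  apply: mideal_mul_sum => b' _; apply: mideal_mul_scale.
  by rewrite mcoeffB mcoeffC eqxx mulr1 subrr.
move=> x; have [l [Hl ->]] := Mall x.
exists (undup (map snd l)), (fun b => \sum_(p <- l | p.2 == b) p.1); split.
  by move=> b; rewrite mem_undup => /mapP[p pl ->]; exact: Hl.
under [RHS]eq_bigr => b _ do rewrite scaler_suml.
rewrite (exchange_big_dep xpredT) //= big_seq [RHS]big_seq; apply: eq_bigr => p pl.
have pu : p.2 \in undup (map snd l) by rewrite mem_undup map_f.
rewrite (big_rem _ pu) /= eqxx big1_seq ?addr0 // => b /andP[/eqP <-].
by rewrite mem_rem_uniq ?undup_uniq // inE eqxx.
Qed.

End GradedFree.

(** * Minimal extension sheaves *)

Lemma comp_morph (R : realType) (m1 m2 : nat) (M1 : lmodType {mpoly R[m1]})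
    (M2 : lmodType {mpoly R[m2]}) g1 g2 (c1 : M1 -> int -> M1) (c2 : M2 -> int -> M2)
    (f : {additive M1 -> M2}) :
  is_comp g1 c1 -> is_comp g2 c2 -> (forall d x, g1 d x -> g2 d (f x)) ->
  forall x d, c2 (f x) d = f (c1 x d).
Proof.
move=> P1 P2 fg x d; have [a1 a2 _ _ _] := P1; have [_ _ _ b4 b5] := P2.
have [l [ul z E]] := a2 x.
rewrite {1}E raddf_sum /= (comp_sum P2).
have [dl|dl] := boolP (d \in l).
  rewrite (bigD1_seq d) //= (b4 _ _ (fg _ _ (a1 x d))) big1 ?addr0 // => e ed.
  by rewrite (b5 _ _ _ (fg _ _ (a1 x e))) // eq_sym.
rewrite (z d dl) raddf0 big1_seq // => e /andP[_ el].
by rewrite (b5 _ _ _ (fg _ _ (a1 x e))) //; apply: contraNneq dl => ->.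
Qed.

Section Update.
Variables (I : eqType) (T : I -> Type) (i0 : I) (a : T i0) (x : forall i, T i).

Definition update (i : I) : T i :=
  if pselect (i0 = i) is left e then ecast j (T j) e a else x i.

Lemma update_same : update i0 = a.
Proof. by rewrite /update; case: pselect => // e; rewrite eq_axiomK. Qed.

Lemma update_other i : i <> i0 -> update i = x i.
Proof. by rewrite /update; case: pselect => // e /nesym. Qed.

End Update.

Section SheafTheory.
Variables (R : realType) (V : vectType R) (D : fan V) (E : gmod_sheaf D).
Local Notation family := (forall s : D, E s).
Implicit Types (s t : D).

Definition stalk_comp s : {comp : E s -> int -> E s | is_comp (@mdegree _ _ _ E s) comp} :=
  cid (grading_comp (mdegree_grading E s)).

Lemma res_comp_deg s t (x : E s) d : face (val t) (val s) ->
  sval (stalk_comp t) (mres E s t x) d = mres E s t (sval (stalk_comp s) x d).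
Proof.
move=> ts; apply: (comp_morph (svalP (stalk_comp s)) (svalP (stalk_comp t))) => e y.
exact: mdegree_res.
Qed.

Section SectionsGrading.
Variable L : {set D}.

Definition sdegree (d : int) : set (msections E L) :=
  [set x : msections E L | forall s (hs : s \in L), mdegree (g := E) d (sec_val x s hs : E s)].

Lemma sec_valB (x y : msections E L) s hs : sec_val (x - y) s hs = sec_val x s hs - sec_val y s hs.
Proof. by []. Qed.

Lemma sec_val_sum (J : Type) (r : seq J) (P : pred J) (f : J -> msections E L) s hs :
  sec_val (\sum_(j <- r | P j) f j) s hs = \sum_(j <- r | P j) sec_val (f j) s hs.
Proof. exact: (big_morph (fun x : msections E L => sec_val x s hs)). Qed.

(** Components are taken stalk by stalk and are compatible because restrictions preserve degrees;
    finitely many degrees suffice since the fan is finite. *)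
Lemma sdegree_grading : is_grading sdegree.
Proof.
split.
- move=> d; split.
    by move=> s hs; have [H _ _] := mdegree_grading E s; exact: (H d).1.
  move=> x y gx gy s hs; rewrite sec_valB.
  by have [H _ _] := mdegree_grading E s; apply: (H d).2.
- move=> x.
  have comp_sec d : compatible (F := sheaf_of_gmod E) (L := L)
      (fun s hs => sval (stalk_comp s) (sec_val x s hs) d).
    move=> s t hs ht ts; rewrite /= -res_comp_deg //.
    by congr (sval (stalk_comp t) _ d); exact: (svalP x s t hs ht ts).
  pose c d : msections E L := exist _ _ (comp_sec d).
  have /choice[ls Hls] : forall s, exists l : seq int, forall hs : s \in L,
      [/\ uniq l, forall d, d \notin l -> sval (stalk_comp s) (sec_val x s hs) d = 0 &
       sec_val x s hs = \sum_(d <- l) sval (stalk_comp s) (sec_val x s hs) d].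
    move=> s; have [hs|ns] := pselect (s \in L); last by exists [::].
    have [_ a2 _ _ _] := svalP (stalk_comp s).
    have [l H] := a2 (sec_val x s hs); exists l => hs'.
    by rewrite (Prop_irrelevance hs' hs).
  pose l := undup (flatten [seq ls s | s <- enum D]).
  exists l, c; split.
    by move=> d s hs; have [a1 _ _ _ _] := svalP (stalk_comp s); exact: a1.
  apply: sections_ext => s hs; rewrite sec_val_sum.
  have [ul z E1] := Hls s hs.
  rewrite [LHS]E1 [RHS](bigID (mem (ls s))) /= [X in _ + X]big1 ?addr0; last first.
    by move=> d /z ->.
  rewrite -[RHS]big_filter; apply: perm_big; apply: uniq_perm => //.
    by rewrite filter_uniq // undup_uniq.
  move=> d; rewrite mem_filter; have [dl|//] := boolP (d \in ls s).
  rewrite mem_undup; apply/esym/flattenP; exists (ls s) => //.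
  by apply: map_f; rewrite mem_enum.
- move=> l c ul gc s0 d dl; apply: sections_ext => s hs.
  have [_ _ ind] := mdegree_grading E s.
  apply: (ind l (fun d => sec_val (c d) s hs)) => //.
    by move=> e; exact: gc.
  by rewrite -(sec_val_sum _ xpredT) s0.
Qed.

Lemma sdegree_scale (q : nat) (d : int) (a : {mpoly R[\dim {:V}]}) (x : msections E L) :
  a \is q.-homog -> sdegree d x -> sdegree (d + (2 * q)%N%:Z) (a *: x).
Proof.
move=> ha gx s hs; apply: mdegree_scale; last exact: gx.
exact: symres_homog.
Qed.

End SectionsGrading.

Hypothesis mesE : minimal_extension_sheaf E.

Definition stalk_bounded s (d0 : int) :=
  forall d (x : E s), d < d0 -> mdegree (g := E) d x -> x = 0.

Lemma star_section_sub s (x : E s) : compatible (F := sheaf_of_gmod E) (L := closed_star s)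
  (fun t _ => mres E s t x).
Proof.
move=> t r; rewrite !finset.in_set => /asboolP ts /asboolP rs rt /=.
exact: mres_comp.
Qed.

Definition star_section s (x : E s) : msections E (closed_star s) :=
  exist _ _ (star_section_sub x).

Lemma mem_closed_star s : s \in closed_star s.
Proof. by rewrite finset.in_set; apply/asboolP/face_sub_fan. Qed.

Lemma mem_bd_cone s t : (t \in bd_cone s) <-> val t `<=` val s /\ t <> s.
Proof.
rewrite finset.in_setD1 finset.in_set; split.
  by move=> /andP[/eqP ts /asboolP/face_sub_fan].
by move=> [sub /eqP ->]; apply/asboolP/face_sub_fan.
Qed.

Lemma mideal_mul_stalk s (X : msections E (closed_star s)) : mideal_mul X ->
  mideal_mul (sec_val X s (mem_closed_star s) : E s).
Proof.
move=> [l [Hl ->]]; rewrite sec_val_sum; apply: mideal_mul_sum => p pl.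
by apply: mideal_mul_scale; rewrite symres_mcoeff0 Hl.
Qed.

Lemma common_bound (L : {set D}) : (forall t, t \in L -> exists d0, stalk_bounded t d0) ->
  exists d0, forall t, t \in L -> stalk_bounded t d0.
Proof.
move=> H; have /choice[b Hb] : forall t, exists d0, t \in L -> stalk_bounded t d0.
  move=> t; have [tL|tL] := boolP (t \in L); last by exists 0.
  by have [d0] := H t tL; exists d0.
exists (- \sum_(t : D) `|b t|) => t tL d x dd gx; apply: (Hb t tL) gx.
apply: lt_le_trans dd _; rewrite (bigD1 t) //= opprD.
have : 0 <= \sum_(i | i != t) `|b i| by apply: sumr_ge0.
by have := ler_norm (- b t); rewrite normrN; lra.
Qed.

(** An element of degree below the bounds of the boundary stalks restricts to 0 there, lies in the
    maximal ideal times E_s by (LME), and vanishes by [free_graded_bounded]. *)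
Lemma stalk_bounded_exists s : exists d0, stalk_bounded s d0.
Proof.
have base t : val t = [set 0] -> exists d0, stalk_bounded t d0.
  move=> t0; have [f [bf fD fZ fdeg]] := mes_N mesE t0.
  exists 0 => d x d0 /fdeg[E0|fx]; first by rewrite E0 ltxx in d0.
  by apply: (bij_inj bf); rewrite fx; apply: (addrI (f 0)); rewrite -fD !addr0.
move: {2}(cone_dim (val s)) (leqnn (cone_dim (val s))) => k.
elim: k s => [|k IH] s sk; have [s0|s0] := pselect (val s = [set 0]).
- exact: base.
- by case: s0; apply: (cone_dim_eq0 (valP s)); lia.
- exact: base.
have [d0 Hd0] : exists d0, forall t, t \in bd_cone s -> stalk_bounded t d0.
  apply: common_bound => t /mem_bd_cone[ts tns]; apply: IH.
  have tns' : val t <> val s by move/val_inj.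
  by have := cone_dim_lt (valP s) (valP t) ts tns'; lia.
exists d0.
apply: (free_graded_bounded (@mdegree_scale _ _ _ E s) (svalP (stalk_comp s)) (mes_PF mesE s)).
move=> d x dd gx.
have [inj _] := mes_LME mesE s0.
have r0 : restrict (bd_cone_sub s) (star_section x) = 0.
  apply: sections_ext => t ht; rewrite /sec_val /=.
  have [ts _] := iffLR (mem_bd_cone _ _) ht.
  apply: (Hd0 t ht d) => //; apply: mdegree_res => //; exact/face_sub_fan.
have := inj (star_section x) (eq_ind_r (fun z => mideal_mul z) (mideal_mul0 _) r0).
move/mideal_mul_stalk.
by rewrite /sec_val /= mres_id.
Qed.

Lemma sections_bounded (L : {set D}) : exists d0, forall d (x : msections E L),
  d < d0 -> sdegree d x -> x = 0.
Proof.
have [d0 H] := common_bound (fun t (_ : t \in L) => stalk_bounded_exists t).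
by exists d0 => d x dd gx; apply: sections_ext => s hs; apply: (H s hs d _ dd); exact: gx.
Qed.

(** (LME) makes the restriction to the boundary surjective modulo the maximal ideal; its image is
    graded, so Nakayama gives surjectivity. For the origin the boundary is empty. *)
Lemma stalk_extend s (y : msections E (bd_cone s)) :
  exists x : E s, forall t (ht : t \in bd_cone s), mres E s t x = sec_val y t ht.
Proof.
have [s0|s0] := pselect (val s = [set 0]).
  exists 0 => t ht; exfalso; have [ts tns] := iffLR (mem_bd_cone _ _) ht.
  apply: tns; apply: val_inj; apply/seteqP; split=> //; rewrite s0.
  exact: (set0_sub (valP t)).
suff [X EX] : exists X : msections E (closed_star s), y = restrict (bd_cone_sub s) X.
  exists (sec_val X s (mem_closed_star s)) => t ht.
  have [ts _] := iffLR (mem_bd_cone _ _) ht.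
  rewrite EX; apply: (svalP X s t (mem_closed_star s)).
  exact/face_sub_fan.
have [comp compP] := grading_comp (sdegree_grading (bd_cone s)).
have [comp' compP'] := grading_comp (sdegree_grading (closed_star s)).
have [d0 bnd] := sections_bounded (bd_cone s).
have [_ sur] := mes_LME mesE s0.
apply: (graded_nakayama (@sdegree_scale (bd_cone s)) compP bnd
  (M' := [set y | exists X, y = restrict (bd_cone_sub s) X])).
- by exists 0; rewrite raddf0.
- by move=> x z [X ->] [Z ->]; exists (X + Z); rewrite raddfD.
- by move=> a x [X ->]; exists (a *: X); rewrite linearZ.
- move=> x d [X ->]; exists (comp' X d).
  by apply: (comp_morph compP' compP) => e Z gZ t ht; exact: gZ.
- by move=> x; have [X HX] := sur x; exists (restrict (bd_cone_sub s) X) => //; exists X.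
Qed.

Definition compat_on (L : D -> Prop) (x : family) : Prop :=
  forall s t, L s -> L t -> val t `<=` val s -> mres E s t (x s) = x t.

(** Cones are added one at a time, a missing cone of least dimension first, so that its boundary is
    already present. *)
Lemma flabby (L : {set D}) (x : family) :
  (forall s t, s \in L -> val t `<=` val s -> t \in L) ->
  compat_on (fun s => s \in L) x ->
  exists y : family, (forall s, s \in L -> y s = x s) /\ compat_on (fun _ => True) y.
Proof.
move: {2}(#|~: L|) (leqnn #|~: L|) => k.
elim: k L x => [|k IH] L x cL low cx.
  have L1 s : s \in L.
    by move: cL; rewrite leqn0 cards_eq0 => /eqP/setP/(_ s); rewrite !inE => /negbFE.
  by exists x; split=> // s t _ _; apply: cx.
have [full|] := pselect (forall s, s \in L).
  by exists x; split=> // s t _ _; apply: cx.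
move=> /existsNP[s1 /negP s1L].
case: (arg_minnP (fun s : D => cone_dim (val s)) (s1L : (fun s => s \notin L) s1)) => s sL smin.
have bdL t : t \in bd_cone s -> t \in L.
  move=> /mem_bd_cone[ts tns]; apply: contrapT => /negP tL.
  have /= sm : (cone_dim (val s) <= cone_dim (val t))%N := smin t tL.
  have tns' : val t <> val s by move/val_inj.
  by have := cone_dim_lt (valP s) (valP t) ts tns'; rewrite ltnNge sm.
have cb : compatible (F := sheaf_of_gmod E) (L := bd_cone s) (fun t _ => x t).
  move=> t r ht hr rt; apply: cx; [exact: bdL|exact: bdL|exact/face_sub_fan].
have [a Ha] := stalk_extend (exist _ _ cb : msections E (bd_cone s)).
pose x' := update a x.
have xs : x' s = a by exact: update_same.
have xo t : t <> s -> x' t = x t by exact: update_other.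
have [|||y [Hy cy]] := IH (s |: L)%SET x'.
- rewrite -ltnS; apply: leq_trans cL; apply: proper_card; apply/fintype.properP; split.
    by apply/fintype.subsetP => z; rewrite !finset.inE negb_or => /andP[].
  by exists s; rewrite !finset.inE ?eqxx.
- move=> t r; rewrite !finset.in_setU1 => /orP[/eqP ->|tL] rt; last first.
    by rewrite (low _ _ tL rt) orbT.
  have [->|rs] := eqVneq r s; first by rewrite ?eqxx.
  by rewrite bdL ?orbT //; apply/mem_bd_cone; split=> //; exact/eqP.
- move=> t r; rewrite !finset.in_setU1 => tL rL rt.
  have [ts|/eqP ts] := eqVneq t s.
    subst t; have [rs|/eqP rs] := eqVneq r s; first by subst r; rewrite mres_id.
    have rb : r \in bd_cone s by apply/mem_bd_cone.
    by rewrite xs xo // (Ha r rb).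
  have tL' : t \in L by move: tL; case: eqP.
  have rL' := low _ _ tL' rt.
  have rs : r <> s by move=> rs; rewrite rs (negbTE sL) in rL'.
  by rewrite !xo //; apply: cx.
exists y; split=> // t tL; rewrite Hy; last by rewrite finset.in_setU1 tL orbT.
by apply: xo => ts; rewrite ts (negbTE sL) in tL.
Qed.

Definition kills_bd s (x : E s) : Prop :=
  forall t, val t `<=` val s -> t <> s -> mres E s t x = 0.

(** Taking [x] at [s] and 0 on the cones not containing [s] gives a section over a subfan, because
    [x] restricts to 0 on the boundary; flabbiness extends it. *)
Lemma extend_by_zero s (x : E s) : kills_bd x ->
  exists y : family, [/\ compat_on (fun _ => True) y, y s = x &
    forall t, ~ (val s `<=` val t) -> y t = 0].
Proof.
move=> kx; pose L : {set D} := [set t : D | (t == s) || `[< ~ (val s `<=` val t) >]]%SET.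
pose x' := update x (fun t => 0 : E t).
have xs : x' s = x by exact: update_same.
have xo t : t <> s -> x' t = 0 by exact: update_other.
have LP t : t \in L <-> t = s \/ ~ (val s `<=` val t).
  rewrite finset.in_set; split.
    by move=> /orP[/eqP ->|/asboolP]; [left|right].
  by case=> [->|H]; [rewrite eqxx|apply/orP; right; apply/asboolP].
have [||y [Hy cy]] := @flabby L x'.
- move=> t r /LP tL rt; apply/LP; case: tL => [ts|nt].
    subst t; have [->|/eqP rs] := eqVneq r s; first by left.
    right=> sr; apply: rs; apply/val_inj/seteqP; split=> //.
  by right=> sr; apply: nt; exact: subset_trans sr rt.
- move=> t r /LP tL /LP rL rt.
  have [ts|/eqP ts] := eqVneq t s.
    subst t; have [rs|/eqP rs] := eqVneq r s; first by subst r; rewrite mres_id.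
    by rewrite xs kx // xo.
  rewrite [x' t]xo // raddf0; have [rs|/eqP rs] := eqVneq r s; last by rewrite xo.
  by subst r; case: tL => //; case.
exists y; split=> //.
  by rewrite Hy ?xs //; apply/LP; left.
move=> t nt; rewrite Hy; last by apply/LP; right.
by apply: xo => ts; apply: nt; rewrite ts.
Qed.

(** The generator of E_o extends to a global section, whose values cannot vanish. *)
Lemma stalk_nonzero s : exists x : E s, x <> 0.
Proof.
pose o0 : D := FSetSub (set0_fan D).
have [f [bf fD fZ _]] := mes_N mesE (erefl : val o0 = [set 0]).
have [g fK gK] := bf.
have [|y [cy y0 _]] := @extend_by_zero o0 (g 1).
  move=> t ts tns; exfalso; apply: tns; apply/val_inj/seteqP; split=> //.
  exact: (set0_sub (valP t)).
exists (y s) => ys.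
have := cy s o0 I I (set0_sub (valP s)); rewrite ys raddf0 y0 => /(congr1 f).
rewrite gK; have -> : f 0 = 0 by apply: (addrI (f 0)); rewrite -fD !addr0.
by move/eqP; rewrite eq_sym oner_eq0.
Qed.

(** A product of linear forms, one for each proper face, vanishing there but not on [s], kills the
    boundary values and acts injectively on the free module E_s. *)
Lemma kernel_nonzero s : exists x : E s, kills_bd x /\ x <> 0.
Proof.
have [x nx] := stalk_nonzero s.
have /choice[b Hb] : forall t, exists b : 'Hom(V, R^o), val t `<=` val s -> t <> s ->
    (forall v, v \in lspan (val t) -> b v = 0) /\ exists2 v, v \in lspan (val s) & b v != 0.
  move=> t; have [ts|] := pselect (val t `<=` val s); last by exists 0.
  have [->|/eqP tns] := eqVneq t s; first by exists 0.
  have [b bp bE] := wall_form (valP s) (valP t) ts.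
  exists b => _ _; split.
    by apply: (lspan_eq0 (fan_cone (valP t))) => v /bE[].
  have tns' : val t <> val s by move/val_inj.
  have [v sv vt] := cone_not_lspan (valP s) (valP t) ts tns'.
  exists v; first exact: (lspan_mem (fan_cone (valP s))).
  apply/eqP => bv; case/negP: vt; apply: (lspan_mem (fan_cone (valP t))).
  by apply/bE.
pose P t := `[< val t `<=` val s /\ t <> s >].
pose f := \prod_(t : D | P t) linform (lspan (val s)) (b t).
exists (f *: x); split.
  move=> t ts tns; rewrite mres_scale; last exact/face_sub_fan.
  have sub := lspanS (valP s) (valP t) ts.
  rewrite /f (bigD1 t) /=; last exact/asboolP.
  rewrite rmorphM /= symres_linform // linform_eq0 ?mul0r ?scale0r //.
  exact: (Hb t ts tns).1.
move=> fx0.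
have [cf cfP] := free_coords (mes_PF mesE s).
apply: nx; apply: (coords_inj cfP) => c.
have := congr1 (fun z => cf z c) fx0; rewrite (coordsZ cfP) (coords0 cfP) => /eqP.
rewrite mulf_eq0 => /orP[|/eqP //].
have : f != 0.
  apply/prodf_neq0 => t /asboolP[ts tns].
  by have [_ [v vs bv]] := Hb t ts tns; exact: (linform_neq0 vs bv).
by move=> /negbTE ->.
Qed.

Lemma stalk_functional s (x : E s) : x <> 0 -> exists phi : E s -> R,
  [/\ phi x = 1, forall y z, phi (y + z) = phi y + phi z &
      forall c y, phi (c%:MP *: y) = c * phi y].
Proof.
move=> nx; have [cf cfP] := free_coords (mes_PF mesE s).
have [b nb] : exists b, cf x b <> 0.
  by apply: contrapT => H; apply: nx; apply: (coords_inj cfP) => b; apply: contrapT => nb;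
    apply: H; exists b.
have [mon nm] : exists mon, (cf x b)@_mon != 0.
  apply: contrapT => H; apply: nb; apply/mpolyP => mon; rewrite mcoeff0.
  by apply/eqP/negPn/negP => nm; apply: H; exists mon.
exists (fun y => (cf y b)@_mon / (cf x b)@_mon); split.
- by rewrite mulfV.
- by move=> y z; rewrite (coordsD cfP) mcoeffD mulrDl.
- by move=> c y; rewrite (coordsZ cfP) mcoeffCM mulrA.
Qed.

End SheafTheory.

(** * Comparison of the complexes *)

Section UniformComplexes.
Variables (R : realType) (V : vectType R) (D : fan V) (o : orientation D).
Local Notation n := (\dim {:V}).
Hypothesis pureD : purely_dim n D.
Implicit Types (s t u g : D).

Lemma dstar_sum (M : zmodType) m (J : Type) (r : seq J) (f : J -> D -> M) s :
  dstar o m (fun g => \sum_(j <- r) f j g) s = \sum_(j <- r) dstar o m (f j) s.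
Proof.
case: m => [//|m] /=; rewrite /scob exchange_big /=.
by apply: eq_bigr => g _; rewrite mulrz_suml.
Qed.

Lemma dstar_morph (M M' : zmodType) (f : M -> M') m b s :
  (forall x y, f (x + y) = f x + f y) -> f (dstar o m b s) = dstar o m (fun g => f (b g)) s.
Proof.
move=> fD; case: m => [//|m] /=.
have f0 : f 0 = 0 by apply: (addrI (f 0)); rewrite -fD !addr0.
have fN x : f (- x) = - f x by apply: (addrI (f x)); rewrite -fD !subrr.
have fM x k : f (x *+ k) = f x *+ k by elim: k => [|k IH]; rewrite ?mulr0n // !mulrS fD IH.
rewrite /scob (big_morph f fD f0); apply: eq_bigr => g _.
by rewrite /intmul; case: (incidence _ _ _) => k; rewrite ?fN fM.
Qed.

Lemma interior_facet m s t : facet (val t) (val s) -> interior m.+1 t -> interior m s.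
Proof.
move=> f [td tb]; split; last by apply: contra tb; exact: bd_fan_facet.
by have [_ d] := iffLR (facetE _ _) f; lia.
Qed.

Section Values.
Variables (k : nat) (M : lmodType {mpoly R[k]}) (K : M -> Prop).
Hypothesis K0 : K 0.
Hypothesis KD : forall x y, K x -> K y -> K (x + y).
Hypothesis KZ : forall (c : R) x, K x -> K (c%:MP *: x).

Lemma scalC0 (x : M) : (0 : R)%:MP_[k] *: x = 0.
Proof. by rewrite mpolyC0 scale0r. Qed.

Lemma scalCD (a b : R) (x : M) : (a + b)%:MP_[k] *: x = a%:MP *: x + b%:MP *: x.
Proof. by rewrite mpolyCD scalerDl. Qed.

(* By induction on the number of vectors spanning the values: either all the
   coordinates are cocycles, or one of the vectors is a combination of the others. *)
Lemma star_exact_values u m (z : D -> M) : star_exact o u m ->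
  (forall s, K (z s)) ->
  (forall t, val u `<=` val t -> interior m.+1 t -> scob o z t = 0) ->
  exists b : D -> M, [/\ forall s, K (b s), m = 0%N -> forall s t, b s = b t &
    forall s, val u `<=` val s -> interior m s -> z s = dstar o m b s].
Proof.
move=> ex Kz Hz.
suff H (l : seq D) (v : D -> M) (a : D -> D -> R) : uniq l -> (forall i, K (v i)) ->
    (forall s, z s = \sum_(i <- l) (a i s)%:MP *: v i) ->
    exists b : D -> M, [/\ forall s, K (b s), m = 0%N -> forall s t, b s = b t &
      forall s, val u `<=` val s -> interior m s -> z s = dstar o m b s].
  (* Initially the spanning vectors are the values themselves, with Kronecker coefficients. *)
  apply: (H (enum D) z (fun i s => (i == s)%:R)) => //; first exact: enum_uniq.
  move=> s; rewrite (bigD1_seq s) ?mem_enum ?enum_uniq //= eqxx mpolyC1 scale1r.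
  by rewrite big1 ?addr0 // => i /negbTE ->; rewrite scalC0.
move: {2}(size l) (leqnn (size l)) => N.
elim: N l a => [|N IH] l a lN ul Kv zE.
  exists (fun _ => 0); split=> // s _ _; rewrite zE.
  move: lN; rewrite leqn0 size_eq0 => /eqP ->; rewrite big_nil.
  by case: (m) => [//|m'] /=; rewrite /scob big1 // => g _; rewrite mul0rz.
have scobz t : scob o z t = \sum_(i <- l) (scob o (a i) t)%:MP *: v i.
  transitivity (dstar o 1 (fun s => \sum_(i <- l) (a i s)%:MP *: v i) t).
    by apply: eq_bigr => s _; rewrite zE.
  rewrite dstar_sum; apply: eq_bigr => i _.
  by rewrite (@dstar_morph R M (fun r => r%:MP *: v i) 1 (a i)) // => ? ?; rewrite scalCD.
have [coc|] := pselect (forall i, i \in l -> forall t, val u `<=` val t -> interior m.+1 t ->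
    scob o (a i) t = 0).
  have /choice[b Hb] : forall i, exists b : D -> R, i \in l ->
      (m = 0%N -> forall s t, b s = b t) /\
      forall s, val u `<=` val s -> interior m s -> a i s = dstar o m b s.
    move=> i; have [il|il] := pselect (i \in l); last by exists (fun _ => 0).
    by have [b Hb] := ex (a i) (coc i il); exists b.
  exists (fun g => \sum_(i <- l) (b i g)%:MP *: v i); split.
  - by move=> s; apply: (big_ind K) => // i _; exact: KZ.
  - move=> m0 s t; rewrite big_seq [RHS]big_seq; apply: eq_bigr => i il.
    by rewrite ((Hb i il).1 m0 s t).
  move=> s us Is; rewrite zE dstar_sum big_seq [RHS]big_seq; apply: eq_bigr => i il.
  rewrite ((Hb i il).2 s us Is).
  by rewrite (@dstar_morph R M (fun r => r%:MP *: v i) m (b i)) // => ? ?; rewrite scalCD.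
move=> /existsNP[i0 /not_implyP[il /existsNP[t0 /not_implyP[ut /not_implyP[It /eqP nz]]]]].
(* The cocycle condition at [t0] is a linear relation among the vectors, to be solved for [v i0]. *)
have := Hz t0 ut It; rewrite scobz (big_rem i0 il) /= => /eqP.
rewrite addr_eq0 => /eqP v0.
pose la i := - scob o (a i) t0 / scob o (a i0) t0.
have vE : v i0 = \sum_(i <- rem i0 l) (la i)%:MP *: v i.
  have : ((scob o (a i0) t0)^-1)%:MP_[k] *: ((scob o (a i0) t0)%:MP *: v i0) = v i0.
    by rewrite scalerA -mpolyCM mulVf // mpolyC1 scale1r.
  move=> <-; rewrite v0 -sumrN scaler_sumr; apply: eq_bigr => i _.
  by rewrite -scaleNr scalerA -mpolyCN -mpolyCM /la mulrC.
apply: (IH (rem i0 l) (fun i s => a i s + a i0 s * la i)) => //.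
- by rewrite size_rem //; case: (size l) lN.
- exact: rem_uniq.
move=> s; rewrite zE (big_rem i0 il) /= vE scaler_sumr -big_split /=.
by apply: eq_bigr => i _; rewrite scalerA -mpolyCM scalCD addrC.
Qed.

End Values.

Variable E : gmod_sheaf D.
Hypothesis mesE : minimal_extension_sheaf E.
Local Notation family := (forall s : D, E s).
Local Notation delta := (@coboundary R V D o (sheaf_of_gmod E)).

Definition aug_cond (m : nat) (y : family) : Prop :=
  m = 0%N -> compat_on (fun _ => True) y.

Definition dfam (m : nat) (y : family) : family := if m is 0%N then y else delta y.

Definition sheaf_exact (m : nat) : Prop :=
  forall x : family, (forall t, interior m.+1 t -> delta x t = 0) ->
    exists y : family, aug_cond m y /\ forall s, interior m s -> x s = dfam m y s.

Lemma deltaD (x y : family) t : delta (fun s => x s + y s) t = delta x t + delta y t.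
Proof.
by rewrite -big_split; apply: eq_bigr => s _; rewrite raddfD /= mulrzDl.
Qed.

Lemma eq_dfam m (x y : family) t : (forall s, x s = y s) -> dfam m x t = dfam m y t.
Proof.
by move=> xy; case: m => [|m]; rewrite /dfam // /coboundary; apply: eq_bigr => s _; rewrite xy.
Qed.

Lemma dfamD m (x y : family) t : dfam m (fun s => x s + y s) t = dfam m x t + dfam m y t.
Proof. by case: m => [//|m]; exact: deltaD. Qed.

Lemma deltaN (x : family) t : delta (fun s => - x s) t = - delta x t.
Proof.
by rewrite -sumrN; apply: eq_bigr => s _; rewrite raddfN /= mulNrz.
Qed.

Lemma dfam0 m t : dfam m (fun s => 0 : E s) t = 0.
Proof.
case: m => [//|m]; rewrite /= /coboundary big1 // => s _; by rewrite raddf0 mul0rz.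
Qed.

Lemma aug_section (y : family) : compat_on (fun _ => True) y ->
  exists Y : msections E [set: D]%SET, forall s hs, sec_val Y s hs = y s.
Proof.
move=> cy.
have c : compatible (F := sheaf_of_gmod E) (L := [set: D]%SET) (fun s _ => y s).
  by move=> s t _ _ ts; apply: cy => //; exact/face_sub_fan.
by exists (exist _ _ c).
Qed.

Lemma section_aug (Y : msections E [set: D]%SET) :
  compat_on (fun _ => True) (fun s => sec_val Y s (finset.in_setT s) : E s).
Proof.
move=> s t _ _ ts; exact: (svalP Y s t _ _ (iffRL (face_sub_fan _ _) ts)).
Qed.

Lemma sheaf_exactE : reduced_acyclic o (sheaf_of_gmod E) <-> forall m, sheaf_exact m.
Proof.
rewrite reduced_acyclicE; last by move=> y; exact: aug_inj_fan.
split=> H m x Hx; have [y [cy Hy]] := H m x Hx; exists y; split.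
- by move=> m0 s t _ _ /face_sub_fan; exact: cy.
- by case: (m) Hy.
- by move=> m0 s t /face_sub_fan; exact: (cy m0).
- by case: (m) Hy.
Qed.

Lemma delta_dfam m (y : family) t : aug_cond m y -> interior m.+1 t ->
  delta (dfam m y) t = 0.
Proof.
case: m => [|m] cy It; last exact: coboundary_sq.
have [Y HY] := aug_section (cy erefl).
rewrite -(coboundary_aug o pureD Y It); apply: eq_coboundary => s _ /=.
by rewrite HY.
Qed.

Lemma res_dfam m (Y : D -> family) s t : (forall g, compat_on (fun _ => True) (Y g)) ->
  val t `<=` val s ->
  mres E s t (dfam m (fun g => Y g g) s) = dstar o m (fun g => Y g t) s.
Proof.
move=> cY ts; case: m => [|m] /=; first by rewrite cY.
rewrite raddf_sum; apply: eq_bigr => g /asboolP/facetE[sg _] /=.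
rewrite raddfMz mres_comp; [|exact/face_sub_fan..].
by rewrite cY //; exact: subset_trans ts sg.
Qed.

Lemma res_delta (x : family) s t : val t `<=` val s ->
  mres E s t (delta x s) = scob o (fun g => mres E g t (x g)) s.
Proof.
move=> ts; rewrite raddf_sum; apply: eq_bigr => g /asboolP/facetE[sg _] /=.
by rewrite raddfMz mres_comp //; exact/face_sub_fan.
Qed.

Lemma mresC s t c x : val t `<=` val s -> mres E s t (c%:MP *: x) = c%:MP *: mres E s t x.
Proof. by move=> ts; rewrite mres_scale ?symresC //; exact/face_sub_fan. Qed.

Lemma kills_bd0 s : kills_bd (0 : E s).
Proof. by move=> t _ _; rewrite raddf0. Qed.

Lemma kills_bdD s (x y : E s) : kills_bd x -> kills_bd y -> kills_bd (x + y).
Proof. by move=> kx ky t ts tns; rewrite raddfD /= kx // ky // addr0. Qed.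

Lemma kills_bdC s c (x : E s) : kills_bd x -> kills_bd (c%:MP *: x).
Proof. by move=> kx t ts tns; rewrite mresC // kx // scaler0. Qed.

(** The restrictions of [x] to [tau] form a cocycle of the star complex with values in the kernel of
    the restriction to the boundary of [tau]. A primitive can be chosen with values in this kernel,
    and each value extends by zero to a section supported on the star; these sections make up
    [y]. *)
Lemma solve_at m x tau : star_exact o tau m ->
  (forall t, interior m.+1 t -> delta x t = 0) ->
  (forall s t, interior m s -> val t `<=` val s ->
     (cone_dim (val t) < cone_dim (val tau))%N -> mres E s t (x s) = 0) ->
  exists y, [/\ aug_cond m y,
    forall s, interior m s -> val tau `<=` val s ->
      mres E s tau (dfam m y s) = mres E s tau (x s) &
    forall s t, val t `<=` val s -> ~ (val tau `<=` val t) -> mres E s t (dfam m y s) = 0].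
Proof.
move=> ex xc x0.
pose z s : E tau := if `[< val tau `<=` val s /\ interior m s >] then mres E s tau (x s) else 0.
have Kz s : kills_bd (z s).
  rewrite /z; case: asboolP => [[us Is]|_]; last exact: kills_bd0.
  move=> t tt tn; rewrite mres_comp; [|exact/face_sub_fan..].
  apply: x0 => //; first exact: subset_trans tt us.
  by apply: (cone_dim_lt (valP tau) (valP t) tt); move/val_inj.
have zc t : val tau `<=` val t -> interior m.+1 t -> scob o z t = 0.
  move=> ut It; transitivity (scob o (fun g => mres E g tau (x g)) t).
    apply: eq_bigr => g /asboolP f; rewrite /z ifT //; apply/asboolP; split.
      exact: subset_trans ut (iffLR (facetE _ _) f).1.
    exact: interior_facet f It.
  by rewrite -res_delta // xc // raddf0.
have [b [Kb bc Hb]] :=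
  star_exact_values (@kills_bd0 tau) (@kills_bdD tau) (@kills_bdC tau) ex Kz zc.
have /choice[ext Hext] : forall k : E tau, exists y : family, kills_bd k ->
    [/\ compat_on (fun _ => True) y, y tau = k & forall t, ~ (val tau `<=` val t) -> y t = 0].
  move=> k; have [kk|nk] := pselect (kills_bd k); last by exists (fun _ => 0).
  by have [y Hy] := extend_by_zero mesE kk; exists y.
pose Y g := ext (b g).
have cY g : compat_on (fun _ => True) (Y g) by have [] := Hext _ (Kb g).
exists (fun g => Y g g); split.
- move=> m0 s t _ _ ts; rewrite /Y (bc m0 t s); exact: (cY s s t).
- move=> s Is us; rewrite res_dfam //.
  transitivity (dstar o m b s).
    have Yt g : Y g tau = b g by have [] := Hext _ (Kb g).
    rewrite /dstar; case: (m) => [|m']; first exact: Yt.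
    by apply: eq_bigr => g _; rewrite Yt.
  by rewrite -Hb // /z ifT //; apply/asboolP.
- move=> s t ts nt; rewrite res_dfam //.
  have Y0 g : Y g t = 0 by have [_ _] := Hext _ (Kb g); apply.
  rewrite /dstar; case: (m) => [//|m']; rewrite /scob big1 // => g _.
  by rewrite Y0 mul0rz.
Qed.

(* The family x, whose restrictions to the cones of dimension < j vanish, takes
   values in the kernels of the restrictions to the boundaries on the cones of
   dimension j; there it is the coboundary of a sum of sections supported on stars. *)
Lemma star_to_sheaf m j (x : family) :
  (forall u, (j <= cone_dim (val u))%N -> star_exact o u m) ->
  (forall t, interior m.+1 t -> delta x t = 0) ->
  (forall s t, interior m s -> val t `<=` val s ->
     (cone_dim (val t) < j)%N -> mres E s t (x s) = 0) ->
  exists y : family, aug_cond m y /\ forall s, interior m s -> x s = dfam m y s.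
Proof.
move: {2}(n.+1 - j)%N (leqnn (n.+1 - j)%N) => k.
elim: k j x => [|k IH] j x jk ex xc x0.
  exists (fun _ => 0); split; first by move=> _ s t _ _ _; rewrite raddf0.
  (* Now [j > n], so the vanishing hypothesis for [s] as its own face gives [x s = 0]. *)
  move=> s Is; rewrite dfam0 -[x s](mres_id (g := E)); apply: x0 => //.
  have : (cone_dim (val s) <= n)%N by exact/dimvS/subvf.
  lia.
have /choice[y Hy] : forall tau, exists y, cone_dim (val tau) = j -> [/\ aug_cond m y,
    forall s, interior m s -> val tau `<=` val s ->
      mres E s tau (dfam m y s) = mres E s tau (x s) &
    forall s t, val t `<=` val s -> ~ (val tau `<=` val t) -> mres E s t (dfam m y s) = 0].
  move=> tau; have [d|/eqP d] := eqVneq (cone_dim (val tau)) j; last by exists (fun _ => 0).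
  have exd : star_exact o tau m by apply: ex; rewrite d.
  have [|y H] := solve_at exd xc; first by rewrite d.
  by exists y.
pose T (tau : D) := cone_dim (val tau) == j.
pose ysum : family := fun s => \sum_(tau | T tau) y tau s.
have dysum s : dfam m ysum s = \sum_(tau | T tau) dfam m (y tau) s.
  rewrite /ysum; elim: (index_enum _) => [|tau l IHl].
    by rewrite big_nil -[RHS](dfam0 m s); apply: eq_dfam => g; rewrite big_nil.
  rewrite big_cons -IHl; case: (boolP (T tau)) => Tt.
    by rewrite -dfamD; apply: eq_dfam => g; rewrite big_cons Tt.
  by apply: eq_dfam => g; rewrite big_cons (negbTE Tt).
have aug_y : aug_cond m ysum.
  move=> m0 s t _ _ ts; rewrite raddf_sum; apply: eq_bigr => tau /eqP d.
  by have [c _ _] := Hy tau d; exact: (c m0).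
(* Subtracting the corrections of all cones of dimension [j] makes the restrictions vanish one
   dimension further; at such a cone only its own correction is felt. *)
pose x' : family := fun s => x s + - dfam m ysum s.
have [||||y' [cy' Hy']] := IH j.+1 x'.
- lia.
- by move=> u ju; apply: ex; lia.
- by move=> t It; rewrite deltaD deltaN xc // delta_dfam // oppr0 addr0.
- move=> s t Is ts; rewrite ltnS => tj; rewrite raddfD raddfN /= dysum raddf_sum /=.
  have [tj'|tj'] := ltnP (cone_dim (val t)) j.
    rewrite x0 // big1 ?subrr // => tau /eqP d.
    have [_ _ H] := Hy tau d; apply: H => // tt.
    by have := cone_dimS (valP t) (valP tau) tt; rewrite d; lia.
  have d : cone_dim (val t) = j by lia.
  rewrite (bigD1 t) /=; last exact/eqP.
  have [_ Ht _] := Hy t d; rewrite Ht // big1 ?addr0 ?subrr // => tau /andP[/eqP d' ne].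
  have [_ _ H] := Hy tau d'; apply: H => // tt.
  case/eqP: ne; apply: val_inj.
  by apply: (cone_dim_eq (valP t) (valP tau) tt); rewrite d d'.
exists (fun s => ysum s + y' s); split.
  by move=> m0 s t _ _ ts; rewrite raddfD /= (aug_y m0 s t) // (cy' m0 s t).
by move=> s Is; rewrite dfamD -Hy' // /x' addrC subrK.
Qed.

(* The star complex of u embeds in that of E by multiplication with a section
   supported on the star of u. *)
Lemma class_lift m u (c : D -> R) :
  (forall t, val u `<=` val t -> interior m.+1 t -> scob o c t = 0) ->
  exists x : family, [/\
    forall t, interior m.+1 t -> delta x t = 0,
    forall (h : 'Hom(V, R^o)) s t, (forall v, v \in lspan (val u) -> h v = 0) ->
      val t `<=` val s -> (cone_dim (val t) < (cone_dim (val u)).+1)%N ->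
      mres E s t (linform (lspan (val s)) h *: x s) = 0 &
    (exists y, aug_cond m y /\ forall s, interior m s -> x s = dfam m y s) ->
      exists b : D -> R, (m = 0%N -> forall s t, b s = b t) /\
      forall s, val u `<=` val s -> interior m s -> c s = dstar o m b s].
Proof.
move=> Hc; have [k [kk nk]] := kernel_nonzero mesE u.
have [e [ce eu e0]] := extend_by_zero mesE kk.
have [phi [phi1 phiD phiC]] := stalk_functional mesE nk.
pose x : family := fun s => (c s)%:MP *: e s.
exists x; split.
- move=> t It.
  have -> : delta x t = (scob o c t)%:MP *: e t.
    rewrite (@dstar_morph R (E t) (fun r => r%:MP *: e t) 1 c t); last first.
      by move=> ? ?; rewrite mpolyCD scalerDl.
    apply: eq_bigr => s /asboolP/facetE[ts _] /=.
    by rewrite mresC // ce.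
  have [ut|nut] := pselect (val u `<=` val t); last by rewrite e0 // scaler0.
  by rewrite Hc // mpolyC0 scale0r.
- move=> h s t hu ts td; rewrite /x mres_scale; last exact/face_sub_fan.
  rewrite mresC // ce // symres_linform; last exact: lspanS (valP s) (valP t) ts.
  have [ut|nut] := pselect (val u `<=` val t); last by rewrite e0 // !scaler0.
  have -> : t = u by apply/val_inj/esym/(cone_dim_eq (valP t) (valP u) ut).
  by rewrite linform_eq0 // scale0r.
move=> [y [cy Hy]].
have cE s : val u `<=` val s -> c s = phi (mres E s u (x s)).
  by move=> us; rewrite /x mresC // ce // eu phiC phi1 mulr1.
case: m {Hc} cy Hy => [|m] cy Hy.
  exists (fun _ => phi (y u)); split=> // s us Is.
  by rewrite cE // Hy //= (cy erefl s u).
exists (fun g => phi (mres E g u (y g))); split=> // s us Is.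
rewrite cE // Hy //= res_delta //.
exact: (@dstar_morph (E u) R phi m.+1 (fun g => mres E g u (y g))).
Qed.

End UniformComplexes.

(** * Regular sequences acting on a complex *)

Section QuotientComplex.
Variables (X : zmodType) (T : Type).
Variables (S N0 : nat -> X -> Prop) (d : nat -> X -> X) (act : T -> X -> X).
Hypothesis S0 : forall m, S m 0.
Hypothesis SB : forall m x y, S m x -> S m y -> S m (x - y).
Hypothesis Sact : forall m h x, S m x -> S m (act h x).
Hypothesis N00 : forall m, N0 m 0.
Hypothesis N0B : forall m x y, N0 m x -> N0 m y -> N0 m (x - y).
Hypothesis N0act : forall m h x, N0 m x -> N0 m (act h x).
Hypothesis dB : forall m x y, d m (x - y) = d m x - d m y.
Hypothesis actB : forall h x y, act h (x - y) = act h x - act h y.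
Hypothesis d_act : forall m h x, d m (act h x) = act h (d m x).
Hypothesis actC : forall h g x, act h (act g x) = act g (act h x).
Hypothesis Sd : forall m x, S m x -> S m.+1 (d m x).
Hypothesis N0d : forall m x, N0 m x -> N0 m.+1 (d m x).
Hypothesis dd : forall m x, S m x -> N0 m.+2 (d m.+1 (d m x)).

(* N hs m is the submodule N0 m + \sum_(h in hs) h (S m), so that S m / N hs m is
   the quotient of the m-th module of the complex by the ideal generated by hs. *)
Fixpoint Nspan (hs : seq T) (m : nat) (x : X) : Prop :=
  if hs is h :: hs' then exists2 y, S m y & Nspan hs' m (x - act h y) else N0 m x.

Definition exact_el hs p x : Prop :=
  if p is m.+1 then exists2 y, S m y & Nspan hs m.+1 (x - d m y) else Nspan hs 0 x.

Definition exact_at hs p : Prop :=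
  forall x, S p x -> Nspan hs p.+1 (d p x) -> exact_el hs p x.

Definition regular_at h hs p : Prop :=
  forall x, S p x -> Nspan hs p (act h x) -> Nspan hs p x.

Lemma d0 m : d m 0 = 0. Proof. by have := dB m 0 0; rewrite !subrr. Qed.
Lemma act0 h : act h 0 = 0. Proof. by have := actB h 0 0; rewrite !subrr. Qed.

Lemma NspanB hs m x y : Nspan hs m x -> Nspan hs m y -> Nspan hs m (x - y).
Proof.
elim: hs x y => [|h hs IH] x y /=; first exact: N0B.
move=> [u Su Hx] [v Sv Hy]; exists (u - v); first exact: SB.
have -> : x - y - act h (u - v) = (x - act h u) - (y - act h v).
  by rewrite actB !opprB addrACA [RHS]addrACA [- y - _]addrC.
exact: IH.
Qed.

Lemma N0_span hs m x : N0 m x -> Nspan hs m x.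
Proof. by elim: hs x => [//|h hs IH] x Nx /=; exists 0; rewrite ?act0 ?subr0 //; exact: IH. Qed.

Lemma NspanD hs m x y : Nspan hs m x -> Nspan hs m y -> Nspan hs m (x + y).
Proof.
move=> Hx Hy; rewrite -[y]opprK -[- y]sub0r; apply: NspanB => //.
by apply: NspanB => //; apply: N0_span.
Qed.

Lemma Nspan_act hs g m x : Nspan hs m x -> Nspan hs m (act g x).
Proof.
elim: hs x => [|h hs IH] x /=; first exact: N0act.
move=> [u Su Hx]; exists (act g u); first exact: Sact.
by rewrite actC -actB; exact: IH.
Qed.

Lemma Nspan_weaken h hs m x : Nspan hs m x -> Nspan (h :: hs) m x.
Proof. by move=> Hx; exists 0; rewrite ?act0 ?subr0. Qed.

Lemma Nspan_form h hs m x : S m x -> Nspan (h :: hs) m (act h x).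
Proof. by move=> Sx; exists x => //; rewrite subrr; exact: N0_span. Qed.

Lemma Nspan_d hs m x : Nspan hs m x -> Nspan hs m.+1 (d m x).
Proof.
elim: hs x => [|h hs IH] x /=; first exact: N0d.
move=> [u Su Hx]; exists (d m u); first exact: Sd.
by rewrite -d_act -dB; exact: IH.
Qed.

Lemma Nspan_sub hs m x y : Nspan hs m (x - y) -> Nspan hs m y -> Nspan hs m x.
Proof. by move=> Hxy Hy; rewrite -[x](subrK y); exact: NspanD. Qed.

Lemma Nspan_sym hs m x y : Nspan hs m (x - y) -> Nspan hs m (y - x).
Proof.
by move=> Hxy; rewrite -opprB -sub0r; apply: NspanB => //; exact: N0_span.
Qed.

Lemma exact_el_cons h hs p x z : S p z -> exact_el hs p (x - act h z) ->
  exact_el (h :: hs) p x.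
Proof.
case: p => [|m] Sz /=; first by exists z.
by move=> [w Sw Hw]; exists w => //; exists z; [exact: Sz|rewrite addrAC].
Qed.

(** A piece of the long exact sequence of multiplication by [h], spelled out on elements: exactness
    at two consecutive indices modulo [hs] gives exactness modulo [h :: hs] at the lower one. *)
Lemma exact_at_cons h hs p : exact_at hs p -> exact_at hs p.+1 -> regular_at h hs p.+2 ->
  exact_at (h :: hs) p.
Proof.
move=> ex1 ex2 reg x Sx [y Sy Hy].
have dy : Nspan hs p.+2 (d p.+1 y).
  apply: reg; first exact: Sd.
  have := Nspan_d Hy; rewrite dB d_act => /Nspan_sym; move/Nspan_sub; apply.
  exact/N0_span/dd.
have [z Sz Hz] := ex2 y Sy dy.
have Sxz : S p (x - act h z) by apply: (SB) => //; exact: Sact.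
have Hx : Nspan hs p.+1 (d p (x - act h z)).
  rewrite dB d_act; have -> : d p x - act h (d p z) = (d p x - act h y) + act h (y - d p z).
    by rewrite actB addrA subrK.
  by apply: NspanD => //; exact: Nspan_act.
exact: (exact_el_cons Sz (ex1 _ Sxz Hx)).
Qed.

(** Exactness at index 0 means that the first map is injective modulo [hs], so regularity descends
    from cochains to sections. *)
Lemma regular_at0 h hs : exact_at hs 0 -> regular_at h hs 1 -> regular_at h hs 0.
Proof.
move=> ex reg x Sx Hx; apply: ex => //; apply: reg; first exact: Sd.
by rewrite -d_act; exact: Nspan_d.
Qed.

(** Each form used lowers the index by one, hence the triangular range of regularity and the [p.+1]
    forms. *)
Fixpoint regular_chain hs gs p : Prop :=
  if gs is g :: gs' then (forall p', (p' <= p)%N -> regular_at g hs p') /\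
    (if p is p1.+1 then regular_chain (g :: hs) gs' p1 else True)
  else False.

(* Writing g x = d y, the class of y modulo g lives in degree p - 1 and is
   nonzero if the class of x is. *)
Lemma killed_class_exact p hs gs x : regular_chain hs gs p ->
  S p x -> Nspan hs p.+1 (d p x) -> (forall p', (p' < p)%N -> exact_at hs p') ->
  (forall g, List.In g gs -> exact_el hs p (act g x)) -> exact_el hs p x.
Proof.
elim: p hs gs x => [|m IH] hs [//|g gs] x /= [reg chain] Sx dx low kill.
  by apply: reg => //; apply: kill; left.
have [y Sy Hy] := kill g (or_introl erefl).
have regm : regular_at g hs m.+1 by apply: reg.
have : exact_el (g :: hs) m y.
  apply: (IH _ gs) => //.
  - apply: (@Nspan_sub _ _ _ (act g x)); last exact: Nspan_form.
    by apply/Nspan_weaken/Nspan_sym.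
  - move=> p' p'm; apply: exact_at_cons; [apply: low; lia|apply: low; lia|].
    by apply: reg; lia.
  move=> g' g'gs.
  have [y' Sy' Hy'] := kill g' (or_intror g'gs).
  (* This element is a cocycle modulo [hs], hence a coboundary by [low]; so [g'] kills the class of
     [y] modulo [g]. *)
  have Sw : S m (act g' y - act g y') by apply: SB; exact: Sact.
  have dw : Nspan hs m.+1 (d m (act g' y - act g y')).
    rewrite dB !d_act.
    have -> : act g' (d m y) - act g (d m y') =
        act g (act g' x - d m y') - act g' (act g x - d m y).
      by rewrite !actB (actC g') opprB [RHS]addrC [RHS]addrA subrK.
    by apply: NspanB; exact: Nspan_act.
  exact: (exact_el_cons Sy' (low m (ltnSn m) _ Sw dw)).
move=> Hex.
(* Modulo [hs], [y] is a cocycle plus [act g v]; hence [g] kills [x - d m v], which vanishes by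
   regularity. *)
have [v [Sv [z [Hz Hyz]]]] : exists v, S m v /\
    exists z, N0 m.+1 (d m z) /\ Nspan hs m (y - z - act g v).
  case: (m) Hex => [|k] /=.
    by move=> [v Sv Hv]; exists v; split=> //; exists 0; rewrite subr0 d0; split.
  move=> [z Sz [v Sv Hv]]; exists v; split=> //; exists (d k z); split=> //.
  exact: dd.
exists v => //; apply: (regm); first by apply: (SB) => //; exact: Sd.
rewrite actB -d_act.
have -> : act g x - d m (act g v) = (act g x - d m y) + (d m (y - z - act g v) + d m z).
  by rewrite !dB [d m y - d m z - _]addrAC subrK addrA subrK.
apply: NspanD => //; apply: NspanD; first exact: Nspan_d.
exact: N0_span.
Qed.

End QuotientComplex.

(** * Generic linear forms vanishing on a subspace *)

Section GenericForms.
Variables (R : realType) (V : vectType R) (D : fan V).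
Local Notation n := (\dim {:V}).
Implicit Types (U W : {vspace V}) (g h : 'Hom(V, R^o)) (hs gs : seq 'Hom(V, R^o)) (s : D).

Lemma zeros_dim U hs : (\dim U <= \dim (zeros U hs) + size hs)%N.
Proof.
elim: hs => [|h hs IH] /=; first by rewrite addn0.
apply: (leq_trans IH); rewrite addnS -addSn leq_add2r.
rewrite -(limg_ker_dim h (zeros U hs)) -addn1 leq_add2l.
by apply: (leq_trans (dimvS (subvf _))); rewrite dimvf.
Qed.

Lemma zeros_dim_cons U h hs w : w \in zeros U hs -> h w != 0 ->
  (\dim (zeros U (h :: hs)) < \dim (zeros U hs))%N.
Proof.
move=> ww hw /=.
have sub : (zeros U hs :&: lker h <= zeros U hs)%VS by exact: capvSl.
rewrite ltn_neqAle dimvS // andbT; apply/negP => /eqP dE.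
have /eqP E : (zeros U hs :&: lker h)%VS == zeros U hs by rewrite eqEdim sub dE leqnn.
by move: ww; rewrite -E memv_cap memv_ker (negbTE hw) andbF.
Qed.

Lemma form_separating W w : w \notin W ->
  exists2 g : 'Hom(V, R^o), (forall v, v \in W -> g v = 0) & g w != 0.
Proof.
move=> wW; have pw : quot_proj W w != 0 by rewrite -memv_ker lker_quot_proj.
have [i ci] : exists i, coord (vbasis {: quot W}) i (quot_proj W w) != 0.
  apply: contrapT => H; case/eqP: pw.
  rewrite (coord_vbasis (memvf (quot_proj W w))) big1 // => i _.
  suff -> : coord (vbasis {: quot W}) i (quot_proj W w) = 0 by rewrite scale0r.
  by apply/eqP/negPn/negP => ci; apply: H; exists i.
have [f Hf] := form_extend (fun j : 'I_(\dim {: quot W}) => (j == i)%:R : R).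
have fE v : f v = coord (vbasis {: quot W}) i v.
  rewrite Hf ?memvf // (bigD1 i) //= eqxx mul1r big1 ?addr0 // => j /negbTE ->.
  by rewrite mul0r.
exists (f \o quot_proj W)%VF; last by rewrite comp_lfunE fE.
move=> v vW; rewrite comp_lfunE (_ : quot_proj W v = 0) ?linear0 //.
by apply/eqP; rewrite -memv_ker lker_quot_proj.
Qed.

Variables (W : {vspace V}) (c : nat).
Hypothesis dimW : (\dim W + c)%N = n.

(** For these [s] the space [zeros (lspan (val s)) hs], of dimension at least
    [cone_dim (val s) - size hs], is larger than W; so a form vanishing on W can be nonzero on
    it. *)
Definition generic_form hs g : Prop := forall s, (size hs + n < c + cone_dim (val s))%N ->
  exists2 w, w \in zeros (lspan (val s)) hs & g w != 0.

Fixpoint generic_seq hs gs : Prop :=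
  if gs is g :: gs' then generic_form hs g /\ generic_seq (g :: hs) gs' else True.

Lemma generic_form_exists hs :
  exists2 g : 'Hom(V, R^o), (forall v, v \in W -> g v = 0) & generic_form hs g.
Proof.
pose P : set 'Hom(V, R^o) := [set g | forall v, v \in W -> g v = 0].
pose N s : set 'Hom(V, R^o) := [set g | forall w, w \in zeros (lspan (val s)) hs -> g w = 0].
pose l := [seq s <- enum D | (size hs + n < c + cone_dim (val s))%N].
have [|||||g Pg Hg] := @generic_vector R 'Hom(V, R^o) D l P N.
- by move=> v _; rewrite zero_lfunE.
- by move=> f g Pf Pg v vW; rewrite add_lfunE Pf // Pg // addr0.
- by move=> s w _; rewrite zero_lfunE.
- by move=> s a f g Nf Ng w ww; rewrite scale_lfunE add_lfunE opp_lfunE Nf // Ng // subrr scaler0.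
- move=> s /(In_nthP s)[i il sE]; have : s \in l by rewrite -sE mem_nth.
  rewrite mem_filter => /andP[sd _].
  have [|w ws wW] := @vspace_ltP _ _ W (zeros (lspan (val s)) hs).
    have zd := zeros_dim (lspan (val s)) hs; rewrite /cone_dim in sd.
    by move: sd zd dimW; move: (\dim _) (\dim _) (\dim _) (\dim _) => *; lia.
  have [g gW gw] := form_separating wW.
  by exists g => // Ng; rewrite Ng ?eqxx in gw.
exists g => // s sd; apply: contrapT => H; apply: (Hg s).
  have : s \in l by rewrite mem_filter sd mem_enum.
  by move/(nthP s) => [i il E]; apply/(In_nthP s); exists i.
by move=> w ww; apply/eqP/negPn/negP => gw; apply: H; exists w.
Qed.

Lemma generic_seq_exists k hs : exists gs, [/\ size gs = k,
  forall g, List.In g gs -> forall v, v \in W -> g v = 0 & generic_seq hs gs].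
Proof.
elim: k hs => [|k IH] hs; first by exists [::].
have [g gW gg] := generic_form_exists hs; have [gs [sz gsW gsg]] := IH (g :: hs).
exists (g :: gs); split=> //=; first by rewrite sz.
by move=> h [<-|/gsW].
Qed.

End GenericForms.

(** * The complex of E as a complex of modules *)

Section Families.
Variables (R : realType) (V : vectType R) (D : fan V) (E : gmod_sheaf D).

Definition fam : Type := forall s : D, E s.

HB.instance Definition _ := gen_eqMixin fam.
HB.instance Definition _ := gen_choiceMixin fam.

Definition fam_add (x y : fam) : fam := fun s => x s + y s.
Definition fam_opp (x : fam) : fam := fun s => - x s.
Definition fam_zero : fam := fun s => 0.

Lemma fam_ext (x y : fam) : (forall s, x s = y s) -> x = y.
Proof. exact: functional_extensionality_dep. Qed.

Lemma fam_addA : associative fam_add.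
Proof. by move=> x y z; apply: fam_ext => s; exact: addrA. Qed.
Lemma fam_addC : commutative fam_add.
Proof. by move=> x y; apply: fam_ext => s; exact: addrC. Qed.
Lemma fam_add0 : left_id fam_zero fam_add.
Proof. by move=> x; apply: fam_ext => s; exact: add0r. Qed.
Lemma fam_addN : left_inverse fam_zero fam_opp fam_add.
Proof. by move=> x; apply: fam_ext => s; exact: addNr. Qed.

HB.instance Definition _ := GRing.isZmodule.Build fam fam_addA fam_addC fam_add0 fam_addN.

Lemma famB (x y : fam) s : (x - y) s = x s - y s. Proof. by []. Qed.

Variable o : orientation D.
Local Notation n := (\dim {:V}).
Hypothesis pureD : purely_dim n D.
Hypothesis mesE : minimal_extension_sheaf E.
Implicit Types (x y : fam) (h g : 'Hom(V, R^o)) (hs gs : seq 'Hom(V, R^o)).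

Definition fam_act h x : fam := fun s => linform (lspan (val s)) h *: x s.

(** Index [k.+1] stands for degree [k], where only interior cones of codimension [k] count, and
    index 0 for the global sections. *)
Definition fam_null (m : nat) x : Prop :=
  if m is k.+1 then forall s, interior k s -> x s = 0 else forall s, x s = 0.

Let S (m : nat) x : Prop := aug_cond m x.
Let d (m : nat) x : fam := dfam o m x.

Lemma famS0 m : S m 0.
Proof. by move=> _ s t _ _ ts; rewrite raddf0. Qed.

Lemma famSB m x y : S m x -> S m y -> S m (x - y).
Proof. by move=> Sx Sy m0 s t _ _ ts; rewrite !famB raddfB /= (Sx m0 s t) // (Sy m0 s t). Qed.

Lemma famSact m h x : S m x -> S m (fam_act h x).
Proof.
move=> Sx m0 s t _ _ ts; rewrite /fam_act mres_scale; last exact/face_sub_fan.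
by rewrite symres_linform ?(Sx m0 s t) //; exact: lspanS (valP s) (valP t) ts.
Qed.

Lemma fam_null0 m : fam_null m 0.
Proof. by case: m. Qed.

Lemma fam_nullB m x y : fam_null m x -> fam_null m y -> fam_null m (x - y).
Proof.
by case: m => [|m] nx ny s *; rewrite famB nx // ny // subrr.
Qed.

Lemma fam_nullact m h x : fam_null m x -> fam_null m (fam_act h x).
Proof. by case: m => [|m] nx s *; rewrite /fam_act nx // scaler0. Qed.

Lemma fam_dB m x y : d m (x - y) = d m x - d m y.
Proof.
apply: fam_ext => s; rewrite famB; case: m => [//|m].
rewrite /d /dfam /coboundary -sumrB; apply: eq_bigr => t _.
by rewrite famB raddfB /= mulrzBl.
Qed.

Lemma fam_actB h x y : fam_act h (x - y) = fam_act h x - fam_act h y.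
Proof. by apply: fam_ext => s; rewrite famB /fam_act famB scalerBr. Qed.

Lemma fam_d_act m h x : d m (fam_act h x) = fam_act h (d m x).
Proof.
apply: fam_ext => t; case: m => [//|m].
rewrite /d /dfam /fam_act /coboundary scaler_sumr; apply: eq_bigr => s /asboolP/facetE[ts _] /=.
rewrite mres_scale; last exact/face_sub_fan.
by rewrite symres_linform ?scalerMzr //; exact: lspanS (valP s) (valP t) ts.
Qed.

Lemma fam_actC h g x : fam_act h (fam_act g x) = fam_act g (fam_act h x).
Proof. by apply: fam_ext => s; rewrite /fam_act !scalerA mulrC. Qed.

Lemma famSd m x : S m x -> S m.+1 (d m x).
Proof. by []. Qed.

Lemma fam_null_d m x : fam_null m x -> fam_null m.+1 (d m x).
Proof.
case: m => [|m] nx; first by move=> s _; exact: nx.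
move=> s Is; rewrite /d /dfam /coboundary big1 // => g /asboolP f.
by rewrite nx ?raddf0 ?mul0rz //; exact: interior_facet f Is.
Qed.

Lemma fam_dd m x : S m x -> fam_null m.+2 (d m.+1 (d m x)).
Proof. by move=> Sx s Is; exact: delta_dfam. Qed.

Local Notation Nsp := (Nspan S fam_null fam_act).
Local Notation exact_at := (exact_at S fam_null d fam_act).
Local Notation exact_el := (exact_el S fam_null d fam_act).
Local Notation regular_at := (regular_at S fam_null fam_act).
Local Notation regular_chain := (regular_chain S fam_null fam_act).

Lemma exact_at0 : exact_at [::] 0.
Proof.
move=> x Sx H s; have [g sg gd] := top_exists pureD s.
rewrite -(Sx erefl g s I I sg).
have -> : x g = 0; last by rewrite raddf0.
by apply: H; split; [rewrite addn0|exact: bd_fan_top].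
Qed.

Lemma exact_atS m : sheaf_exact o E m -> exact_at [::] m.+1.
Proof.
move=> ex x _ Hx; have [y [Sy Hy]] := ex x Hx.
by exists y => // s Is; rewrite famB Hy // subrr.
Qed.

(** Cochains obey no compatibility condition, so from index 1 on the quotients are formed stalk by
    stalk. *)
Lemma Nspan_stalks hs k x :
  Nsp hs k.+1 x <-> forall s, interior k s -> lin_span hs (x s : E s).
Proof.
elim: hs x => [|h hs IH] x /=.
  by split=> H s Is; [apply/lin_span_nil; exact: H|apply/lin_span_nil; exact: H].
split.
  by move=> [y _ /IH H] s Is; apply/lin_span_cons; exists (y s); exact: H.
move=> H; have Hy : forall s, exists y : E s, interior k s ->
    lin_span hs (x s - linform (lspan (val s)) h *: y).
  move=> s; have [Is|nI] := pselect (interior k s); last by exists 0.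
  by have /lin_span_cons[y Hy] := H s Is; exists y.
exists (fun s => sval (cid (Hy s))) => //; apply/IH => s Is.
exact: (svalP (cid (Hy s)) Is).
Qed.

End Families.

(** * Exactness, freeness and the equivalences *)

Section Main.
Variables (R : realType) (V : vectType R) (D : fan V) (E : gmod_sheaf D).
Variable o : orientation D.
Local Notation n := (\dim {:V}).
Hypothesis pureD : purely_dim n D.
Hypothesis mesE : minimal_extension_sheaf E.
Implicit Types (x y : fam E) (h g : 'Hom(V, R^o)) (hs gs : seq 'Hom(V, R^o)).

Let S (m : nat) x : Prop := aug_cond m x.
Let d (m : nat) x : fam E := dfam o m x.
Local Notation Nsp := (Nspan S (@fam_null _ _ _ E) (@fam_act _ _ _ E)).
Local Notation exact_at := (exact_at S (@fam_null _ _ _ E) d (@fam_act _ _ _ E)).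
Local Notation exact_el := (exact_el S (@fam_null _ _ _ E) d (@fam_act _ _ _ E)).
Local Notation regular_at := (regular_at S (@fam_null _ _ _ E) (@fam_act _ _ _ E)).
Local Notation regular_chain := (regular_chain S (@fam_null _ _ _ E) (@fam_act _ _ _ E)).
Local Notation sec := (msections E [set: D]%SET).

Let fam_of (Y : sec) : fam E := fun s => sec_val Y s (finset.in_setT s).

Lemma fam_ofE (Y : sec) s hL : fam_of Y s = sec_val Y s hL.
Proof. by congr (sec_val Y s _); exact: Prop_irrelevance. Qed.

Lemma fam_of_act h (Y : sec) : fam_of (linform {:V}%VS h *: Y) = fam_act h (fam_of Y).
Proof.
apply: fam_ext => s.
rewrite -[LHS]/(symres {:V} (lspan (val s)) (linform {:V}%VS h) *: (fam_of Y s : E s)).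
by rewrite symres_linform ?subvf.
Qed.

Lemma fam_of_surj x : S 0 x -> exists Y : sec, fam_of Y = x.
Proof. by move=> /(_ erefl)/aug_section[Y YE]; exists Y; apply: fam_ext => s; exact: YE. Qed.

Lemma Nspan_sections hs (Y : sec) : Nsp hs 0 (fam_of Y) <-> lin_span (U := {:V}%VS) hs Y.
Proof.
elim: hs Y => [|h hs IH] Y /=.
  split=> [H|/lin_span_nil -> //].
  by apply/lin_span_nil/sections_ext => s hL; rewrite -fam_ofE H.
split=> [[_ /fam_of_surj[Z <-]]|/lin_span_cons[Z]].
  by rewrite -fam_of_act => /(IH (Y - _)) HZ; apply/lin_span_cons; exists Z.
move=> /IH HZ; exists (fam_of Z); first by move=> _; exact: section_aug.
by rewrite -fam_of_act.
Qed.

Lemma regular_at_stalks c hs g k : generic_form D c hs g -> (size hs + k < c)%N ->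
  regular_at g hs k.+1.
Proof.
move=> gen kc x _ /Nspan_stalks H; apply/Nspan_stalks => s Is.
have [cf cfP] := free_coords (mes_PF mesE s).
have [|w ww gw] := gen s; first by case: Is => sd _; lia.
exact: (free_regular cfP ww gw (H s Is)).
Qed.

Lemma generic_form_top c hs g : generic_form D c hs g -> (size hs < c)%N ->
  exists2 w, w \in zeros {:V} hs & g w != 0.
Proof.
move=> gen hc; pose o0 : D := FSetSub (set0_fan D).
have [s _ sd] := top_exists pureD o0.
by have := gen s; rewrite (lspan_top sd) sd; apply; lia.
Qed.

Lemma regular_at_free c hs g : free_module sec -> generic_form D c hs g -> (size hs < c)%N ->
  regular_at g hs 0.
Proof.
move=> /free_coords[cf cfP] gen hc _ /fam_of_surj[Y <-].
rewrite -fam_of_act => /Nspan_sections H; apply/Nspan_sections.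
by have [w ww gw] := generic_form_top gen hc; exact: (free_regular cfP ww gw H).
Qed.

(** The tightest condition is at index 0 for the last form, when [p] further forms have been used;
    there freeness of the sections enters. *)
Lemma regular_chain_generic c hs gs p : free_module sec -> generic_seq D c hs gs ->
  size gs = p.+1 -> (size hs + p < c)%N -> regular_chain hs gs p.
Proof.
move=> fr; elim: p hs gs => [|p IH] hs [//|g gs] /= [gg ggs] [sz] hc; split.
- by move=> p'; rewrite leqn0 => /eqP ->; apply: regular_at_free gg _ => //; lia.
- by [].
- move=> [|p'] pp; first by apply: regular_at_free gg _ => //; lia.
  by apply: (regular_at_stalks gg); lia.
by apply: IH => //=; lia.
Qed.

Let exact_cons : forall h hs p, exact_at hs p -> exact_at hs p.+1 -> regular_at h hs p.+2 ->
    exact_at (h :: hs) p :=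
  exact_at_cons (@famS0 _ _ _ E) (@famSB _ _ _ E) (@famSact _ _ _ E)
    (@fam_null0 _ _ _ E) (@fam_nullB _ _ _ E) (@fam_nullact _ _ _ E)
    (@fam_dB _ _ _ E o) (@fam_actB _ _ _ E) (@fam_d_act _ _ _ E o) (@fam_actC _ _ _ E)
    (@famSd _ _ _ E o) (@fam_null_d _ _ _ E o) (@fam_dd _ _ _ E o pureD).

(** The range of exactness shrinks by one with each form divided out and lasts for [n] forms, after
    which their common zero is the origin. *)
Lemma exact_quasi_convex : (forall m, sheaf_exact o E m) -> quasi_convex E.
Proof.
move=> ex.
have W0 : (\dim (0%VS : {vspace V}) + n)%N = n by rewrite dimv0.
have [gs [sz _ gsg]] := generic_seq_exists D W0 n [::].
suff H : forall gs hs, generic_seq D n hs gs -> (size gs + size hs)%N = n ->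
    (forall p, (p + size hs < n)%N -> exact_at hs p) ->
    lin_regular (U := {:V}%VS) sec hs -> (\dim (zeros {:V} hs) + size hs <= n)%N ->
    free_module sec.
  apply: (H gs [::]) => //; first by rewrite addn0.
    by case=> [|p] _; [exact: exact_at0|exact: exact_atS].
  by rewrite addn0.
elim=> [|g gs' IH] hs /=.
  move=> _ hn _ reg zd.
  have [d0 bnd] := sections_bounded mesE [set: D]%SET.
  apply: (graded_regular_free (U := {:V}%VS) (sdegree_grading E [set: D]%SET) _ bnd reg).
    exact: sdegree_scale.
  by lia.
move=> [gg ggs] hn exh reg zd.
have reg1 k : (size hs + k < n)%N -> regular_at g hs k.+1 by apply: regular_at_stalks.
apply: (IH (g :: hs)) => //=; first by lia.
- move=> p pn; apply: exact_cons; [apply: exh; lia|apply: exh; lia|].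
  by apply: reg1; lia.
- split=> // Y /Nspan_sections; rewrite fam_of_act => HY; apply/Nspan_sections.
  apply: (regular_at0 (@fam_dB _ _ _ E o) (@fam_d_act _ _ _ E o) (@famSd _ _ _ E o)
    (@fam_null_d _ _ _ E o) (exh 0%N _) (reg1 0%N _)); [lia|lia| |exact: HY].
  by move=> _; exact: section_aug.
have [|w ww gw] := generic_form_top gg; first by lia.
by have := zeros_dim_cons ww gw; rewrite /=; lia.
Qed.

Lemma quasi_convex_star_exact : quasi_convex E -> forall m u, star_exact o u m.
Proof.
move=> qc m; have [M] := ubnP m; elim: M m => // M IHm m mM u.
have {}IHm m' : (m' < m)%N -> forall v, star_exact o v m' by move=> lt; apply: (IHm); lia.
have [N] := ubnP (n - cone_dim (val u))%N; elim: N u => // N IHu u uN.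
have dimW : (\dim (lspan (val u)) + (n - cone_dim (val u)))%N = n.
  by apply: subnKC; exact/dimvS/subvf.
move: dimW; rewrite -/(cone_dim _); set c := (n - _)%N => dimW.
have {}IHu v : (cone_dim (val u) < cone_dim (val v))%N -> star_exact o v m.
  move=> lt; apply: IHu; have : (cone_dim (val v) <= n)%N by exact/dimvS/subvf.
  by move: uN lt; move: (cone_dim _) (cone_dim _) (\dim _) => *; lia.
(* The star has cones of codimension at most [c] only, so there are no cochains of degree
   [m > c]. *)
have [mc|] := ltnP c m.
  move=> b Hb; exists (fun _ => 0); split=> // s us [sd _].
  have := cone_dimS (valP s) (valP u) us; move: sd mc dimW.
  by move: (cone_dim _) (cone_dim _) c (\dim _) => *; lia.
rewrite leq_eqVlt => /orP[/eqP mc|].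
  case: m mM IHm IHu mc => [|k] mM IHm IHu mc.
    by apply: star_exact_dim0; lia.
  by apply: star_exact_last => //; lia.
rewrite leq_eqVlt => /orP[/eqP mc|mc].
  case: m mM IHm IHu mc => [|k] mM IHm IHu mc.
    by apply: star_exact_dim1 => //; lia.
  by apply: star_exact_rays => //; lia.
move=> b Hb; have [x [xc xu xb]] := class_lift mesE Hb.
apply: xb.
(* A class at index [m.+1] takes [m.+2] forms, available because [m.+1 < c]. *)
have [gs [sz gsW gsg]] := generic_seq_exists D dimW m.+2 [::].
have [||||y Sy Hy] := killed_class_exact (@famS0 _ _ _ E) (@famSB _ _ _ E) (@famSact _ _ _ E)
    (@fam_null0 _ _ _ E) (@fam_nullB _ _ _ E) (@fam_nullact _ _ _ E)
    (@fam_dB _ _ _ E o) (@fam_actB _ _ _ E) (@fam_d_act _ _ _ E o) (@fam_actC _ _ _ E)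
    (@famSd _ _ _ E o) (@fam_null_d _ _ _ E o) (@fam_dd _ _ _ E o pureD)
    (regular_chain_generic qc gsg sz _) _ (xc : Nsp [::] m.+2 (d m.+1 x)).
- by rewrite add0n.
- by [].
- case=> [|p] pm; first exact: exact_at0.
  apply: exact_atS => y Hy; apply: (@star_to_sheaf _ _ _ _ pureD _ mesE _ 0) => // v _.
  by apply: IHm; lia.
- move=> g /gsW gW.
  have [y [Sy Hy]] : exists y, aug_cond m y /\
      forall s, interior m s -> fam_act g x s = dfam o m y s.
    (* The restrictions of [fam_act g x] vanish up to the dimension of [u], so only the stars of
       larger cones enter. *)
    apply: (@star_to_sheaf _ _ _ _ pureD _ mesE m (cone_dim (val u)).+1).
    - exact: IHu.
    - move=> t It; rewrite [LHS](congr1 (@^~ t) (fam_d_act o m.+1 g x)).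
      by rewrite /fam_act [X in _ *: X]xc // scaler0.
    - by move=> s t _ ts td; exact: (xu g s t gW ts td).
  by exists y => // s Is; rewrite famB Hy // subrr.
by exists y; split=> // s Is; have := Hy s Is; rewrite famB => /eqP; rewrite subr_eq0 => /eqP.
Qed.

End Main.

Theorem theorem3p8 (R : realType) (V : vectType R) (D : fan V)
    (pureD : purely_dim (\dim {:V}) D)
    (E : gmod_sheaf D) (mesE : minimal_extension_sheaf E)
    (o : orientation D)
    (oT : forall s : D, orientation (transversal_fan D (val s))) :
  ((forall s : D, reduced_acyclic (oT s) (constant_sheaf (transversal_fan D (val s))))
     <-> reduced_acyclic o (sheaf_of_gmod E))
  /\ (reduced_acyclic o (sheaf_of_gmod E) <-> quasi_convex E).
Proof.
have i_star : (forall s : D, reduced_acyclic (oT s) (constant_sheaf (transversal_fan D (val s))))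
    <-> forall m u, star_exact o u m.
  split=> [H m u|H u]; first exact: ((transversal_acyclicE o pureD (oT u)).1 (H u) m).
  by apply/(transversal_acyclicE o pureD (oT u)) => m; exact: H.
rewrite i_star (sheaf_exactE o pureD).
have star_sheaf : (forall m u, star_exact o u m) <-> forall m, sheaf_exact o E m.
  split=> [H m x Hx|H m u c Hc].
    by apply: (@star_to_sheaf _ _ _ _ pureD _ mesE _ 0) => // u _; exact: H.
  by have [x [xc _ xb]] := class_lift mesE Hc; apply: xb; exact: H.
(* From (iii) the way back to (ii) leads through the star complexes of (i). *)
split=> //; split=> [|/(quasi_convex_star_exact pureD mesE (o := o))/star_sheaf //].
exact: exact_quasi_convex.
Qed.
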